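(* Let $\mu$ be a probability measure on $\mathbb{C}\cong\mathbb{R}^2$ of the form $\mu=\phi(\sqrt{x^2+y^2})\,dx\,dy$ for some $\phi\in C_c^\infty((1,\infty))$. Let $p_n$ be the random polynomial $p_n(z)=\prod_{k=1}^n(z-z_k)$, whose $n$ roots $z_1,\dots,z_n$ are independent and identically distributed according to $\mu$. For every such polynomial $p_n$, consider the Blaschke (inner-outer) factorization $$p_n(z)=p_n(0)+B(z)\cdot G(z),$$ where $B\cdot G$ is the Blaschke factorization of $p_n(z)-p_n(0)$. Then $G$ is a random polynomial whose roots are also distributed according to $\mu$ as $n\to\infty$; that is, the empirical measures of the roots of $G$ converge to $\mu$ in the sense of distributions, in probability, as $n\to\infty$.
   Context: The Blaschke factorization of a polynomial (or entire function) $f\not\equiv 0$ is $f=B\cdot G$ with $$B(z)=\prod_{|\alpha|\le 1,\ f(\alpha)=0}\frac{z-\alpha}{1-\overline{\alpha}z},$$ the product ranging over all roots of $f$ in the unit disk counted with multiplicity, and $G=f/B$, which has no roots inside the unit disk. The empirical measure of the roots of a nonconstant polynomial of degree $m$ is $\frac1m\sum\delta_w$, summed over its roots $w$ with multiplicity. Convergence of random measures to $\mu$ in the sense of distributions, in probability, means that for each $f\in C_c^\infty(\mathbb{C})$ the integrals of $f$ converge in probability to $\int f\,d\mu$. *)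

(* Defs.v *)
From HB Require Import structures.
From mathcomp Require Import all_boot all_order all_algebra.
From mathcomp Require Import complex.
From mathcomp Require Import all_classical all_reals all_analysis.
Set Implicit Arguments.
Unset Strict Implicit.
Unset Printing Implicit Defensive.
Import Order.TTheory GRing.Theory Num.Theory.
Import numFieldNormedType.Exports.
Local Open Scope classical_set_scope.
Local Open Scope complex_scope.
Local Open Scope ring_scope.

(* C is R * R with its product Borel sigma-algebra where measures and test
   functions are concerned, and R[i] where polynomials are concerned.
   measurableTypeR R is R with the structure over which lebesgue_measure is
   defined, so that a single measurable structure on the plane is in use. *)
Notation plane R := (measurableTypeR R * measurableTypeR R)%type.

Definition to_complex (R : realType) (w : plane R) : R[i] := w.1 +i* w.2.

Definition of_complex (R : realType) (z : R[i]) : plane R :=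
  (complex.Re z, complex.Im z).

(* C^oo: every iterated directional derivative exists and is continuous. *)
Definition smooth (R : realType) (V : normedModType R) (f : V -> R) : Prop :=
  forall vs : seq V,
    let g : V -> R := foldr (fun v u => 'D_v u) f vs in
    continuous g /\ forall v x, derivable g x v.

Definition supp (R : realType) (V : normedModType R) (f : V -> R) : set V :=
  closure [set x | f x != 0].

(* C_c^oo(U) for U open; elements are extended by 0 to the whole of V. *)
Definition Cc_infty (R : realType) (V : normedModType R) (U : set V)
    (f : V -> R) : Prop :=
  [/\ smooth f, compact (supp f) & supp f `<=` U].

(* The product rule on subfamilies is the case where some A k are setT. *)
Definition mutually_independent d d' (T : measurableType d)
    (T' : measurableType d') (R : realType) (P : probability T R) (n : nat)
    (X : 'I_n -> {RV P >-> T'}) : Prop :=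
  forall A : 'I_n -> set T', (forall k, measurable (A k)) ->
    P (\bigcap_k (X k @^-1` A k)) = (\prod_(k < n) P (X k @^-1` A k))%E.

(* The X n have to be random variables for the probabilities to be meaningful. *)
Definition converges_in_probability d (T : measurableType d) (R : realType)
    (P : probability T R) (X : nat -> T -> R) (l : R) : Prop :=
  (forall n, measurable_fun setT (X n)) /\
  forall eps : R, 0 < eps ->
    P [set w | eps < `|X n w - l|] @[n --> \oo] --> 0%E.

(* The roots of q with multiplicity; the list is determined up to order when
   q != 0 and carries no information when q = 0. *)
Definition poly_roots (R : realType) (q : {poly R[i]}) : seq R[i] :=
  sval (closed_field_poly_normal q).

(* The zero measure when q has no root, since 0^-1 = 0. *)
Definition empirical_measure (R : realType) (q : {poly R[i]}) :
    {measure set (plane R) -> \bar R} :=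
  mscale ((size (poly_roots q))%:R^-1 : R)%:nng
    (msum (fun k => dirac (of_complex (poly_roots q)`_k)) (size (poly_roots q))).

(* A rational function, hence an element of the field of fractions; a root of
   modulus 1 contributes the unimodular constant - a. *)
Definition blaschke_product (R : realType) (f : {poly R[i]}) :
    {fraction {poly R[i]}} :=
  \prod_(a <- poly_roots f | `|a| <= 1)
    (tofrac ('X - a%:P) / tofrac (1 - (a^*)%C *: 'X)).

Definition blaschke_factorization (R : realType) (f G : {poly R[i]}) : Prop :=
  tofrac f = blaschke_product f * tofrac G.

Definition random_poly d (T : measurableType d) (R : realType)
    (P : probability T R) (n : nat) (Z : 'I_n -> {RV P >-> plane R})
    (w : T) : {poly R[i]} :=
  \prod_(k < n) ('X - (to_complex (Z k w))%:P).

(* Main.v *)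
Require Import Defs.
From HB Require Import structures.
From mathcomp Require Import all_boot all_order all_algebra.
From mathcomp Require Import complex.
From mathcomp Require Import all_classical all_reals all_analysis.
From mathcomp Require Import measurable_realfun ring lra.
Set Implicit Arguments.
Unset Strict Implicit.
Unset Printing Implicit Defensive.
Import Order.TTheory GRing.Theory Num.Theory.
Import numFieldNormedType.Exports.
Local Open Scope classical_set_scope.
Local Open Scope complex_scope.
Local Open Scope ring_scope.

(* Let p be the random polynomial, q = p - p(0) and
   L_(z,r) (x) = ln (max |x - z| r), the mean of ln |x - y| over the circle of
   centre z and radius r.  By Jensen's formula the sum of L_(z,r) over the roots
   of q is the mean of ln |q| over that circle.  Since mu is radial, its
   logarithmic potential is minimal at 0; so with high probability |p(0)| is at
   most e^(n eps) times |p|, up to a truncation near the roots of p, and ln |q|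
   exceeds ln |p| by at most n eps on average.  Conversely, for a fixed x <> 0,
   |q(x)| >= e^(- n eps) |p(x)| with high probability, because given all roots of
   p but one, the opposite inequality confines the last one to a tiny disk.  Hence
   the sums of L_(z,r) over the roots of q and over those of p differ by o(n).
   The functions L_(z,2r) - L_(z,r) are compactly supported bumps whose linear
   combinations are uniformly dense, so that the roots of q are asymptotically
   distributed like those of p, which obey the law of large numbers.
   Passing to the outer factor reflects the roots of the unit disk, which amounts
   to replacing a test function by another one that agrees with it outside the
   unit disk, hence mu-almost everywhere.

   Means over circles are replaced by means over the vertices of regular
   polygons. *)

(** * Regular polygons *)

(** The two inequalities between the potentials use their polygons differently. In the upper bound
    the number [N] of vertices tends to infinity after the roots of [q] are fixed, so its hypothesis
    must hold at all points of a disk at once; truncated logarithms are Lipschitz, and a finite net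
    provides this. The lower bound for [|q|] is available only at finitely many points chosen in
    advance, so there [N] is fixed before the sample, and truncated potentials have to be compared
    with [ln |p|] at the vertices. Polygons suit both purposes because the product of the distances
    from [x] to the vertices is the closed expression [|x^N - s^N|]. They also settle measurability:
    the list of roots of [q] is merely chosen, its measurable trace being the values [|q(x)|], and
    sums over the roots are recovered as limits of combinations of [ln |q(x)|]. Since 0 is always a
    root of [q] and disappears from the outer factor, the empirical measure is normalised by [n]
    minus the multiplicity of 0, which must be shown to be [o(n)]. *)

Lemma ler_sqrW (R : realDomainType) (a b : R) :
  0 <= b -> a ^+ 2 <= b ^+ 2 -> a <= b.
Proof.
move=> b0 ab; rewrite leNgt; apply/negP => ba; nra.
Qed.

(** * The modulus of a complex number as a real number *)

Section modulus.
Variable R : realType.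
Implicit Types x y z : R[i].

Definition cmod z : R := Num.sqrt (complex.Re z ^+ 2 + complex.Im z ^+ 2).

Lemma normr_cmod z : `|z| = (cmod z)%:C.
Proof. exact: normc_def. Qed.

Lemma cmod_ge0 z : 0 <= cmod z.
Proof. exact: sqrtr_ge0. Qed.

Lemma cmod0 : cmod 0 = 0.
Proof. by apply: complexI; rewrite -normr_cmod normr0. Qed.

Lemma cmod1 : cmod 1 = 1.
Proof. by apply: complexI; rewrite -normr_cmod normr1. Qed.

Lemma cmodM x y : cmod (x * y) = cmod x * cmod y.
Proof. by apply: complexI; rewrite rmorphM /= -!normr_cmod normrM. Qed.

Lemma cmodN x : cmod (- x) = cmod x.
Proof. by apply: complexI; rewrite -!normr_cmod normrN. Qed.

Lemma cmodB x y : cmod (x - y) = cmod (y - x).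
Proof. by rewrite -cmodN opprB. Qed.

Lemma cmodX x n : cmod (x ^+ n) = cmod x ^+ n.
Proof. by apply: complexI; rewrite rmorphXn /= -!normr_cmod normrX. Qed.

Lemma cmodV x : cmod x^-1 = (cmod x)^-1.
Proof. by apply: complexI; rewrite fmorphV /= -!normr_cmod normfV. Qed.

Lemma cmodJ x : cmod (x^*)%C = cmod x.
Proof. by apply: complexI; rewrite -!normr_cmod normcJ. Qed.

Lemma cmodC (r : R) : 0 <= r -> cmod r%:C = r.
Proof.
by move=> r0; apply: complexI; rewrite -normr_cmod ger0_norm// ler0c.
Qed.

Lemma cmodD x y : cmod (x + y) <= cmod x + cmod y.
Proof. by rewrite -lecR rmorphD /= -!normr_cmod ler_normD. Qed.

Lemma cmod_eq0 x : (cmod x == 0) = (x == 0).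
Proof.
apply/eqP/eqP => [x0|->]; last exact: cmod0.
by apply/eqP; rewrite -normr_eq0 normr_cmod x0.
Qed.

Lemma cmod_gt0 x : (0 < cmod x) = (x != 0).
Proof. by rewrite lt_def cmod_ge0 andbT cmod_eq0. Qed.

Lemma ler_cmodB x y : cmod x - cmod y <= cmod (x - y).
Proof. by rewrite lerBlDr -{1}[x](subrK y) cmodD. Qed.

Lemma cmod_triangle x y z : cmod (x - z) <= cmod (x - y) + cmod (y - z).
Proof. by rewrite -{1}(subrKA y x (- z)) cmodD. Qed.

Lemma cmod_prod (I : Type) (r : seq I) (F : I -> R[i]) :
  cmod (\prod_(i <- r) F i) = \prod_(i <- r) cmod (F i).
Proof.
by elim/big_rec2: _ => [|i y1 y2 _ <-]; rewrite ?cmod1// cmodM.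
Qed.

Lemma cmod_sqr z : cmod z ^+ 2 = complex.Re z ^+ 2 + complex.Im z ^+ 2.
Proof. by rewrite sqr_sqrtr// addr_ge0// sqr_ge0. Qed.

Lemma ler_Re_cmod z : `|complex.Re z| <= cmod z.
Proof.
by rewrite -(@ler_pXn2r _ 2)// ?nnegrE ?cmod_ge0// cmod_sqr real_normK ?num_real// lerDl sqr_ge0.
Qed.

Lemma ler_Im_cmod z : `|complex.Im z| <= cmod z.
Proof.
by rewrite -(@ler_pXn2r _ 2)// ?nnegrE ?cmod_ge0// cmod_sqr real_normK ?num_real// lerDr sqr_ge0.
Qed.

Lemma cmod_le_ReIm z : cmod z <= `|complex.Re z| + `|complex.Im z|.
Proof.
rewrite -(@ler_pXn2r _ 2)// ?nnegrE ?cmod_ge0 ?addr_ge0// cmod_sqr sqrrD.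
rewrite !real_normK ?num_real// -addrA lerD2l.
by rewrite lerDr mulrn_wge0// mulr_ge0.
Qed.

(** With [<x, y>] the real inner product, the two sides differ by [2 t <x, x - y>], which is
    nonnegative because [|y| <= |x|]. Pushing the outer point outwards thus dominates both the old
    distance and the size of the push. *)
Lemma cmod_scale_sub x y (t : R) : 0 <= t -> cmod y <= cmod x ->
  cmod (x - y) ^+ 2 + (t * cmod x) ^+ 2 <= cmod ((1 + t)%:C * x - y) ^+ 2.
Proof.
move=> t0 yx; rewrite exprMn !cmod_sqr.
have : complex.Re x * complex.Re y + complex.Im x * complex.Im y <=
    complex.Re x ^+ 2 + complex.Im x ^+ 2.
  have xy : complex.Re y ^+ 2 + complex.Im y ^+ 2 <=
      complex.Re x ^+ 2 + complex.Im x ^+ 2.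
    by rewrite -!cmod_sqr ler_sqr ?nnegrE ?cmod_ge0.
  have := sqr_ge0 (complex.Re x - complex.Re y).
  have := sqr_ge0 (complex.Im x - complex.Im y).
  by move: xy; nra.
case: x y {yx} => a b [c d] /= H.
rewrite !(mul0r, subr0, addr0, mulr0).
have := mulr_ge0 t0 (_ : 0 <= a ^+ 2 + b ^+ 2 - (a * c + b * d)).
rewrite subr_ge0 => /(_ H); lra.
Qed.

End modulus.

(** * Logarithms and Bernoulli's inequality *)

Section logarithms.
Variable R : realType.

Lemma ler_lnW (x y : R) : 0 < x -> x <= y -> ln x <= ln y.
Proof. by move=> x0 xy; rewrite ler_ln ?posrE// (lt_le_trans x0). Qed.

Lemma ln_prod (I : eqType) (r : seq I) (F : I -> R) :
  (forall i, i \in r -> 0 < F i) ->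
  ln (\prod_(i <- r) F i) = \sum_(i <- r) ln (F i).
Proof.
elim: r => [|i r IH] F0; first by rewrite !big_nil ln1.
rewrite !big_cons lnM ?posrE ?IH//.
- by move=> j jr; apply: F0; rewrite inE jr orbT.
- by apply: F0; rewrite inE eqxx.
- by rewrite big_seq prodr_gt0// => j jr; apply: F0; rewrite inE jr orbT.
Qed.

Lemma lnX n (x : R) : 0 < x -> ln (x ^+ n) = n%:R * ln x.
Proof. by move=> x0; rewrite lnXn// mulr_natl. Qed.

Lemma ln2_le1 : ln (2 : R) <= 1.
Proof. by have := @le_ln1Dx R 1; rewrite -[1 + 1]/(2); apply; lra. Qed.

Lemma lnD_le (x t : R) : 0 < x -> 0 <= t -> ln ((1 + t) * x) <= ln x + t.
Proof.
move=> x0 t0; rewrite lnM ?posrE//; last by lra.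
by rewrite addrC lerD2l le_ln1Dx//; lra.
Qed.

Lemma bernoulli (t : R) n : 0 <= t -> 1 + n%:R * t <= (1 + t) ^+ n.
Proof.
move=> t0; elim: n => [|n IH]; first by rewrite mul0r addr0 expr0.
rewrite exprS -natr1; have n0 : (0 : R) <= n%:R by [].
by move: IH; set y := (1 + t) ^+ n; nra.
Qed.

Lemma bernoulli2 n : (0 < n)%N -> (2 : R) <= (1 + n%:R^-1) ^+ n.
Proof.
move=> n0; apply: le_trans (bernoulli _ _); last by rewrite invr_ge0.
by rewrite mulfV ?pnatr_eq0 -?lt0n.
Qed.

Lemma exp_1D_inv n : (0 < n)%N -> (1 + n%:R^-1) ^+ n <= expR (1 : R).
Proof.
move=> n0.
have -> : expR (1 : R) = expR (n%:R^-1) ^+ n.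
  by rewrite -expRM_natl mulfV// pnatr_eq0 -lt0n.
by rewrite lerXn2r ?nnegrE ?expR_ge0 ?addr_ge0 ?invr_ge0// expR_ge1Dx.
Qed.

End logarithms.

(* The vertices [u * s] of a regular polygon, [u] ranging over the roots of
   unity, turn the product of the distances to [x] into [x ^ N - s ^ N]. *)
Section polygon.
Variable R : realType.
Implicit Types x s : R[i].

Definition unity (N : nat) : seq R[i] := poly_roots ('X^N - 1).

Lemma unityE N : (0 < N)%N ->
  'X^N - 1 = \prod_(u <- unity N) ('X - u%:P) :> {poly R[i]}.
Proof.
move=> N0; rewrite /unity /poly_roots; case: closed_field_poly_normal => r /= ->.
have := monicXnsubC (1 : R[i]) N0; rewrite monicE => /eqP ->.
by rewrite scale1r.
Qed.

Lemma size_unity N : (0 < N)%N -> size (unity N) = N.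
Proof.
move=> N0; have /(congr1 (fun p : {poly _} => size p)) := unityE N0.
by rewrite size_prod_XsubC size_XnsubC// => -[].
Qed.

Lemma subXX_unity N x s : (0 < N)%N ->
  x ^+ N - s ^+ N = \prod_(u <- unity N) (x - u * s).
Proof.
move=> N0; have [->|s0] := eqVneq s 0.
  rewrite expr0n eqn0Ngt N0 subr0.
  under eq_bigr do rewrite mulr0 subr0.
  by rewrite big_const_seq count_predT size_unity// iter_mulr_1.
have := congr1 (fun p => s ^+ N * p.[x / s]) (unityE N0).
rewrite /= hornerD hornerN hornerXn hornerC mulrBr mulr1 -exprMn.
rewrite mulrCA divff// mulr1 => ->.
rewrite horner_prod -{1}(size_unity N0) -count_predT.
rewrite -iter_mulr_1 -big_const_seq -big_split /=.
apply: eq_bigr => u _.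
by rewrite !hornerE mulrBr mulrCA divff// mulr1 mulrC.
Qed.

Lemma cmod_unity N u : (0 < N)%N -> u \in unity N -> cmod u = 1.
Proof.
move=> N0 uN; have : u ^+ N = 1.
  have := subXX_unity u 1 N0; rewrite (big_rem u)//= mulr1 subrr mul0r expr1n.
  by move/eqP; rewrite subr_eq0 => /eqP.
move=> /(congr1 (@cmod R)); rewrite cmodX cmod1 => /eqP.
by rewrite pexpr_eq1 ?cmod_ge0// -?lt0n// => /eqP.
Qed.

Lemma cmod_subXX_le N x s m : cmod x <= m -> cmod s <= m ->
  cmod (x ^+ N - s ^+ N) <= 2 * m ^+ N.
Proof.
move=> xm sm; have m0 : 0 <= m by apply: le_trans xm; exact: cmod_ge0.
apply: (le_trans (cmodD _ _)); rewrite cmodN !cmodX.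
by rewrite mulr2n mulrDl mul1r lerD// lerXn2r ?nnegrE ?cmod_ge0.
Qed.

Lemma ln_cmod_subXX_le N x s m : 0 < m -> cmod x <= m -> cmod s <= m ->
  x ^+ N != s ^+ N ->
  ln (cmod (x ^+ N - s ^+ N)) <= ln 2 + N%:R * ln m.
Proof.
move=> m0 xm sm xs; apply: (@le_trans _ _ (ln (2 * m ^+ N))).
  by rewrite ler_lnW ?cmod_subXX_le// cmod_gt0 subr_eq0.
by rewrite lnM ?posrE ?exprn_gt0// lnX//.
Qed.

Lemma sum_unity_const N (c : R) : (0 < N)%N ->
  \sum_(u <- unity N) c = N%:R * c.
Proof.
by move=> N0; rewrite big_const_seq count_predT size_unity// iter_addr_0 mulr_natl.
Qed.

(** Push the farther of [x] and [s] outwards by the factor [1 + t] with [t = d / |s|]. By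
    [cmod_scale_sub] every truncated distance is then dominated by a true distance, and the product
    of the true ones is a single [|x'^N - s'^N|], at most [2 ((1 + t) m)^N]. *)
Lemma logmax_polygon_le N x s d : (0 < N)%N -> 0 < d -> 0 < cmod s ->
  \sum_(u <- unity N) ln (Num.max (cmod (x - u * s)) d) <=
  ln 2 + N%:R * (ln (Num.max (cmod x) (cmod s)) + d / cmod s).
Proof.
move=> N0 d0 s0; set t := d / cmod s; set m := Num.max _ (cmod s).
have t0 : 0 < t by rewrite divr_gt0.
have m0 : 0 < m by rewrite lt_max s0 orbT.
have dE : d = t * cmod s by rewrite divfK ?gt_eqF.
have [[x' s'] [x'm s'm xs']] : exists xs : R[i] * R[i],
    [/\ cmod xs.1 <= (1 + t) * m, cmod xs.2 <= (1 + t) * m & forall u, u \in unity N ->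
      Num.max (cmod (x - u * s)) d <= cmod (xs.1 - u * xs.2)].
  have cT : cmod (1 + t)%:C = 1 + t by rewrite cmodC// addr_ge0// ltW.
  have le1t a : 0 <= a -> a <= m -> a <= (1 + t) * m.
    move=> a0 am; apply: (le_trans am).
    by rewrite ler_peMl ?lerDl ?(le_trans a0 am) ?(ltW t0).
  have [xs|sx] := ltP (cmod x) (cmod s).
    have mE : m = cmod s by rewrite /m max_r ?(ltW xs).
    exists (x, (1 + t)%:C * s); split=> /=.
    - by rewrite le1t ?cmod_ge0// mE (ltW xs).
    - by rewrite cmodM cT mE.
    move=> u uN; have us : cmod (u * s) = cmod s by rewrite cmodM (cmod_unity N0)// mul1r.
    have := @cmod_scale_sub _ (u * s) x t (ltW t0); rewrite us (ltW xs) => /(_ isT) H.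
    rewrite cmodB (cmodB x) mulrCA ge_max dE; apply/andP; split.
      by apply: ler_sqrW; [exact: cmod_ge0|rewrite (le_trans _ H)// lerDl sqr_ge0].
    by apply: ler_sqrW; [exact: cmod_ge0|rewrite (le_trans _ H)// lerDr sqr_ge0].
  have mE : m = cmod x by rewrite /m max_l.
  exists ((1 + t)%:C * x, s); split=> /=.
  - by rewrite cmodM cT mE.
  - by rewrite le1t ?cmod_ge0// mE.
  move=> u uN; have us : cmod (u * s) = cmod s by rewrite cmodM (cmod_unity N0)// mul1r.
  have := @cmod_scale_sub _ x (u * s) t (ltW t0); rewrite us sx => /(_ isT) H.
  rewrite ge_max dE; apply/andP; split.
    by apply: ler_sqrW; [exact: cmod_ge0|rewrite (le_trans _ H)// lerDl sqr_ge0].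
  apply: (@le_trans _ _ (t * cmod x)); first by rewrite ler_wpM2l// ltW.
  by apply: ler_sqrW; [exact: cmod_ge0|rewrite (le_trans _ H)// lerDr sqr_ge0].
have M0 u : 0 < Num.max (cmod (x - u * s)) d by rewrite lt_max d0 orbT.
rewrite -ln_prod//.
apply: (@le_trans _ _ (ln (2 * ((1 + t) * m) ^+ N))).
  apply: ler_lnW; first by rewrite prodr_gt0.
  apply: le_trans (cmod_subXX_le N x'm s'm).
  rewrite subXX_unity// cmod_prod big_seq [leRHS]big_seq.
  by apply: ler_prod => u uN; rewrite xs'// ltW.
have tm0 : 0 < (1 + t) * m by rewrite mulr_gt0// addr_gt0.
rewrite lnM ?posrE ?exprn_gt0// lnX// lerD2l.
by rewrite ler_wpM2l// lnD_le// ltW.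
Qed.

(** Here the farther point is pushed by the factor [1 + 1/N]: this at least doubles its [N]-th
    power, so that [|x'^N - s'^N| >= m^N]. Each distance grows by at most [B / N], hence each
    truncated distance by a factor at most [1 + B / (N d)]; the [N] factors together cost
    [B / d]. *)
Lemma logmax_polygon_ge N x s d B : (0 < N)%N -> 0 < d ->
  0 < cmod s -> cmod s <= B -> cmod x <= B ->
  N%:R * ln (Num.max (cmod x) (cmod s)) <=
  \sum_(u <- unity N) ln (Num.max (cmod (x - u * s)) d) + B / d.
Proof.
move=> N0 d0 s0 sB xB; set m := Num.max _ (cmod s).
have m0 : 0 < m by rewrite lt_max s0 orbT.
have mB : m <= B by rewrite ge_max xB.
set t : R := N%:R^-1.
have t0 : 0 < t by rewrite invr_gt0 ltr0n.
have M0 u : 0 < Num.max (cmod (x - u * s)) d by rewrite lt_max d0 orbT.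
have cT : cmod (1 + t)%:C = 1 + t by rewrite cmodC// addr_ge0// ltW.
have tC : cmod t%:C = t by rewrite cmodC// ltW.
have tE : (1 + t)%:C = 1 + t%:C by rewrite rmorphD.
have le_max_shift a b : 0 <= a -> b <= t * m ->
    a + b <= (1 + t * B / d) * Num.max a d.
  move=> a0 bt; set M := Num.max a d.
  have aM : a <= M by rewrite le_max lexx.
  have dM : d <= M by rewrite le_max lexx orbT.
  rewrite mulrDl mul1r lerD// (le_trans bt)//.
  apply: (@le_trans _ _ (t * B)); first by rewrite ler_wpM2l// ltW.
  rewrite -[t * B / d * M]mulrA ler_peMr//.
    by rewrite mulr_ge0 ?(ltW t0)// (le_trans _ mB)// ltW.
  by rewrite mulrC ler_pdivlMr// mul1r.
have [[x' s'] [xs'm xs']] : exists xs : R[i] * R[i],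
    m ^+ N <= cmod (xs.1 ^+ N - xs.2 ^+ N) /\ forall u, u \in unity N ->
      cmod (xs.1 - u * xs.2) <=
      (1 + t * B / d) * Num.max (cmod (x - u * s)) d.
  have gap a b : 0 <= b -> b <= a -> a ^+ N <= ((1 + t) * a) ^+ N - b ^+ N.
    move=> b0 ba; have a0 := le_trans b0 ba.
    rewrite lerBrDr exprMn.
    apply: (@le_trans _ _ (2 * a ^+ N)).
      by rewrite mulr2n mulrDl mul1r lerD2l lerXn2r.
    by rewrite ler_wpM2r ?exprn_ge0// bernoulli2.
  have [xs|sx] := ltP (cmod x) (cmod s).
    have mE : m = cmod s by rewrite /m max_r ?(ltW xs).
    exists (x, (1 + t)%:C * s); split=> /=.
      rewrite cmodB; apply: le_trans (ler_cmodB _ _); rewrite !cmodX cmodM cT mE.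
      by rewrite gap ?cmod_ge0// (ltW xs).
    move=> u uN.
    have -> : x - u * ((1 + t)%:C * s) = (x - u * s) + (- (t%:C * (u * s))).
      by rewrite tE; ring.
    apply: le_trans (cmodD _ _) _; rewrite cmodN.
    rewrite le_max_shift ?cmod_ge0//.
    by rewrite !cmodM (cmod_unity N0 uN) mul1r tC mE.
  have mE : m = cmod x by rewrite /m max_l.
  exists ((1 + t)%:C * x, s); split=> /=.
    apply: le_trans (ler_cmodB _ _); rewrite !cmodX cmodM cT mE.
    by rewrite gap ?cmod_ge0.
  move=> u uN.
  have -> : (1 + t)%:C * x - u * s = (x - u * s) + t%:C * x.
    by rewrite tE; ring.
  apply: le_trans (cmodD _ _) _; rewrite le_max_shift ?cmod_ge0//.
  by rewrite cmodM tC mE.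
have tBd0 : 0 <= t * B / d.
  by rewrite divr_ge0 ?(ltW d0)// mulr_ge0 ?(ltW t0)// (le_trans _ mB)// ltW.
have tBd1 : 0 < 1 + t * B / d by lra.
have : ln (m ^+ N) <= ln (\prod_(u <- unity N)
    ((1 + t * B / d) * Num.max (cmod (x - u * s)) d)).
  apply: ler_lnW; first by rewrite exprn_gt0.
  apply: (le_trans xs'm).
  rewrite /= subXX_unity// cmod_prod big_seq [leRHS]big_seq.
  by apply: ler_prod => u uN; rewrite xs'// cmod_ge0.
rewrite lnX// => /le_trans; apply.
rewrite ln_prod; last by move=> u _; rewrite mulr_gt0.
apply: (@le_trans _ _ (\sum_(u <- unity N)
    (ln (Num.max (cmod (x - u * s)) d) + t * B / d))).
  apply: ler_sum => u _; exact: lnD_le.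
rewrite big_split /= lerD2l sum_unity_const//.
by rewrite /t !mulrA mulfV ?mul1r// pnatr_eq0 gtn_eqF.
Qed.

(* Radii slightly larger than [r] keep the vertices away from [x], even if
   [cmod x = r]. *)
Lemma polygon_jensen r x : 0 < r -> exists N0, forall N, (N0 <= N)%N ->
  (0 < N)%N /\ let s := (r * (1 + N%:R^-1))%:C in
  x ^+ N != s ^+ N /\
  `|ln (cmod (x ^+ N - s ^+ N)) - N%:R * ln (Num.max (cmod x) r)| <= 2.
Proof.
move=> r0.
have e0 : 0 < expR (1 : R) by exact: expR_gt0.
have [xr|rx] := leP (cmod x) r.
  exists 1%N => N N0; split=> //=.
  set t : R := N%:R^-1; have t0 : 0 < t by rewrite invr_gt0 ltr0n.
  have rt0 : 0 < r * (1 + t) by rewrite mulr_gt0// addr_gt0.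
  have cs : cmod (r * (1 + t))%:C = r * (1 + t) by rewrite cmodC// ltW.
  have lo : r ^+ N <= cmod (x ^+ N - (r * (1 + t))%:C ^+ N).
    rewrite cmodB; apply: le_trans (ler_cmodB _ _); rewrite !cmodX cs lerBrDr.
    rewrite exprMn; apply: (@le_trans _ _ (r ^+ N * 2)); last first.
      by rewrite ler_wpM2l ?exprn_ge0 ?(ltW r0)// bernoulli2.
    by rewrite mulr_natr mulr2n lerD2l lerXn2r ?nnegrE ?cmod_ge0// ltW.
  have xs : x ^+ N != (r * (1 + t))%:C ^+ N.
    by rewrite -subr_eq0 -cmod_gt0 (lt_le_trans _ lo)// exprn_gt0.
  split => //.
  have hi := ln_cmod_subXX_le rt0 _ _ xs.
  rewrite cs lexx in hi; have {hi} := hi _ isT.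
  rewrite (le_trans xr); last by rewrite ler_peMr ?lerDl ?(ltW r0) ?(ltW t0).
  move=> /(_ isT) hi.
  have {lo} := ler_lnW (exprn_gt0 N r0) lo; rewrite lnX// => lo.
  have hi2 : N%:R * ln (r * (1 + t)) <= N%:R * ln r + 1.
    have Nt : N%:R * t = 1 by rewrite /t mulfV// pnatr_eq0 gtn_eqF.
    have H : ln (r * (1 + t)) <= ln r + t by rewrite mulrC lnD_le// ltW.
    by have := ler_wpM2l (ler0n R N) H; rewrite [X in _ <= X]mulrDr Nt.
  rewrite ler_norml.
  have := ln2_le1 R; lra.
have x0 : 0 < cmod x by rewrite (lt_trans r0).
pose h := cmod x / r - 1.
have h0 : 0 < h by rewrite /h subr_gt0 ltr_pdivlMr// mul1r.
have xE : cmod x = r * (1 + h) by rewrite /h addrC subrK mulrC divfK// gt_eqF.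
(* From here on [(1 + h)^N >= N h > 2 e >= 2 (1 + 1/N)^N], so [|x|^N] is at least twice [|s|^N] and
   the difference keeps half of it. *)
exists (Num.truncn (2 * expR 1 / h)).+1 => N N0.
have Nbig : 2 * expR 1 < N%:R * h.
  rewrite -ltr_pdivrMr//; apply: lt_le_trans (truncnS_gt _) _.
  by rewrite ler_nat.
have {}N0 : (0 < N)%N by case: (N) N0.
split=> //=.
set t : R := N%:R^-1; have t0 : 0 < t by rewrite invr_gt0 ltr0n.
have rt0 : 0 < r * (1 + t) by rewrite mulr_gt0// addr_gt0.
have cs : cmod (r * (1 + t))%:C = r * (1 + t) by rewrite cmodC// ltW.
have half : 2 * (r * (1 + t)) ^+ N <= cmod x ^+ N.
  rewrite xE !exprMn mulrCA ler_wpM2l ?exprn_ge0 ?(ltW r0)//.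
  apply: (@le_trans _ _ (2 * expR 1)); first by rewrite ler_wpM2l// exp_1D_inv.
  apply: le_trans (bernoulli _ (ltW h0)); lra.
have lo : cmod x ^+ N / 2 <= cmod (x ^+ N - (r * (1 + t))%:C ^+ N).
  apply: le_trans (ler_cmodB _ _); rewrite !cmodX cs; lra.
have xN0 : 0 < cmod x ^+ N by rewrite exprn_gt0.
have xs : x ^+ N != (r * (1 + t))%:C ^+ N.
  by rewrite -subr_eq0 -cmod_gt0 (lt_le_trans _ lo)// divr_gt0.
split=> //.
have hi := ln_cmod_subXX_le x0 (lexx _) _ xs; rewrite cs in hi.
have {}hi : ln (cmod (x ^+ N - (r * (1 + t))%:C ^+ N)) <= ln 2 + N%:R * ln (cmod x).
  apply: hi; rewrite -(@ler_pXn2r _ N)// ?nnegrE ?ltW//.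
  by rewrite (lt_le_trans _ half)// ltr_pMl ?exprn_gt0// ltr1n.
have {lo} := ler_lnW (divr_gt0 xN0 (ltr0Sn _ 1)) lo.
rewrite ln_div ?posrE// lnX// => lo.
rewrite ler_norml.
have := ln2_le1 R; lra.
Qed.

End polygon.

(** * Logarithmic sums over the roots of [p] and of [p - p(0)] *)

Section root_potentials.
Variable R : realType.
Implicit Types (x s z : R[i]) (zs qs : seq R[i]).

Definition logmax (r : R) (x : R[i]) : R := ln (Num.max (cmod x) r).

Definition shifted_roots zs qs : Prop := forall x,
  \prod_(a <- qs) (x - a) =
  \prod_(z <- zs) (x - z) - \prod_(z <- zs) (0 - z).

Lemma sum_const_seq (I : Type) (r : seq I) (c : R) :
  \sum_(i <- r) c = (size r)%:R * c.
Proof. by rewrite big_const_seq count_predT iter_addr_0 mulr_natl. Qed.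

Lemma le_of_mul_natP (x y c : R) N0 :
  (forall N, (N0 <= N)%N -> N%:R * x <= N%:R * y + c) -> x <= y.
Proof.
move=> H; rewrite leNgt; apply/negP => yx.
have g0 : 0 < x - y by rewrite subr_gt0.
have := H (N0 + (Num.truncn (`|c| / (x - y))).+1)%N (leq_addr _ _).
set N := (_ + _)%N => HN.
have : `|c| < N%:R * (x - y).
  rewrite -ltr_pdivrMr//; apply: (lt_le_trans (truncnS_gt _)).
  by rewrite ler_nat leq_addl.
have := ler_norm c; rewrite mulrBr; lra.
Qed.

Lemma prod_polygon qs z0 s N : (0 < N)%N ->
  \prod_(u <- unity R N) cmod (\prod_(a <- qs) (z0 + u * s - a)) =
  \prod_(a <- qs) cmod ((a - z0) ^+ N - s ^+ N).
Proof.
move=> N0; under eq_bigr do rewrite cmod_prod.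
rewrite exchange_big /=; apply: eq_bigr => a _.
rewrite subXX_unity// cmod_prod; apply: eq_bigr => u _.
by rewrite cmodB opprD addrA.
Qed.

(** Discrete form of Jensen's formula: the error does not grow with [N], while the main term is
    multiplied by [N]. The threshold [N0] depends on how close the roots come to the circle, so it
    is available only once [qs] is fixed. *)
Lemma jensen_roots qs z0 r : 0 < r -> exists N0, forall N, (N0 <= N)%N ->
  (0 < N)%N /\ let s := (r * (1 + N%:R^-1))%:C in
  (forall u, u \in unity R N -> \prod_(a <- qs) (z0 + u * s - a) != 0) /\
  `|\sum_(u <- unity R N) ln (cmod (\prod_(a <- qs) (z0 + u * s - a))) -
    N%:R * \sum_(a <- qs) logmax r (a - z0)| <= 2 * (size qs)%:R.
Proof.
move=> r0.
have [N0 HN0] : exists N0, forall N, (N0 <= N)%N ->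
  (0 < N)%N /\ let s := (r * (1 + N%:R^-1))%:C in
  (forall a, a \in qs -> (a - z0) ^+ N != s ^+ N) /\
  `|\sum_(a <- qs) ln (cmod ((a - z0) ^+ N - s ^+ N)) -
    N%:R * \sum_(a <- qs) logmax r (a - z0)| <= 2 * (size qs)%:R.
  elim: qs => [|a qs [N1 IH]].
    by exists 1%N => N N1; split=> //=; rewrite !big_nil mulr0 subrr normr0 mulr0.
  have [N2 H2] := polygon_jensen (a - z0) r0.
  exists (maxn N1 N2) => N; rewrite geq_max => /andP[/IH[N0 [/= H1 H1']] /H2[_ [H3 H3']]].
  split=> //=; move: H1 H1' H3 H3'; set s := (r * _)%:C => H1 H1' H3 H3'.
  split=> [b|].
    by rewrite inE => /orP[/eqP ->//|/H1].
  rewrite !big_cons mulrDr opprD addrACA (le_trans (ler_normD _ _))//.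
  by rewrite -[(size qs).+1]add1n natrD mulrDr mulr1 lerD.
exists N0 => N /HN0 [N_gt0 /=]; set s := (r * _)%:C => -[H1 H2].
have q0 a : a \in qs -> 0 < cmod ((a - z0) ^+ N - s ^+ N).
  by move=> aq; rewrite cmod_gt0 subr_eq0 H1.
have P0 : \prod_(a <- qs) cmod ((a - z0) ^+ N - s ^+ N) != 0.
  by rewrite gt_eqF// big_seq prodr_gt0.
have Hu u : u \in unity R N -> \prod_(a <- qs) (z0 + u * s - a) != 0.
  move=> uN; apply: contra P0 => /eqP u0.
  by rewrite -prod_polygon// (big_rem u)//= u0 cmod0 mul0r.
split=> //; split=> //.
rewrite -ln_prod; last by move=> u /Hu; rewrite cmod_gt0.
by rewrite prod_polygon// ln_prod.
Qed.

(** * Upper bound for the potential of the roots of the shifted polynomial *)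

Section upper.
Variables (zs qs : seq R[i]) (z0 : R[i]) (r d e : R).
Hypotheses (r0 : 0 < r) (d0 : 0 < d) (e0 : 0 <= e).
Hypotheses (zqs : shifted_roots zs qs) (szq : size qs = size zs).
Hypothesis zs0 : forall z, z \in zs -> z != 0.
Hypothesis Hlow : forall x, cmod x <= cmod z0 + 2 * r ->
  \sum_(z <- zs) ln (cmod z) <=
  \sum_(z <- zs) logmax d (z - x) + (size zs)%:R * e.

(** Both terms of [q(x) = p(x) - p(0)] are at most the same exponential, [|p(x)|] because truncation
    only increases distances and [|p(0)|] by [Hlow]. Adding them costs [ln 2]. *)
Let logq_le x : cmod x <= cmod z0 + 2 * r -> \prod_(a <- qs) (x - a) != 0 ->
  ln (cmod (\prod_(a <- qs) (x - a))) <=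
  ln 2 + \sum_(z <- zs) logmax d (z - x) + (size zs)%:R * e.
Proof.
move=> xB qx0; set V := _ + _ * e.
rewrite -[leRHS]expRK; apply: ler_lnW; first by rewrite cmod_gt0.
rewrite zqs (le_trans (cmodD _ _))// cmodN.
have -> : expR V = 2 * expR (\sum_(z <- zs) logmax d (z - x) + (size zs)%:R * e).
  by rewrite /V -addrA expRD lnK ?posrE.
rewrite mulr2n mulrDl mul1r lerD// cmod_prod.
  apply: (@le_trans _ _ (expR (\sum_(z <- zs) logmax d (z - x)))); last first.
    by rewrite ler_expR lerDl mulr_ge0.
  rewrite expR_sum ler_prod// => z _; rewrite cmod_ge0 /logmax /=.
  by rewrite lnK ?posrE ?lt_max ?d0 ?orbT// cmodB le_max lexx.
apply: le_trans (_ : expR (\sum_(z <- zs) ln (cmod z)) <= _); last first.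
  by rewrite ler_expR Hlow.
rewrite expR_sum big_seq [leRHS]big_seq ler_prod// => z zz.
by rewrite cmod_ge0 sub0r cmodN lnK ?lexx// posrE cmod_gt0 zs0.
Qed.

(** Average [logq_le] over the polygon of radius [r (1 + 1/N) <= 2 r] and apply Jensen's formula to
    the left side and [logmax_polygon_le] to the right. As [qs] is fixed, [N] may tend to infinity,
    which removes every error bounded independently of [N]; only the truncation error [d / r] per
    root remains. *)
Lemma roots_upper : \sum_(a <- qs) logmax r (a - z0) <=
  \sum_(z <- zs) logmax r (z - z0) + (size zs)%:R * (e + d / r) + ln 2.
Proof.
have [N0 HN] := jensen_roots qs z0 r0.
apply: (@le_of_mul_natP _ _ ((size zs)%:R * 4) N0) => N /HN [N_gt0 /=].
set t : R := N%:R^-1; have t0 : 0 < t by rewrite invr_gt0 ltr0n.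
have t1 : t <= 1 by rewrite invf_le1 ?ltr0n// ler1n.
have Nt : N%:R * t = 1 by rewrite /t mulfV// pnatr_eq0 gtn_eqF.
have rt0 : 0 < r * (1 + t) by rewrite mulr_gt0// addr_gt0.
set s := (r * _)%:C => -[Hu].
have cs : cmod s = r * (1 + t) by rewrite cmodC// ltW.
rewrite szq ler_norml => /andP[H1 _].
have H2 : \sum_(u <- unity R N) ln (cmod (\prod_(a <- qs) (z0 + u * s - a))) <=
   N%:R * (ln 2 + (size zs)%:R * e) +
   \sum_(z <- zs) \sum_(u <- unity R N) ln (Num.max (cmod ((z - z0) - u * s)) d).
  rewrite -sum_unity_const// exchange_big -big_split /=.
  rewrite big_seq [leRHS]big_seq; apply: ler_sum => u uN.
  apply: le_trans (logq_le _ (Hu u uN)) _.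
    apply: (le_trans (cmodD _ _)); rewrite lerD2l cmodM (cmod_unity N_gt0 uN) mul1r cs.
    by rewrite mulrC ler_pM2r//; lra.
  rewrite [leRHS]addrAC lerD2r// lerD2l; apply: ler_sum => z _.
  by rewrite /logmax opprD addrA.
have H3 : \sum_(z <- zs) \sum_(u <- unity R N) ln (Num.max (cmod ((z - z0) - u * s)) d)
   <= \sum_(z <- zs) (N%:R * (logmax r (z - z0) + d / r) + 2).
  apply: ler_sum => z _.
  apply: le_trans (logmax_polygon_le (z - z0) N_gt0 d0 _) _; first by rewrite cs.
  have sr : r <= cmod s by rewrite cs ler_peMr ?(ltW r0)// lerDl ltW.
  have ds : d / cmod s <= d / r.
    by rewrite ler_pM2l// lef_pV2// posrE// (lt_le_trans r0).
  have lm : ln (Num.max (cmod (z - z0)) (cmod s)) <= logmax r (z - z0) + t.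
    apply: le_trans (lnD_le _ (ltW t0)); last by rewrite lt_max r0 orbT.
    apply: ler_lnW; first by rewrite lt_max (lt_le_trans r0 sr) orbT.
    rewrite ge_max; apply/andP; split.
      apply: (@le_trans _ _ (Num.max (cmod (z - z0)) r)); first by rewrite le_max lexx.
      by rewrite ler_peMl ?lerDl ?(ltW t0)// le_max (ltW r0) orbT.
    by rewrite cs mulrC ler_wpM2l ?addr_ge0 ?(ltW t0)// le_max lexx orbT.
  have := ler_wpM2l (ler0n R N) (lerD lm ds).
  have := ln2_le1 R.
  rewrite addrAC [X in _ -> X <= _ -> _]mulrDr [X in _ -> _ <= X -> _]mulrDr Nt.
  rewrite [X in _ -> _ -> _ + X <= _]mulrDr; lra.
rewrite big_split /= sum_const_seq -mulr_sumr big_split /= sum_const_seq in H3.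
have n0 : (0 : R) <= (size zs)%:R by [].
have := ln2_le1 R; rewrite !mulrDr in H1 H2 H3 *; lra.
Qed.

End upper.

(** * Lower bound on a polygon fixed in advance *)

Section lower.
Variables (zs qs : seq R[i]) (z0 s : R[i]) (d e B : R) (N : nat).
Hypotheses (N0 : (0 < N)%N) (s0 : 0 < cmod s) (d0 : 0 < d).
Hypotheses (zqs : shifted_roots zs qs) (szq : size qs = size zs).
Hypothesis sB : cmod s <= B.
Hypothesis zsB : forall z, z \in zs -> cmod (z - z0) <= B.
Hypothesis zsv : forall u z, u \in unity R N -> z \in zs -> z0 + u * s != z.
Hypothesis Hq : forall u, u \in unity R N ->
  expR (- ((size zs)%:R * e)) * cmod (\prod_(z <- zs) (z0 + u * s - z)) <=
  cmod (\prod_(z <- zs) (z0 + u * s - z) - \prod_(z <- zs) (0 - z)).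
Hypothesis Hd : \sum_(u <- unity R N) \sum_(z <- zs)
  (logmax d (z0 + u * s - z) - ln (cmod (z0 + u * s - z))) <=
  N%:R * ((size zs)%:R * e).

(** The chain goes from the potential of [zs] to its truncated polygon sum ([H1]), then to [ln |p|]
    by [Hd], to [ln |q|] by [Hq], and to the potential of [qs]. The last step uses only the upper
    bound [|x^N - s^N| <= 2 m^N], so roots of [q] near the vertices do no harm, and [Hq] itself
    prevents them from being vertices. *)
Lemma roots_lower : N%:R * \sum_(z <- zs) logmax (cmod s) (z - z0) <=
  N%:R * (\sum_(a <- qs) logmax (cmod s) (a - z0) + 2 * ((size zs)%:R * e)) +
  (size zs)%:R * (1 + B / d).
Proof.
have pv0 u : u \in unity R N -> 0 < cmod (\prod_(z <- zs) (z0 + u * s - z)).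
  move=> uN; rewrite cmod_prod big_seq prodr_gt0// => z zz.
  by rewrite cmod_gt0 subr_eq0 zsv.
have qv0 u : u \in unity R N -> 0 < cmod (\prod_(a <- qs) (z0 + u * s - a)).
  move=> uN; rewrite zqs; apply: lt_le_trans (Hq uN).
  by rewrite mulr_gt0 ?expR_gt0 ?pv0.
have H1 : N%:R * \sum_(z <- zs) logmax (cmod s) (z - z0) <=
   \sum_(u <- unity R N) \sum_(z <- zs) logmax d (z0 + u * s - z) +
   (size zs)%:R * (B / d).
  rewrite exchange_big /= -sum_const_seq -big_split mulr_sumr /=.
  rewrite big_seq [leRHS]big_seq; apply: ler_sum => z zz.
  apply: le_trans (logmax_polygon_ge N0 d0 s0 sB (zsB zz)) _.
  rewrite lerD2r; apply: ler_sum => u _.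
  have -> : z - z0 - u * s = - (z0 + u * s - z) by ring.
  by rewrite cmodN.
have H2 : \sum_(u <- unity R N) \sum_(z <- zs) logmax d (z0 + u * s - z) <=
    \sum_(u <- unity R N) ln (cmod (\prod_(z <- zs) (z0 + u * s - z))) +
    N%:R * ((size zs)%:R * e).
  rewrite -lerBlDl; apply: le_trans Hd.
  rewrite -sumrB big_seq [leRHS]big_seq; apply: ler_sum => u uN.
  rewrite sumrB lerD2l lerN2 cmod_prod ln_prod// => z zz.
  by rewrite cmod_gt0 subr_eq0 zsv.
have H3 : \sum_(u <- unity R N) ln (cmod (\prod_(z <- zs) (z0 + u * s - z))) <=
    \sum_(u <- unity R N) ln (cmod (\prod_(a <- qs) (z0 + u * s - a))) +
    N%:R * ((size zs)%:R * e).
  rewrite -sum_unity_const// -big_split /=.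
  rewrite big_seq [leRHS]big_seq; apply: ler_sum => u uN.
  rewrite -lerBlDr -[_ - _]expRK; apply: ler_lnW; first exact: expR_gt0.
  by rewrite zqs expRD lnK ?posrE ?pv0// mulrC Hq.
have P0 : 0 < \prod_(a <- qs) cmod ((a - z0) ^+ N - s ^+ N).
  by rewrite -prod_polygon// big_seq prodr_gt0.
have a0 a : a \in qs -> (a - z0) ^+ N != s ^+ N.
  move=> aq; apply: contraTneq P0 => a0.
  by rewrite (big_rem a)//= a0 subrr cmod0 mul0r ltxx.
have H4 : \sum_(u <- unity R N) ln (cmod (\prod_(a <- qs) (z0 + u * s - a))) <=
    N%:R * \sum_(a <- qs) logmax (cmod s) (a - z0) + (size zs)%:R.
  rewrite -ln_prod// prod_polygon// ln_prod; last first.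
    by move=> a aq; rewrite cmod_gt0 subr_eq0 a0.
  rewrite -[X in _ + X]mulr1 -szq -sum_const_seq mulr_sumr -big_split /=.
  rewrite big_seq [leRHS]big_seq; apply: ler_sum => a aq.
  have := @ln_cmod_subXX_le _ N (a - z0) s (Num.max (cmod (a - z0)) (cmod s)).
  rewrite lt_max s0 orbT !le_max !lexx orbT => /(_ isT isT isT (a0 a aq)).
  by have := ln2_le1 R; rewrite /logmax; lra.
move: H1 H2 H3 H4; set n : R := (size zs)%:R.
rewrite !mulrDr mulr1; lra.
Qed.

End lower.
End root_potentials.

(** * Uniform density of the logarithmic potentials *)

Section logarithmic_span.
Variable R : realType.
Implicit Types (x y z : R[i]) (f g F : R[i] -> R).

Lemma logmax_lipschitz (r : R) x y : 0 < r ->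
  logmax r x <= logmax r y + cmod (x - y) / r.
Proof.
move=> r0; have m0 z : 0 < Num.max (cmod z) r by rewrite lt_max r0 orbT.
have h0 : 0 <= cmod (x - y) / r by rewrite divr_ge0 ?cmod_ge0// ltW.
apply: le_trans (lnD_le (m0 y) h0); apply: ler_lnW => //.
set M := Num.max (cmod y) r.
have yM : cmod y <= M by rewrite le_max lexx.
have rM : r <= M by rewrite le_max lexx orbT.
have hM : cmod (x - y) <= cmod (x - y) / r * M.
  by rewrite -mulrA ler_peMr ?cmod_ge0// mulrC ler_pdivlMr// mul1r.
rewrite mulrDl mul1r ge_max; apply/andP; split.
  by rewrite -[x in cmod x](subrK y) addrC (le_trans (cmodD _ _))// lerD.
by rewrite (le_trans rM)// lerDl mulr_ge0// ltW// m0.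
Qed.

Lemma dist_logmax (r : R) x y : 0 < r ->
  `|logmax r x - logmax r y| <= cmod (x - y) / r.
Proof.
move=> r0; have := logmax_lipschitz x y r0; have := logmax_lipschitz y x r0.
by rewrite (cmodB y) ler_norml; lra.
Qed.

Inductive logspan : (R[i] -> R) -> Prop :=
| logspan0 : logspan (fun=> 0)
| logspanD (c r : R) z f : 0 < r -> logspan f ->
    logspan (fun x => c * logmax r (x - z) + f x).

Lemma logspan_add f g : logspan f -> logspan g ->
  logspan (fun x => f x + g x).
Proof.
move=> + lg; elim=> [|c r z h r0 _ IH].
  by under eq_fun do rewrite add0r.
by under eq_fun do rewrite -addrA; exact: logspanD.
Qed.

Lemma logspan_scale (a : R) f : logspan f -> logspan (fun x => a * f x).
Proof.
elim=> [|c r z h r0 _ IH].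
  by under eq_fun do rewrite mulr0; exact: logspan0.
by under eq_fun do rewrite mulrDr mulrA; exact: logspanD.
Qed.

Lemma logspan_sum (I : Type) (s : seq I) (G : I -> R[i] -> R) :
  (forall i, logspan (G i)) -> logspan (fun x => \sum_(i <- s) G i x).
Proof.
move=> lG; elim: s => [|i s IH].
  by under eq_fun do rewrite big_nil; exact: logspan0.
by under eq_fun do rewrite big_cons; exact: logspan_add.
Qed.

Definition tent (r : R) x : R := logmax (2 * r) x - logmax r x.

Lemma logspan_tent r z : 0 < r -> logspan (fun x => tent r (x - z)).
Proof.
move=> r0; have r20 : 0 < 2 * r by rewrite mulr_gt0.
have := logspanD 1 z r20 (logspanD (-1) z r0 logspan0).
by under eq_fun do rewrite mul1r mulN1r addr0.
Qed.

Lemma tent_ge0 r x : 0 < r -> 0 <= tent r x.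
Proof.
move=> r0; rewrite subr_ge0; apply: ler_lnW; first by rewrite lt_max r0 orbT.
rewrite ge_max !le_max lexx /=; apply/orP; right; lra.
Qed.

Lemma tent_le r x : 0 < r -> tent r x <= ln 2.
Proof.
move=> r0; rewrite lerBlDr -lnM ?posrE ?lt_max ?r0 ?orbT//.
apply: ler_lnW; first by rewrite lt_max mulr_gt0// orbT.
rewrite ge_max; apply/andP; split; last by rewrite ler_pM2l// le_max lexx orbT.
apply: (@le_trans _ _ (2 * cmod x)); last by rewrite ler_pM2l// le_max lexx.
by rewrite ler_peMl ?cmod_ge0// ler1n.
Qed.

Lemma tent_in r x : 0 < r -> cmod x <= r -> tent r x = ln 2.
Proof.
move=> r0 xr; rewrite /tent /logmax max_r; last by lra.
by rewrite max_r// lnM ?posrE// addrK.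
Qed.

Lemma tent_out r x : 0 < r -> 2 * r <= cmod x -> tent r x = 0.
Proof.
move=> r0 xr; rewrite /tent /logmax max_l// max_l ?subrr//; lra.
Qed.

(** A class of test functions stable under the reflection in the unit disk: that map has a kink on
    the unit circle, which destroys smoothness but not uniform continuity. *)
Record nice F : Prop := Nice {
  nice_supp : exists B, forall x, B < cmod x -> F x = 0;
  nice_bounded : exists M, forall x, `|F x| <= M;
  nice_unif : forall e, 0 < e -> exists2 d, 0 < d &
    forall x y, cmod (x - y) < d -> `|F x - F y| <= e }.

Lemma nice0 : nice (fun=> 0).
Proof.
split; first by exists 0.
  by exists 0 => x; rewrite normr0.
by move=> e e0; exists 1 => // x y _; rewrite subrr normr0 ltW.
Qed.

Lemma nice_add f g : nice f -> nice g -> nice (fun x => f x + g x).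
Proof.
move=> [[B1 s1] [M1 b1] u1] [[B2 s2] [M2 b2] u2]; split.
- exists (Num.max B1 B2) => x; rewrite gt_max => /andP[/s1 -> /s2 ->].
  by rewrite addr0.
- by exists (M1 + M2) => x; rewrite (le_trans (ler_normD _ _))// lerD.
- move=> e e0; have e20 : 0 < e / 2 by rewrite divr_gt0.
  have [d1 d10 H1] := u1 _ e20; have [d2 d20 H2] := u2 _ e20.
  exists (Num.min d1 d2); first by rewrite lt_min d10.
  move=> x y; rewrite lt_min => /andP[/H1 + /H2].
  rewrite opprD addrACA => H H'; rewrite (le_trans (ler_normD _ _))//.
  by rewrite (le_trans (lerD H H'))//; lra.
Qed.

Lemma nice_scale (a : R) f : nice f -> nice (fun x => a * f x).
Proof.
move=> [[B s1] [M b1] u1]; split.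
- by exists B => x /s1 ->; rewrite mulr0.
- by exists (`|a| * M) => x; rewrite normrM ler_wpM2l.
- move=> e e0; have a0 : 0 < `|a| + 1 by rewrite ltr_wpDl.
  have [d d0 H] := u1 _ (divr_gt0 e0 a0); exists d => // x y /H.
  rewrite ler_pdivlMr// => {}H; rewrite -mulrBr normrM (le_trans _ H)//.
  by rewrite mulrC ler_wpM2l// lerDl.
Qed.

Lemma nice_sum (I : Type) (s : seq I) (G : I -> R[i] -> R) :
  (forall i, nice (G i)) -> nice (fun x => \sum_(i <- s) G i x).
Proof.
move=> lG; elim: s => [|i s IH].
  by under eq_fun do rewrite big_nil; exact: nice0.
by under eq_fun do rewrite big_cons; exact: nice_add.
Qed.

Lemma nice_tent r z : 0 < r -> nice (fun x => tent r (x - z)).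
Proof.
move=> r0; split.
- exists (2 * r + cmod z) => x xB; apply: tent_out => //.
  by apply: le_trans (ler_cmodB _ _); rewrite lerBrDr ltW.
- by exists (ln 2) => x; rewrite ger0_norm ?tent_ge0 ?tent_le.
- move=> e e0; exists (e * r / 2); first by rewrite divr_gt0// mulr_gt0.
  move=> x y xy.
  have r20 : 0 < 2 * r by rewrite mulr_gt0.
  have := dist_logmax (x - z) (y - z) r0.
  have := dist_logmax (x - z) (y - z) r20.
  have -> : x - z - (y - z) = x - y by ring.
  rewrite /tent; set c := cmod (x - y) => H1 H2.
  have cr : c / r < e / 2 by rewrite ltr_pdivrMr// mulrAC.
  have cr2 : c / (2 * r) <= c / r.
    rewrite ler_wpM2l ?cmod_ge0// lef_pV2 ?posrE//; lra.
  move: H1 H2; rewrite !ler_norml => /andP[? ?] /andP[? ?].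
  by apply/andP; split; lra.
Qed.

Lemma count_near (t : R) K :
  \sum_(i < K) (`|t - i%:R| < 4)%R%:R <= (9 : R).
Proof.
move cE : (4 : R) => c.
(* The second bound carries the induction: if [K] itself is counted, then [K - t < 4], so the
   earlier count is at most 8. *)
suff [] : \sum_(i < K) (`|t - i%:R| < c)%R%:R <= (9 : R) /\
  \sum_(i < K) (`|t - i%:R| < c)%R%:R <= Num.max 0 (K%:R - t + c) by [].
elim: K => [|K [IH1 IH2]].
  by rewrite big_ord0 le_max lexx.
rewrite big_ord_recr /= -[K.+1%:R]natr1.
move: IH1 IH2; set S := \sum_(i < K) _ => IH1 IH2.
case: (ltP `|t - K%:R| c) => [|_]; last first.
  rewrite mulr0n addr0; split=> //; apply: (le_trans IH2).
  rewrite ge_max !le_max lexx /=; apply/orP; right; lra.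
rewrite mulr1n ltr_norml => /andP[h1 h2].
have {}IH2 : S <= K%:R - t + c.
  by rewrite (le_trans IH2)// ge_max lexx andbT; lra.
split; first by lra.
rewrite le_max; apply/orP; right; lra.
Qed.

Definition grid (r : R) (M : nat) (ij : 'I_(2 * M).+1 * 'I_(2 * M).+1) : R[i] :=
  ((ij.1%:R - M%:R) * r) +i* ((ij.2%:R - M%:R) * r).

Arguments grid : clear implicits.

Lemma grid_near r M (t : R) : 0 < r -> `|t| < M%:R * r ->
  exists i : 'I_(2 * M).+1, `|t - (i%:R - M%:R) * r| <= r.
Proof.
move=> r0; rewrite -ltr_pdivrMr// => tM.
have tr : `|t / r| < M%:R by rewrite normrM normfV (gtr0_norm r0).
move: tr; rewrite ltr_norml => /andP[t1 t2].
have w0 : 0 <= t / r + M%:R by lra.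
have w2 : t / r + M%:R < (2 * M).+1%:R.
  by rewrite -natr1 natrM; lra.
have /andP[k1 k2] := truncn_itv w0.
have kM : (Num.truncn (t / r + M%:R) < (2 * M).+1)%N.
  by rewrite -(ltr_nat R) (le_lt_trans k1).
exists (Ordinal kM) => /=; set k := Num.truncn _ in k1 k2 *.
have -> : t - (k%:R - M%:R) * r = (t / r + M%:R - k%:R) * r.
  by field; rewrite gt_eqF.
rewrite normrM (gtr0_norm r0) ger_pMl// ler_norml; move: k2; rewrite -natr1; lra.
Qed.

Lemma grid_cover r M x : 0 < r -> cmod x < M%:R * r ->
  exists ij, cmod (x - grid r M ij) <= 2 * r :> R.
Proof.
move=> r0 xM.
have [i Hi] := grid_near r0 (le_lt_trans (ler_Re_cmod x) xM).
have [j Hj] := grid_near r0 (le_lt_trans (ler_Im_cmod x) xM).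
exists (i, j); apply: (le_trans (cmod_le_ReIm _)).
case: x Hi Hj {xM} => a b /= Hi Hj.
by apply: (le_trans (lerD Hi Hj)); lra.
Qed.

Lemma finite_net (B e : R) : 0 < e -> exists s : seq R[i],
  forall x, cmod x <= B -> exists2 y, y \in s & cmod (x - y) <= e.
Proof.
move=> e0; have r0 : 0 < e / 2 by rewrite divr_gt0.
pose M := (Num.truncn (B / (e / 2))).+1.
exists [seq grid (e / 2) M ij | ij : 'I_(2 * M).+1 * 'I_(2 * M).+1] => x xB.
have [|ij Hij] := @grid_cover (e / 2) M x r0.
  by rewrite (le_lt_trans xB)// -ltr_pdivrMr// truncnS_gt.
exists (grid (e / 2) M ij); first by apply/mapP; exists ij; rewrite ?mem_enum.
by rewrite (le_trans Hij)// mulrC divfK.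
Qed.

(** A tent of inner radius [2 * r] vanishes from distance [4 * r] on, so in each coordinate only the
    at most 9 indices of [count_near] contribute; this gives [9 * 9] tents of height at most
    [ln 2]. *)
Lemma tent_sum_le r M x : 0 < r ->
  \sum_(ij : 'I_(2 * M).+1 * 'I_(2 * M).+1) tent (2 * r) (x - grid r M ij) <=
  81 * ln 2.
Proof.
move=> r0; have r20 : 0 < 2 * r by rewrite mulr_gt0.
have l2 : 0 <= ln (2 : R) by rewrite ln_ge0// ler1n.
case: x => a b.
pose p (c : R) (i : 'I_(2 * M).+1) : R := (`|c / r + M%:R - i%:R| < 4)%R%:R.
have Hp (c : R) (i : 'I_(2 * M).+1) : `|c - (i%:R - M%:R) * r| < 4 * r -> p c i = 1.
  move=> H; rewrite /p.
  have -> : c / r + M%:R - i%:R = (c - (i%:R - M%:R) * r) / r.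
    by field; rewrite gt_eqF.
  by rewrite normrM normfV (gtr0_norm r0) ltr_pdivrMr// H.
apply: (@le_trans _ _ (\sum_(ij : 'I_(2 * M).+1 * 'I_(2 * M).+1)
    ln 2 * (p a ij.1 * p b ij.2))).
  apply: ler_sum => -[i j] _ /=.
  have [H|H] := ltP (cmod (a +i* b - grid r M (i, j))) (2 * (2 * r)); last first.
    by rewrite tent_out// mulr_ge0// mulr_ge0.
  rewrite !Hp ?mulr1 ?tent_le//.
    apply: le_lt_trans (ler_Im_cmod (a +i* b - grid r M (i, j))) _; rewrite (lt_le_trans H)//; lra.
  apply: le_lt_trans (ler_Re_cmod (a +i* b - grid r M (i, j))) _; rewrite (lt_le_trans H)//; lra.
rewrite -mulr_sumr mulrC ler_wpM2r//.
rewrite -(pair_bigA _ (fun i j => p a i * p b j)) /=.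
under eq_bigr do rewrite -mulr_sumr.
rewrite -mulr_suml.
have -> : (81 : R) = 9 * 9 by ring.
by apply: ler_pM; rewrite ?sumr_ge0//; exact: count_near.
Qed.

(* One step of the approximation: put at every point of a fine grid a tent whose
   height is [F] there divided by [81 * ln 2], a bound for the sum of all tents.
   Near each point of the support some tent has full height [ln 2]. *)
Lemma logspan_contract F M : nice F -> (forall x, `|F x| <= M) ->
  exists g, [/\ logspan g, nice g & forall x, `|F x - g x| <= (1 - 162%:R^-1) * M].
Proof.
move=> nF FM; have M0 : 0 <= M by apply: le_trans (FM 0).
move: M0; rewrite le_eqVlt => /orP[/eqP M0|M0].
  exists (fun=> 0); split; [exact: logspan0|exact: nice0|].
  by move=> x; rewrite -M0 mulr0 subr0 M0.
have [B HB] := nice_supp nF.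
(* Covering gains [1/81] of [M] and the oscillation of [F] may give back half of that, whence the
   ratio [1 - 1/81 + 1/162 = 1 - 1/162]. *)
have e0 : 0 < M / 162 by rewrite divr_gt0.
have [d d0 Hd] := nice_unif nF e0.
(* The tents below have inner radius [2 * r], hence outer radius [4 * r = d], the scale on which [F]
   varies by at most [M / 162]. *)
pose r := d / 4; have r0 : 0 < r by rewrite divr_gt0.
have r20 : 0 < 2 * r by rewrite mulr_gt0.
have l2 : 0 < ln (2 : R) by rewrite ln_gt0// ltr1n.
pose W : R := 81 * ln 2; have W0 : 0 < W by rewrite mulr_gt0.
pose K := (Num.truncn (B / r)).+1.
pose T ij x : R := tent (2 * r) (x - grid r K ij).
pose g x : R := \sum_ij F (grid r K ij) / W * T ij x.
exists g; split.
- by apply: logspan_sum => ij; apply: logspan_scale; exact: logspan_tent.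
- by apply: nice_sum => ij; apply: nice_scale; exact: nice_tent.
move=> x; pose S : R := \sum_ij T ij x.
have T0 ij : 0 <= T ij x by exact: tent_ge0.
have SW : S <= W by exact: tent_sum_le.
have S0 : 0 <= S by exact: sumr_ge0.
have SB : cmod x <= B -> ln 2 <= S.
  move=> xB; have [|ij Hij] := @grid_cover r K x r0.
    by rewrite (le_lt_trans xB)// -ltr_pdivrMr// truncnS_gt.
  rewrite /S (bigD1 ij)//= {1}/T tent_in// lerDl sumr_ge0//.
(* The first term is what the tents leave uncovered, small because [S / W >= 1/81] wherever [F] may
   be nonzero; the second is a subconvex combination of oscillations of [F] within single tents. *)
have -> : F x - g x = F x * (1 - S / W) +
    \sum_ij (F x - F (grid r K ij)) * (T ij x / W).
  have -> : \sum_ij (F x - F (grid r K ij)) * (T ij x / W) = F x * (S / W) - g x.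
    rewrite /S /g mulr_suml mulr_sumr -sumrB; apply: eq_bigr => ij _.
    by rewrite mulrBl mulrAC -mulrA [X in _ - X]mulrCA.
  ring.
apply: (le_trans (ler_normD _ _)).
have H2 : `|\sum_ij (F x - F (grid r K ij)) * (T ij x / W)| <= M / 162.
  apply: (le_trans (ler_norm_sum _ _ _)).
  apply: (@le_trans _ _ (\sum_ij (M / 162) * (T ij x / W))).
    apply: ler_sum => ij _; rewrite normrM [`|_ / W|]ger0_norm; last first.
      by rewrite divr_ge0// ltW.
    have [H|H] := ltP (cmod (x - grid r K ij)) d.
      by rewrite ler_wpM2r ?Hd// divr_ge0// ltW.
    rewrite {1 2}/T tent_out// ?mul0r ?mulr0//.
    by rewrite (le_trans _ H)// /r; lra.
  rewrite -mulr_sumr -mulr_suml ler_piMr ?(ltW e0)//.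
  by rewrite ler_pdivrMr// mul1r.
have H1 : `|F x * (1 - S / W)| <= M * (1 - 81%:R^-1).
  have [xB|/HB ->] := leP (cmod x) B; last first.
    rewrite mul0r normr0 mulr_ge0// ?(ltW M0)//; lra.
  have SW1 : S / W <= 1 by rewrite ler_pdivrMr// mul1r.
  have SWl : 81%:R^-1 <= S / W.
    by rewrite ler_pdivlMr// /W mulrA mulVf ?mul1r ?SB// pnatr_eq0.
  rewrite normrM [`|1 - _|]ger0_norm ?subr_ge0//.
  by rewrite ler_pM// ?subr_ge0// lerD2l lerN2.
rewrite (le_trans (lerD H1 H2))//; lra.
Qed.

(** The error of one approximation step is again [nice], so the step can be iterated, and the sup
    norm decreases geometrically. *)
Lemma logspan_dense F e : nice F -> 0 < e ->
  exists2 g, logspan g & forall x, `|F x - g x| <= e.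
Proof.
move=> nF e0; have [M FM] := nice_bounded nF.
have M0 : 0 <= M by apply: le_trans (FM 0).
pose q : R := 1 - 162%:R^-1.
have H k : exists g, [/\ logspan g, nice g & forall x, `|F x - g x| <= q ^+ k * M].
  elim: k => [|k [g [lg ng Hg]]].
    exists (fun=> 0); split; [exact: logspan0|exact: nice0|].
    by move=> x; rewrite subr0 expr0 mul1r.
  have nFg : nice (fun x => F x - g x).
    by have := nice_add nF (nice_scale (-1) ng); under eq_fun do rewrite mulN1r.
  have [f [lf nf Hf]] := logspan_contract nFg Hg.
  exists (fun x => g x + f x); split; [exact: logspan_add|exact: nice_add|].
  by move=> x; rewrite opprD addrA exprS -mulrA.
have q0 : 0 < q by rewrite /q; lra.
pose t : R := q^-1 - 1.
have t0 : 0 < t by rewrite /t subr_gt0 invf_gt1// /q; lra.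
(* Bernoulli's inequality gives [q ^ (- k) >= 1 + k t], and [k t > M / e]; hence
   [q ^ k * M <= e]. *)
pose k := (Num.truncn (M / (e * t))).+1.
have [g [lg _ Hg]] := H k; exists g => // x; apply: (le_trans (Hg x)).
have tq : 1 + t = q^-1 by rewrite /t addrC subrK.
have : 1 + k%:R * t <= (q^-1) ^+ k by rewrite -tq bernoulli// ltW.
have : M / (e * t) < k%:R by exact: truncnS_gt.
rewrite ltr_pdivrMr ?mulr_gt0// exprVn => h1 h2.
have : 1 + k%:R * t <= (q ^+ k)^-1 by [].
rewrite -(ler_pM2l (exprn_gt0 k q0)) mulfV ?gt_eqF ?exprn_gt0// => h3.
have qk : 0 < q ^+ k by rewrite exprn_gt0.
apply: (@le_trans _ _ (q ^+ k * (k%:R * (e * t)))).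
  by rewrite ler_wpM2l// ltW.
have -> : q ^+ k * (k%:R * (e * t)) = e * (q ^+ k * (k%:R * t)) by ring.
rewrite ler_piMr ?(ltW e0)// (le_trans _ h3)// ler_wpM2l ?(ltW qk)//.
by rewrite lerDr.
Qed.

End logarithmic_span.

(** * Blaschke factorization *)

Section blaschke.
Variable R : realType.
Implicit Types (f p : {poly R[i]}) (s : seq R[i]).

Lemma poly_rootsE p :
  p = lead_coef p *: \prod_(a <- poly_roots p) ('X - a%:P).
Proof. by rewrite /poly_roots; case: closed_field_poly_normal. Qed.

Lemma poly_roots_perm p (c : R[i]) s : c != 0 ->
  p = c *: \prod_(a <- s) ('X - a%:P) -> perm_eq (poly_roots p) s.
Proof.
move=> c0 pE; have lc : lead_coef p = c.
  rewrite pE lead_coefZ (eqP (_ : _ \is monic)) ?mulr1//.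
  exact: monic_prod_XsubC.
apply: prod_XsubC_eq; apply: (scalerI c0).
by rewrite -pE -lc -poly_rootsE.
Qed.

(* [reflect_in 0 = 0] is a junk value: a root at [0] contributes no root to the
   outer factor, see [reflect_fun]. *)
Definition reflect_in (a : R[i]) : R[i] := if `|a| <= 1 then (a^*)%C^-1 else a.

(** The denominators of the Blaschke factors take the place of their numerators. For [|a| = 1] the
    new factor is a constant multiple of the old one, and for [a = 0] it is 1. *)
Definition inner_free_part f : {poly R[i]} :=
  lead_coef f *: \prod_(a <- poly_roots f)
    (if `|a| <= 1 then 1 - (a^*)%C *: 'X else 'X - a%:P).

Lemma inner_free_partP f : blaschke_factorization f (inner_free_part f).
Proof.
rewrite /blaschke_factorization /blaschke_product /inner_free_part.
rewrite [in LHS](poly_rootsE f) -!mul_polyC !rmorphM /= mulrCA; congr (_ * _).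
rewrite !rmorph_prod /= (bigID (fun a => `|a| <= 1)) /=.
rewrite [X in _ = _ * X](bigID (fun a => `|a| <= 1)) /= mulrA -big_split /=.
congr (_ * _); apply: eq_bigr => a a1; last by rewrite (negbTE a1).
rewrite a1 divfK// tofrac_eq0.
apply/eqP => /(congr1 (fun p : {poly R[i]} => p.[0])) /eqP.
by rewrite !hornerE subr0 oner_eq0.
Qed.

Lemma poly_roots_inner_free_part f : f != 0 ->
  perm_eq (poly_roots (inner_free_part f))
    [seq reflect_in a | a <- poly_roots f & a != 0].
Proof.
move=> f0.
(* The leading coefficient of [1 - conj(a) X] is [- conj(a)] when [a] is nonzero; at [a = 0] the
   factor is the constant 1 and contributes neither root nor coefficient. *)
apply: (@poly_roots_perm _ (lead_coef f * \prod_(a <- poly_roots f)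
   (if a == 0 then 1 else if `|a| <= 1 then - (a^*)%C else 1))).
  rewrite mulf_neq0 ?lead_coef_eq0// prodf_seq_neq0.
  apply/allP => a _ /=; case: ifPn => [_|a0]; first exact: oner_neq0.
  by case: ifP; rewrite ?oner_neq0// oppr_eq0 conjc_eq0.
rewrite /inner_free_part -!mul_polyC polyCM -mulrA; congr (_ * _).
rewrite big_map big_filter rmorph_prod /= [X in _ * X]big_mkcond -big_split /=.
apply: eq_bigr => a _; rewrite /reflect_in.
case: eqVneq => [->|a0].
  by rewrite normr0 ler01 conjc0 scale0r subr0 mulr1.
case: ifP => _; last by rewrite mul1r.
rewrite /= -mul_polyC polyCN mulNr mulrBr opprB -polyCM mulfV ?conjc_eq0//.
Qed.

(** The value 0 at 0 expresses that a root at 0 has no counterpart in the outer factor. It is also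
    the continuous value when [h] vanishes near infinity, since points near 0 are reflected far
    away. *)
Definition reflect_fun (h : R[i] -> R) (a : R[i]) : R :=
  if a == 0 then 0 else h (reflect_in a).

Lemma sum_roots_inner_free_part f (h : R[i] -> R) : f != 0 ->
  \sum_(b <- poly_roots (inner_free_part f)) h b =
  \sum_(a <- poly_roots f) reflect_fun h a.
Proof.
move=> f0; rewrite (perm_big _ (poly_roots_inner_free_part f0)) /=.
rewrite big_map big_filter big_mkcond /=; apply: eq_bigr => a _.
by rewrite /reflect_fun if_neg.
Qed.

Lemma size_roots_inner_free_part f : f != 0 ->
  size (poly_roots (inner_free_part f)) =
  (size (poly_roots f) - count_mem (0 : R[i])%R (poly_roots f))%N.
Proof.
move=> f0; rewrite (perm_size (poly_roots_inner_free_part f0)) size_map size_filter.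
by rewrite -(count_predC (pred1 (0 : R[i]))) addKn.
Qed.

Lemma integral_empirical_measure p (h : plane R -> R) :
  measurable_fun setT h ->
  \int[empirical_measure p]_x h x =
  (size (poly_roots p))%:R^-1 * \sum_(a <- poly_roots p) h (of_complex a).
Proof.
move=> mh.
rewrite /Rintegral /empirical_measure; set s := poly_roots p.
set m := mscale _ _.
have ge0 (f : plane R -> R) : measurable_fun setT f -> (forall x, 0 <= f x) ->
    (\int[m]_x (f x)%:E = ((size s)%:R^-1 * \sum_(a <- s) f (of_complex a))%R%:E)%E.
  move=> mf f0; have mEf : measurable_fun setT (EFin \o f) by exact/measurable_EFinP.
  rewrite /m ge0_integral_mscale//; last by move=> x _; rewrite lee_fin.
  rewrite ge0_integral_measure_sum//; last by move=> x _; rewrite lee_fin.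
  rewrite (big_nth 0) big_mkord EFinM -sumEFin; congr (_ * _)%E.
  by apply: eq_bigr => k _; rewrite integral_dirac// diracT mul1e.
have mp : measurable_fun setT (fun x => Num.max (h x) 0) by exact: measurable_maxr.
have mn : measurable_fun setT (fun x => Num.max (- h x) 0).
  by apply: measurable_maxr => //; exact: measurableT_comp.
rewrite integralE.
have -> : (EFin \o h)^\+%E = (fun x => (Num.max (h x) 0)%:E).
  by apply/funext => x; rewrite funeposE /= EFin_max.
have -> : (EFin \o h)^\-%E = (fun x => (Num.max (- h x) 0)%:E).
  by apply/funext => x; rewrite funenegE /= EFin_max.
rewrite !ge0//; try by move=> x; rewrite le_max lexx orbT.
rewrite -EFinB /= -mulrBr -sumrB; congr (_ * _); apply: eq_bigr => a _.
by case: (leP (h _) 0) => h0; [rewrite max_l|rewrite max_r]; lra.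
Qed.

End blaschke.

(** * Sums over roots as random variables, and test functions *)

Section measurability.
Variable R : realType.

Lemma cvg_rate (u : nat -> R) (l c : R) N0 :
  (forall N, (N0 <= N)%N -> `|u N - l| <= c / N.+1%:R) -> u N @[N --> \oo] --> l.
Proof.
move=> H; have c0 : c / n.+1%:R @[n --> \oo] --> (0 : R).
  by rewrite -(mulr0 c); apply: cvgMr; exact: cvg_harmonic.
apply/cvgrPdist_le => e e0.
move/cvgrPdist_le : c0 => /(_ e e0) Hc.
near=> N; rewrite distrC (le_trans (H N _))//; first by near: N; exists N0.
have : `|0 - c / N.+1%:R| <= e by near: N.
by rewrite sub0r normrN; exact: le_trans (ler_norm _).
Unshelve. all: by end_near. Qed.

Context d (T : measurableType d).

Lemma measurable_sum_seq (I : eqType) (s : seq I) (f : I -> T -> R) :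
  (forall i, i \in s -> measurable_fun setT (f i)) ->
  measurable_fun setT (fun w => \sum_(i <- s) f i w).
Proof.
elim: s => [|i s IH] mf.
  by under eq_fun do rewrite big_nil; exact: measurable_cst.
under eq_fun do rewrite big_cons; apply: measurable_funD.
  by apply: mf; rewrite inE eqxx.
by apply: IH => j js; apply: mf; rewrite inE js orbT.
Qed.

Section roots.
Variables (Q : T -> seq R[i]) (n : nat).
Hypothesis sQ : forall w, size (Q w) = n.
Hypothesis mQ : forall x : R[i],
  measurable_fun setT (fun w => cmod (\prod_(a <- Q w) (x - a))).

(** The list [Q w] is not assumed measurable in any sense; only the moduli of its polynomial at
    fixed points are. Jensen's formula on polygons exhibits the sum as a pointwise limit of finite
    combinations of their logarithms; the threshold may depend on [w]. *)
Lemma measurable_sum_logmax (r : R) z : 0 < r ->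
  measurable_fun setT (fun w => \sum_(a <- Q w) logmax r (a - z)).
Proof.
move=> r0.
pose u N w : R := N.+1%:R^-1 * \sum_(t <- unity R N.+1)
  ln (cmod (\prod_(a <- Q w) (z + t * (r * (1 + N.+1%:R^-1))%:C - a))).
apply: (@measurable_fun_cvg _ _ _ _ u) => [N|w _].
  apply: measurable_funM; first exact: measurable_cst.
  apply: measurable_sum_seq => t _.
  by apply: measurableT_comp (mQ _); exact: measurable_ln.
have [N0 HN] := jensen_roots (Q w) z r0.
apply: (@cvg_rate _ _ (2 * (size (Q w))%:R) N0) => N /leqW /HN [_ [_ /=]].
rewrite /u; set S1 := \sum_(t <- _) _; set S2 := \sum_(a <- _) logmax _ _ => H.
have -> : N.+1%:R^-1 * S1 - S2 = N.+1%:R^-1 * (S1 - N.+1%:R * S2).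
  by rewrite mulrBr mulrA mulVf ?mul1r// pnatr_eq0.
by rewrite normrM ger0_norm ?invr_ge0// mulrC ler_wpM2r ?invr_ge0.
Qed.

Lemma measurable_sum_logspan g : logspan g ->
  measurable_fun setT (fun w => \sum_(a <- Q w) g a).
Proof.
elim=> [|c r z f r0 _ IH].
  by under eq_fun do rewrite big1_eq; exact: measurable_cst.
under eq_fun do rewrite big_split /= -mulr_sumr.
apply: measurable_funD => //; apply: measurable_funM; first exact: measurable_cst.
exact: measurable_sum_logmax.
Qed.

Lemma measurable_sum_nice F : nice F ->
  measurable_fun setT (fun w => \sum_(a <- Q w) F a).
Proof.
move=> nF.
have /choice[g Hg] : forall N, exists g, logspan g /\
    forall x, `|F x - g x| <= (N.+1%:R^-1 : R).
  move=> N; have [|g lg Hg] := logspan_dense nF (_ : 0 < N.+1%:R^-1).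
    by rewrite invr_gt0.
  by exists g.
apply: (@measurable_fun_cvg _ _ _ _ (fun N w => \sum_(a <- Q w) g N a)) => [N|w _].
  by apply: measurable_sum_logspan; case: (Hg N).
apply: (@cvg_rate _ _ n%:R 0%N) => N _.
rewrite distrC -sumrB (le_trans (ler_norm_sum _ _ _))//.
rewrite -(sQ w) -sum_const_seq; apply: ler_sum => a _.
by case: (Hg N).
Qed.

(** Normalised tents at 0 with radius tending to 0 converge to the indicator of 0; on a finite list
    they eventually agree with it exactly. *)
Lemma measurable_count_roots : measurable_fun setT
  (fun w => (count_mem (0 : R[i]) (Q w))%:R : R).
Proof.
have l2 : 0 < ln (2 : R) by rewrite ln_gt0// ltr1n.
pose r N : R := N.+1%:R^-1.
have r0 N : 0 < r N by rewrite invr_gt0.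
apply: (@measurable_fun_cvg _ _ _ _
  (fun N w => \sum_(a <- Q w) (ln 2)^-1 * tent (r N) a)) => [N|w _].
  apply: measurable_sum_nice; apply: nice_scale.
  by have := nice_tent 0 (r0 N); under eq_fun do rewrite subr0.
have [N0 HN0] : exists N0, forall N, (N0 <= N)%N -> forall a, a \in Q w ->
    (ln 2)^-1 * tent (r N) a = (a == 0)%:R.
  elim: (Q w) => [|a s [N1 IH]]; first by exists 0%N.
  exists (maxn N1 (Num.truncn (2 / cmod a))) => N; rewrite geq_max => /andP[/IH {}IH Na] b.
  rewrite inE => /orP[/eqP ->{b}|/IH//].
  case: eqVneq => [->|a0].
    by rewrite tent_in ?mulVf ?gt_eqF// cmod0 ltW.
  rewrite tent_out ?mulr0// /r ler_pdivrMr// mulrC -ler_pdivrMr ?cmod_gt0//.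
  by rewrite ltW// (lt_le_trans (truncnS_gt _))// ler_nat.
apply: (@cvg_rate _ _ 0 N0) => N NN0; rewrite mul0r.
have -> : (count_mem (0 : R[i]) (Q w))%:R = \sum_(a <- Q w) (a == 0)%:R :> R.
  by rewrite -sum1_count natr_sum big_mkcond /=; apply: eq_bigr => a _; case: eqP.
rewrite -sumrB big_seq big1 ?normr0// => a aw.
by rewrite HN0// subrr.
Qed.

End roots.
End measurability.

(** * Test functions and their reflection *)

Section compactly_supported.
Variable R : realType.

Lemma cmod_plane (x y : R[i]) :
  `|(of_complex x : (R^o * R^o)%type) - of_complex y| <= cmod (x - y).
Proof.
case: x y => [a b] [c e]; rewrite prod_normE /= ge_max.
have := ler_Re_cmod ((a +i* b) - (c +i* e)).
have := ler_Im_cmod ((a +i* b) - (c +i* e)).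
by move=> /= -> ->.
Qed.

Lemma nice_of_Cc (h : plane R -> R) :
  @Cc_infty R (R^o * R^o)%type setT h -> nice (h \o @of_complex R).
Proof.
move=> [sm cK _]; have [ch _] := sm [::].
have h0 x : ~ supp h x -> h x = 0.
  move=> nx; apply: contrapT => hx; apply: nx; apply: subset_closure.
  exact/eqP.
have [M [_ HM]] := compact_bounded cK.
have bsupp x : 2 * (M + 1) < cmod x -> (h \o @of_complex R) x = 0.
  move=> xM; apply: h0 => /(HM (M + 1)).
  rewrite ltrDl ltr01 => /(_ isT) /=; apply/negP; rewrite -ltNge.
  case: x xM => a b; rewrite prod_normE /= => xM.
  have := lt_le_trans xM (cmod_le_ReIm _); rewrite /= lt_max.
  by case: (ltP (M + 1) `|a|) => //= h1 h2; lra.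
have [M2 HM2] : exists M2, forall x, `|h x| <= M2.
  have /compact_bounded[M' [_ HM']] : compact (h @` supp h).
    apply: continuous_compact => //.
    exact: continuous_subspaceT.
  exists (Num.max (M' + 1) 0) => x.
  have [xK|/h0 ->] := pselect (supp h x); last by rewrite normr0 le_max lexx orbT.
  by rewrite le_max HM'//= ?ltrDl//; exists x.
split.
- by exists (2 * (M + 1)).
- by exists M2 => x; exact: HM2.
move=> e e0; have e20 : 0 < e / 2 by rewrite divr_gt0.
(* Heine-Cantor on the compact support. It is enough that one of the two points lies in the support,
   since otherwise both values are 0. *)
have Hnear : \forall dd \near (0 : R)^'+, forall x, supp h x ->
    forall y, `|x - y| < dd -> `|h x - h y| <= e.
  apply: ((compact_near_coveringP _).1 cK (R : Type) (at_right 0)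
    (fun dd x => forall y, `|x - y| < dd -> `|h x - h y| <= e)) => x xK.
  have := ch x; move=> /cvgrPdist_lt /(_ _ e20) /nbhs_normP[dd /= dd0 Hdd].
  have dd20 : 0 < dd / 2 by rewrite divr_gt0.
  exists (ball x (dd / 2), [set t | t < dd / 2]); first split.
  - exact: nbhsx_ballx.
  - exact: nbhs_right_lt.
  move=> [x' t] /= [+ td] y xy; rewrite -ball_normE /= => xx'.
  have h1 : `|h x - h x'| < e / 2 
    by apply: Hdd; rewrite /ball_ /= (lt_trans xx')// ltr_pdivrMr// ltr_pMr// ltr1n.
  have h2 : `|h x - h y| < e / 2.
    apply: Hdd; rewrite /ball_ /= -(subrKA x') (le_lt_trans (ler_normD _ _))//.
    rewrite (splitr dd) ltrD// (lt_trans xy)//.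
  rewrite -(subrKA (h x)) (le_trans (ler_normD _ _))// (distrC (h x')) ltW//.
  by rewrite [ltRHS](splitr e) ltrD.
have [dd dd0 Hdd] : exists2 dd, 0 < dd & forall x, supp h x ->
    forall y, `|x - y| < dd -> `|h x - h y| <= e.
  near (0 : R)^'+ => dd; exists dd; near: dd => //.
  exact: nbhs_right_gt.
exists dd => // x y xy; have {}xy := le_lt_trans (cmod_plane x y) xy.
have [xK|xK] := pselect (supp h (of_complex x)); first exact: Hdd.
have [yK|yK] := pselect (supp h (of_complex y)).
  by rewrite distrC; apply: Hdd => //; rewrite distrC.
by rewrite /= !h0// subrr normr0 ltW.
Unshelve. all: by end_near. Qed.

Lemma reflect_inE (a : R[i]) :
  reflect_in a = if cmod a <= 1 then (a^*)%C^-1 else a.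
Proof. by rewrite /reflect_in normr_cmod lecR. Qed.

Lemma cmod_reflect_in (a : R[i]) :
  cmod (reflect_in a) = if cmod a <= 1 then (cmod a)^-1 else cmod a.
Proof. by rewrite reflect_inE; case: ifP; rewrite ?cmodV ?cmodJ. Qed.

(** The constant adds up the cases: inversion has Lipschitz constant [c^-1 ^+ 2] where [|x| >= c],
    and the identity has constant 1. If [|u| <= 1 < |v|], reflecting [u] moves it by
    [(1 - |u|^2) / |u| <= (2 / c) (1 - |u|)], and [1 - |u| <= |u - v|]. *)
Lemma reflect_in_lipschitz (c : R) (x y : R[i]) :
  0 < c -> c <= cmod x -> c <= cmod y ->
  cmod (reflect_in x - reflect_in y) <= (1 + 2 / c + c^-1 ^+ 2) * cmod (x - y).
Proof.
move=> c0; have nx z : c <= cmod z -> z != 0.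
  by move=> cz; rewrite -cmod_gt0 (lt_le_trans c0).
have iV z : c <= cmod z -> (cmod z)^-1 <= c^-1.
  by move=> cz; rewrite lef_pV2 ?posrE// (lt_le_trans c0).
have ci : 0 < c^-1 by rewrite invr_gt0.
set C := _ + c^-1 ^+ 2.
have C1 : 1 <= C by rewrite /C -addrA lerDl addr_ge0// ?exprn_ge0 ?mulr_ge0// ltW.
have C2 : c^-1 ^+ 2 <= C by rewrite lerDr addr_ge0// mulr_ge0// ltW.
have mixed u v : c <= cmod u -> cmod u <= 1 -> 1 < cmod v ->
    cmod ((u^*)%C^-1 - v) <= C * cmod (u - v).
  move=> cu u1 v1; rewrite (le_trans (cmod_triangle _ u _))//.
  apply: (@le_trans _ _ (2 / c * cmod (u - v) + cmod (u - v))); last first.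
    rewrite -[X in _ + X]mul1r -mulrDl ler_wpM2r ?cmod_ge0//.
    by rewrite /C (addrC 1) lerDl exprn_ge0// ltW.
  rewrite lerD2r.
  have uv : 1 - cmod u <= cmod (u - v).
    by rewrite cmodB (le_trans _ (ler_cmodB _ _))// lerD2r ltW.
  have -> : (u^*)%C^-1 - u = (1 - u * (u^*)%C) / (u^*)%C.
    by field; rewrite conjc_eq0 nx.
  rewrite cmodM cmodV cmodJ -sqr_normc normr_cmod.
  have -> : 1 - (cmod u)%:C ^+ 2 = (1 - cmod u ^+ 2)%:C by rewrite rmorphB rmorphXn.
  have u0 := cmod_ge0 u.
  rewrite cmodC; last by rewrite subr_ge0 expr_le1.
  have h1 : 1 - cmod u ^+ 2 <= 2 * cmod (u - v).
    have -> : 1 - cmod u ^+ 2 = (1 + cmod u) * (1 - cmod u) by ring.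
    by rewrite ler_pM// ?subr_ge0 ?addr_ge0//; lra.
  rewrite mulrAC ler_pM ?invr_ge0 ?iV//.
  by rewrite subr_ge0 expr_le1.
move=> cx cy; rewrite !reflect_inE.
case: (leP (cmod x) 1) => x1; case: (leP (cmod y) 1) => y1.
- have -> : (x^*)%C^-1 - (y^*)%C^-1 = - ((x - y)^*)%C / ((x^*)%C * (y^*)%C).
    by rewrite rmorphB /=; field; rewrite !conjc_eq0 !nx.
  rewrite cmodM cmodN cmodV cmodM !cmodJ mulrC ler_wpM2r ?cmod_ge0//.
  by rewrite (le_trans _ C2)// invfM expr2 ler_pM ?invr_ge0 ?cmod_ge0 ?iV.
- exact: mixed.
- by rewrite cmodB (cmodB x) mixed.
- by rewrite ler_peMl ?cmod_ge0.
Qed.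

(** Inversion is singular only at 0, but it sends a small disk around 0 outside the support of [h];
    off that disk the reflection is Lipschitz. *)
Lemma nice_reflect_fun (h : R[i] -> R) : nice h -> nice (reflect_fun h).
Proof.
move=> [[B0 HB0] [M HM] uh].
pose B := Num.max B0 1.
have B1 : 1 <= B by rewrite le_max lexx orbT.
have B0' : 0 < B by rewrite (lt_le_trans ltr01).
have HB x : B < cmod x -> h x = 0.
  by rewrite gt_max => /andP[/HB0].
have Hbig x : B < cmod x -> reflect_fun h x = 0.
  move=> Bx; rewrite /reflect_fun; case: eqP => // _.
  by apply: HB; rewrite cmod_reflect_in leNgt (le_lt_trans B1 Bx).
have Hsmall x : cmod x < B^-1 -> reflect_fun h x = 0.
  move=> xB; rewrite /reflect_fun; case: eqVneq => // x0.
  apply: HB; rewrite cmod_reflect_in ifT; last first.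
    by rewrite (le_trans (ltW xB))// invf_le1.
  by rewrite -[B]invrK ltf_pV2 ?posrE ?invr_gt0// cmod_gt0.
split.
- by exists B.
- exists (Num.max M 0) => x; rewrite /reflect_fun le_max.
  by case: eqP => _; rewrite ?normr0 ?lexx ?orbT ?HM.
move=> e e0; have [d d0 Hd] := uh _ e0.
(* Half the radius [B^-1] of the disk where the reflected function vanishes: two points closer than
   [c], one of them within [c] of 0, both lie in that disk. *)
pose c := (2 * B)^-1.
have c0 : 0 < c by rewrite invr_gt0 mulr_gt0.
have c2 : 2 * c = B^-1 by rewrite /c invfM mulrA mulfV ?mul1r.
have C0 : 0 < 1 + 2 / c + c^-1 ^+ 2.
  have ci : 0 < c^-1 by rewrite invr_gt0.
  by rewrite !addr_gt0 ?mulr_gt0 ?exprn_gt0.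
exists (Num.min (d / (1 + 2 / c + c^-1 ^+ 2)) c).
  by rewrite lt_min c0 divr_gt0.
move=> x y; rewrite lt_min ltr_pdivlMr// mulrC => /andP[xy xyc].
have small u v : cmod (u - v) < c -> cmod u < c ->
    reflect_fun h u = 0 /\ reflect_fun h v = 0.
  move=> uv uc; split; apply: Hsmall; rewrite -c2; first by lra.
  have := ler_cmodB v u; rewrite (cmodB v); lra.
have [xc|xc] := ltP (cmod x) c.
  by have [-> ->] := small _ _ xyc xc; rewrite subrr normr0 ltW.
have [yc|yc] := ltP (cmod y) c.
  by rewrite cmodB in xyc; have [-> ->] := small y x xyc yc; rewrite subrr normr0 ltW.
have x0 : x != 0 by rewrite -cmod_gt0 (lt_le_trans c0).
have y0 : y != 0 by rewrite -cmod_gt0 (lt_le_trans c0).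
rewrite /reflect_fun (negbTE x0) (negbTE y0); apply: Hd.
exact: le_lt_trans (reflect_in_lipschitz c0 xc yc) xy.
Qed.

End compactly_supported.

(** * Rotations of the plane *)

Section image_measure.
Context d d' (T1 : measurableType d) (T2 : measurableType d') (R : realType).

Definition image_measure (m : {measure set T1 -> \bar R}) (f : T1 -> T2)
  (mf : measurable_fun setT f) : {measure set T2 -> \bar R}.
Proof. refine (pushforward m f : {measure set T2 -> \bar R}); exact: mf. Defined.

Lemma measurable_preimage (f : T1 -> T2) A : measurable_fun setT f ->
  measurable A -> measurable (f @^-1` A).
Proof. by move=> mf mA; rewrite -[X in measurable X]setTI; exact: mf. Qed.

End image_measure.

(** * Measurability of complex-valued functions *)

Section complex_measurability.
Variable R : realType.
Context d (T : measurableType d).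

Definition measurable_complex (f : T -> R[i]) : Prop :=
  measurable_fun setT (@complex.Re R \o f) /\ measurable_fun setT (@complex.Im R \o f).

Lemma measurable_complex_cst (z : R[i]) : measurable_complex (fun=> z).
Proof. by split; exact: measurable_cst. Qed.

Lemma measurable_complexB (f g : T -> R[i]) :
  measurable_complex f -> measurable_complex g ->
  measurable_complex (fun w => f w - g w).
Proof.
move=> [f1 f2] [g1 g2]; split.
  rewrite (_ : _ \o _ = (@complex.Re R \o f) \- (@complex.Re R \o g)).
    exact: measurable_funB.
  by apply/funext => w /=; rewrite raddfB.
rewrite (_ : _ \o _ = (@complex.Im R \o f) \- (@complex.Im R \o g)).
  exact: measurable_funB.
by apply/funext => w /=; rewrite raddfB.
Qed.

Lemma measurable_complexM (f g : T -> R[i]) :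
  measurable_complex f -> measurable_complex g ->
  measurable_complex (fun w => f w * g w).
Proof.
move=> [f1 f2] [g1 g2]; split.
  rewrite (_ : _ \o _ = (@complex.Re R \o f) \* (@complex.Re R \o g) \-
    (@complex.Im R \o f) \* (@complex.Im R \o g)).
    by apply: measurable_funB; exact: measurable_funM.
  by apply/funext => w /=; case: (f w) (g w) => a b [].
rewrite (_ : _ \o _ = (@complex.Re R \o f) \* (@complex.Im R \o g) \+
  (@complex.Im R \o f) \* (@complex.Re R \o g)).
  by apply: measurable_funD; exact: measurable_funM.
by apply/funext => w /=; case: (f w) (g w) => a b [].
Qed.

Lemma measurable_complex_prod (I : Type) (s : seq I) (P : pred I)
    (f : I -> T -> R[i]) :
  (forall i, P i -> measurable_complex (f i)) ->
  measurable_complex (fun w => \prod_(i <- s | P i) f i w).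
Proof.
move=> mf; elim: s => [|i s IH].
  by under eq_fun do rewrite big_nil; exact: measurable_complex_cst.
under eq_fun do rewrite big_cons; case Pi: (P i) => //.
by apply: measurable_complexM => //; exact: mf.
Qed.

Lemma measurable_cmod (f : T -> R[i]) : measurable_complex f ->
  measurable_fun setT (fun w => cmod (f w)).
Proof.
move=> [f1 f2]; rewrite /cmod.
apply: (@measurableT_comp _ _ _ _ _ _ (@Num.sqrt R)).
  by apply: continuous_measurable_fun; exact: sqrt_continuous.
by apply: measurable_funD; apply: measurable_funX.
Qed.

Lemma measurable_to_complex (f : T -> plane R) : measurable_fun setT f ->
  measurable_complex (fun w => to_complex (f w)).
Proof.
move=> mf; split.
  by apply: measurableT_comp mf; exact: measurable_fst.
by apply: measurableT_comp mf; exact: measurable_snd.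
Qed.

Lemma measurable_of_complex (f : T -> R[i]) : measurable_complex f ->
  measurable_fun setT (fun w => of_complex (f w) : plane R).
Proof. by move=> [f1 f2]; exact: measurable_fun_pair. Qed.

Lemma measurable_lt (f g : T -> R) : measurable_fun setT f ->
  measurable_fun setT g -> measurable [set w | f w < g w].
Proof.
move=> mf mg; rewrite -[X in measurable X]setTI.
exact: (measurable_fun_ltr mf mg).
Qed.

Lemma measurable_le (f g : T -> R) : measurable_fun setT f ->
  measurable_fun setT g -> measurable [set w | f w <= g w].
Proof.
move=> mf mg; rewrite -[X in measurable X]setTI.
exact: (measurable_fun_ler mf mg).
Qed.

Lemma measurable_logmax (r : R) (f : T -> R[i]) : measurable_complex f ->
  measurable_fun setT (fun w => logmax r (f w)).
Proof.
move=> mf; apply: measurableT_comp; first exact: measurable_ln.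
by apply: measurable_maxr; [exact: measurable_cmod|exact: measurable_cst].
Qed.

End complex_measurability.

Section invariant_integrals.
Local Open Scope ereal_scope.
Context d (T : measurableType d) (R : realType).
Variables (m : {measure set T -> \bar R}) (r : T -> T).
Hypothesis mr : measurable_fun setT r.
Hypothesis inv : forall A, measurable A -> m (r @^-1` A) = m A.

Lemma integral_invariant (D : set T) (f : T -> \bar R) : measurable D ->
  measurable_fun setT f ->
  \int[m]_(x in r @^-1` D) f (r x) = \int[m]_(x in D) f x.
Proof.
move=> mD mf.
have ge0 g : measurable_fun setT g -> (forall x, 0 <= g x) ->
    \int[m]_(x in r @^-1` D) g (r x) = \int[m]_(x in D) g x.
  move=> mg g0.
  rewrite -(ge0_integral_pushforward mr m mD); last 2 first.
  - exact: measurable_funTS.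
  - by move=> x _.
  by apply: eq_measure_integral => A mA _; exact: inv.
rewrite integralE [RHS]integralE; congr (_ - _).
  by rewrite (funepos_comp f r) ge0//; exact: measurable_funepos.
by rewrite (funeneg_comp f r) ge0//; exact: measurable_funeneg.
Qed.

End invariant_integrals.

(** * Rotation invariance of planar Lebesgue measure *)

Section planar_lebesgue.
Variable R : realType.
Local Notation leb := (@lebesgue_measure R).
Local Notation leb2 := ((leb \x leb)%E).

Lemma lebesgue_measure_translate (c : R) (A : set (measurableTypeR R)) :
  measurable A -> leb ((fun x => x + c) @^-1` A) = leb A.
Proof.
move=> mA.
have mt : measurable_fun setT ((fun x => x + c) : measurableTypeR R -> measurableTypeR R).
  by apply: measurable_funD.
apply/esym; rewrite -[RHS]/(image_measure leb mt A).
apply: lebesgue_measure_unique => //.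
move=> _ [[a b]] _ <-.
have E : (fun x => x + c) @^-1` [set` `]a, b]] = [set` `]a - c, b - c]].
  by apply/seteqP; split => x /=; rewrite !in_itv/= ltrBlDr lerBrDr.
rewrite -[RHS]/(leb ((fun x => x + c) @^-1` [set` `]a, b]])) E.
rewrite !lebesgue_measure_itv/= !lte_fin ltrD2r.
by case: ifP => // _; rewrite -!EFinB; congr (_%:E); ring.
Qed.

Lemma leb2_swap (A : set (plane R)) : measurable A ->
  leb2 ((fun p => (p.2, p.1)) @^-1` A) = leb2 A.
Proof.
move=> mA.
have ms : measurable_fun setT ((fun p => (p.2, p.1)) : plane R -> plane R).
  by apply: measurable_fun_pair; [exact: measurable_snd|exact: measurable_fst].
apply/esym; rewrite -[RHS]/(image_measure leb2 ms A).
apply: product_measure_unique => //.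
move=> B C mB mC; rewrite -[LHS]/(leb2 ((fun p => (p.2, p.1)) @^-1` (B `*` C))).
rewrite (_ : _ @^-1` _ = C `*` B); first by rewrite product_measure1E// muleC.
by apply/seteqP; split => -[x y] /= [].
Qed.

(** On the vertical line through [x] the shear is the translation by [t * x], so all sections keep
    their measure, and the two measures agree on rectangles. *)
Lemma leb2_shear_snd (t : R) (A : set (plane R)) : measurable A ->
  leb2 ((fun p => (p.1, p.2 + t * p.1)) @^-1` A) = leb2 A.
Proof.
move=> mA.
have ms : measurable_fun setT ((fun p => (p.1, p.2 + t * p.1)) : plane R -> plane R).
  apply: measurable_fun_pair; first exact: measurable_fst.
  apply: measurable_funD; first exact: measurable_snd.
  by apply: measurable_funM => //; exact: measurable_fst.
apply/esym; rewrite -[RHS]/(image_measure leb2 ms A).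
apply: product_measure_unique => //.
move=> B C mB mC; rewrite -product_measure1E//.
rewrite /product_measure1; apply: eq_integral => x _ /=.
have [xB|xB] := pselect (B x).
  rewrite in_xsectionX ?inE// -[RHS](lebesgue_measure_translate (t * x))//.
  congr (leb _); apply/seteqP; split => y /=; rewrite /xsection /= inE /=.
    by case.
  by [].
rewrite notin_xsectionX; last by rewrite notin_setE.
rewrite (_ : xsection _ _ = set0)//.
by apply/seteqP; split => y //=; rewrite /xsection /= inE /= => -[].
Qed.

Lemma leb2_shear_fst (t : R) (A : set (plane R)) : measurable A ->
  leb2 ((fun p => (p.1 + t * p.2, p.2)) @^-1` A) = leb2 A.
Proof.
move=> mA.
have ms : measurable_fun setT ((fun p => (p.2, p.1)) : plane R -> plane R).
  by apply: measurable_fun_pair; [exact: measurable_snd|exact: measurable_fst].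
have mh : measurable_fun setT ((fun p => (p.1, p.2 + t * p.1)) : plane R -> plane R).
  apply: measurable_fun_pair; first exact: measurable_fst.
  apply: measurable_funD; first exact: measurable_snd.
  by apply: measurable_funM => //; exact: measurable_fst.
rewrite -[RHS]leb2_swap// -[RHS](leb2_shear_snd t); last first.
  exact: (measurable_preimage ms).
rewrite -[RHS]leb2_swap//.
by apply: (measurable_preimage mh); exact: (measurable_preimage ms).
Qed.

Definition rotate (u : R[i]) (p : plane R) : plane R := of_complex (u * to_complex p).

Lemma measurable_rotate u : measurable_fun setT (rotate u).
Proof.
apply: measurable_of_complex; apply: measurable_complexM.
  exact: measurable_complex_cst.
exact: measurable_to_complex.
Qed.

Lemma leb2_rotate (u : R[i]) (A : set (plane R)) : cmod u = 1 -> measurable A ->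
  leb2 (rotate u @^-1` A) = leb2 A.
Proof.
have main (v : R[i]) (B : set (plane R)) : cmod v = 1 -> 1 + complex.Re v != 0 -> measurable B ->
    leb2 (rotate v @^-1` B) = leb2 B.
  case: v => c s v1 /= c1 mB.
  have cs : c ^+ 2 + s ^+ 2 = 1 by have := cmod_sqr (c +i* s); rewrite v1 expr1n.
  (* A rotation other than the half-turn is a product of three shears. *)
  pose t := - (s / (1 + c)).
  pose S1 (p : plane R) : plane R := (p.1 + t * p.2, p.2).
  pose S2 (p : plane R) : plane R := (p.1, p.2 + s * p.1).
  have mS1 : measurable_fun setT S1.
    apply: measurable_fun_pair; last exact: measurable_snd.
    apply: measurable_funD; first exact: measurable_fst.
    by apply: measurable_funM => //; exact: measurable_snd.
  have mS2 : measurable_fun setT S2.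
    apply: measurable_fun_pair; first exact: measurable_fst.
    apply: measurable_funD; first exact: measurable_snd.
    by apply: measurable_funM => //; exact: measurable_fst.
  have -> : rotate (c +i* s) @^-1` B = S1 @^-1` (S2 @^-1` (S1 @^-1` B)).
    rewrite /preimage; apply/funext => p /=; congr (B _).
    have e1 : s * t = c - 1.
      rewrite /t mulrN mulrA -expr2.
      have -> : s ^+ 2 = (1 - c) * (1 + c) by move: cs; lra.
      by rewrite mulfK// opprB.
    have e2 : t * (1 + c) = - s by rewrite /t mulNr divfK.
    rewrite /rotate /of_complex /S1 /S2 /=; congr (_, _).
      have -> : p.1 + t * p.2 + t * (p.2 + s * (p.1 + t * p.2)) =
          (1 + s * t) * p.1 + t * (1 + (1 + s * t)) * p.2 by ring.
      rewrite e1 (addrC 1 (c - 1)) subrK e2.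
      ring.
    have -> : p.2 + s * (p.1 + t * p.2) = (1 + s * t) * p.2 + s * p.1 by ring.
    rewrite e1; ring.
  have m1 : measurable (S1 @^-1` B) by exact: measurable_preimage.
  have m2 : measurable (S2 @^-1` (S1 @^-1` B)) by exact: measurable_preimage.
  by rewrite leb2_shear_fst// leb2_shear_snd// leb2_shear_fst.
move=> u1 mA; have [u0|u0] := eqVneq (1 + complex.Re u) 0; last exact: main.
have i1 : cmod ('i : R[i]) = 1 by rewrite /cmod /= expr0n /= add0r expr1n sqrtr1.
have i0 : 1 + complex.Re ('i : R[i]) != 0 by rewrite /= addr0 oner_neq0.
(* In the remaining case [u = -1], where [1 + c] vanishes; the half-turn is two quarter-turns, each
   covered by [main]. *)
have -> : rotate u @^-1` A = rotate 'i @^-1` (rotate 'i @^-1` A).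
  have -> : u = 'i * 'i.
    case: u u1 u0 => c s u1 /= u0.
    have cs : c ^+ 2 + s ^+ 2 = 1 by have := cmod_sqr (c +i* s); rewrite u1 expr1n.
    have cE : c = -1 by lra.
    have s0 : s = 0.
      by apply/eqP; rewrite -sqrf_eq0; apply/eqP; move: cs; rewrite cE; lra.
    by rewrite cE s0; apply/eqP; rewrite eq_complex /=; apply/andP; split; apply/eqP; ring.
  rewrite /preimage; apply/funext => p /=; congr (A _).
  by rewrite /rotate -mulrA; case: p.
rewrite main// ?main//.
by apply: measurable_preimage => //; exact: measurable_rotate.
Qed.

End planar_lebesgue.

(** * The radial law *)

Section radial_law.
Variables (R : realType) (mu : probability (plane R) R) (phi : R -> R).
Hypothesis phi_Cc : @Cc_infty R R^o `]1, +oo[ phi.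
Hypothesis mu_phi : forall A : set (plane R), measurable A ->
  mu A = (\int[lebesgue_measure \x lebesgue_measure]_(w in A)
            (phi (Num.sqrt (w.1 ^+ 2 + w.2 ^+ 2)))%:E)%E.

Let phi_cont : continuous (phi : R -> R).
Proof. by have [sm _ _] := phi_Cc; have [] := sm [::]. Qed.

Let phi0 x : ~ supp (phi : R^o -> R) x -> phi x = 0.
Proof.
move=> nx; apply: contrapT => hx; apply: nx; apply: subset_closure.
exact/eqP.
Qed.

Let measurable_density : measurable_fun setT
  (fun w : plane R => phi (Num.sqrt (w.1 ^+ 2 + w.2 ^+ 2))).
Proof.
apply: measurableT_comp; first exact: continuous_measurable_fun.
exact: (measurable_cmod (measurable_to_complex (@measurable_id _ _ _))).
Qed.

Let measurable_cmod_sub (z : R[i]) :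
  measurable_fun setT (fun p : plane R => cmod (to_complex p - z)).
Proof.
apply: measurable_cmod; apply: measurable_complexB; last exact: measurable_complex_cst.
exact: (measurable_to_complex (@measurable_id _ _ _)).
Qed.

Lemma radial_law_bounded : exists2 b : R, 1 <= b &
  mu [set p | ~ (1 <= cmod (to_complex p) <= b)] = 0.
Proof.
have [_ cK sK] := phi_Cc.
have [M [_ HM]] := compact_bounded cK.
exists (Num.max (M + 1) 1); first by rewrite le_max lexx orbT.
have mc : measurable_fun setT (fun p : plane R => cmod (to_complex p)).
  exact: (measurable_cmod (measurable_to_complex (@measurable_id _ _ _))).
rewrite mu_phi; last first.
  rewrite (_ : [set _ | _] = ~` ([set p | 1 <= cmod (to_complex p)] `&`
      [set p | cmod (to_complex p) <= Num.max (M + 1) 1])).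
    apply: measurableC; apply: measurableI.
      by apply: measurable_le => //; exact: measurable_cst.
    by apply: measurable_le => //; exact: measurable_cst.
  apply/seteqP; split => p /=; first by move=> + [h1 h2]; apply; rewrite h1.
  by move=> + /andP[h1 h2]; apply.
apply: integral0_eq => p /= Hp; congr (_%:E); apply: phi0 => Kp.
apply: Hp; have := sK _ Kp; rewrite /= in_itv /= andbT => /ltW p1.
rewrite -[X in _ <= X <= _]/(Num.sqrt (p.1 ^+ 2 + p.2 ^+ 2)) p1 /=.
by rewrite le_max (le_trans (ler_norm _))// HM// ltrDl.
Qed.

Lemma radial_law_ball : exists2 C : R, 0 <= C & forall (z : R[i]) (r : R), 0 <= r ->
  (mu [set p | (cmod (to_complex p - z) < r)%R] <= (C * r ^+ 2)%:E)%E.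
Proof.
have [_ cK _] := phi_Cc.
have [M M0 HM] : exists2 M, 0 <= M & forall x, `|phi x| <= M.
  have /compact_bounded[M' [_ HM']] : compact ((phi : R^o -> R^o) @` supp (phi : R^o -> R)).
    apply: continuous_compact => //.
    exact: continuous_subspaceT.
  exists (Num.max (M' + 1) 0) => [|x]; first by rewrite le_max lexx orbT.
  have [xK|/phi0 ->] := pselect (supp (phi : R^o -> R) x); last by rewrite normr0 le_max lexx orbT.
  by rewrite le_max HM'//= ?ltrDl//; exists x.
(* The disk lies in a square of area [4 * r ^+ 2], on which the density is at most [M]. *)
exists (4 * M) => [|z r r0]; first by rewrite mulr_ge0.
have mB : measurable [set p : plane R | cmod (to_complex p - z) < r].
  by apply: measurable_lt => //; exact: measurable_cst.
pose Q : set (plane R) := `[complex.Re z - r, complex.Re z + r]%classic `*`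
  `[complex.Im z - r, complex.Im z + r]%classic.
have mQ : measurable Q by apply: measurableX; exact: measurable_itv.
have BQ : [set p : plane R | cmod (to_complex p - z) < r] `<=` Q.
  move=> p /= pr; have h1 := le_lt_trans (ler_Re_cmod _) pr.
  have h2 := le_lt_trans (ler_Im_cmod _) pr.
  move: h1 h2; rewrite /Q; case: p {pr} => x y; case: z {mB Q mQ} => a c /=.
  rewrite !ltr_norml /= => /andP[h1 h2] /andP[h3 h4].
  by rewrite !in_itv /=; split; apply/andP; split; lra.
apply: (@le_trans _ _ (mu Q)); first by apply: le_measure => //; rewrite inE.
rewrite mu_phi// (le_trans (lee_abs _))//.
apply: (le_trans (le_abse_integral _ _ _)) => //.
  by apply/measurable_EFinP; exact: measurable_funTS.
apply: (@le_trans _ _ (\int[lebesgue_measure \x lebesgue_measure]_(w in Q) (cst M%:E) w)%E).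
  apply: ge0_le_integral => //.
  - by apply: measurableT_comp => //; apply/measurable_EFinP; exact: measurable_funTS.
  - by move=> p _; rewrite lee_fin HM.
rewrite integral_cst//; have := product_measure1E (@lebesgue_measure R) (@lebesgue_measure R)
  (measurable_itv `[complex.Re z - r, complex.Re z + r])
  (measurable_itv `[complex.Im z - r, complex.Im z + r]); rewrite /= -/Q => ->.
rewrite !lebesgue_measure_itv/= !lte_fin.
have H (x : R) : (if x - r < x + r then ((x + r)%:E - (x - r)%:E)%E else 0%E) = (2 * r)%:E.
  case: ifPn => [_|]; first by rewrite -EFinB; congr (_%:E); ring.
  by rewrite -leNgt => h; congr (_%:E); lra.
rewrite !H -!EFinM lee_fin le_eqVlt; apply/orP; left; apply/eqP; ring.
Qed.

Lemma radial_law_rotate (u : R[i]) (A : set (plane R)) : cmod u = 1 ->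
  measurable A -> mu (rotate u @^-1` A) = mu A.
Proof.
move=> u1 mA; rewrite !mu_phi//; last first.
  by apply: measurable_preimage => //; exact: measurable_rotate.
pose f (w : plane R) : \bar R := (phi (Num.sqrt (w.1 ^+ 2 + w.2 ^+ 2)))%:E.
rewrite -(@integral_invariant _ _ _ _ _ (measurable_rotate u) _ A f)//.
- apply: eq_integral => p _; rewrite /f.
  rewrite -[X in (phi X)%:E = _]/(cmod (to_complex p)).
  rewrite -[X in _ = (phi X)%:E]/(cmod (u * to_complex p)).
  by rewrite cmodM u1 mul1r.
- by move=> B mB; exact: leb2_rotate.
- exact/measurable_EFinP.
Qed.

End radial_law.

(** * Markov bounds, independence, and the weak law of large numbers *)

Section elementary_probability.
Context d (T : measurableType d) (R : realType) (P : probability T R).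
Local Open Scope ereal_scope.

Lemma bounded_integrable d' (T' : measurableType d')
    (m : probability T' R) (f : T' -> R) (M : R) :
  measurable_fun setT f -> (forall w, (`|f w| <= M)%R) ->
  m.-integrable setT (EFin \o f).
Proof.
move=> mf fM; apply: measurable_bounded_integrable => //.
  by rewrite [X in X < _](@probability_setT _ _ _ m) ltry.
exists M; split; first exact: num_real.
by move=> x Mx w _; exact: le_trans (fM w) (ltW Mx).
Qed.

Lemma integrable_sum_EFin d' (T' : measurableType d') (m : probability T' R)
    (I : Type) (s : seq I) (f : I -> T' -> R) :
  (forall i, m.-integrable setT (EFin \o f i)) ->
  m.-integrable setT (EFin \o (fun w => (\sum_(i <- s) f i w)%R)).
Proof.
move=> fi; rewrite (_ : _ \o _ = fun w => \sum_(i <- s) (EFin \o f i) w).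
  by apply: integrable_sum => // i _; exact: fi.
by apply/funext => w; rewrite /= sumEFin.
Qed.

Lemma Rintegral_sum d' (T' : measurableType d') (m : probability T' R)
    (I : Type) (s : seq I) (f : I -> T' -> R) :
  (forall i, m.-integrable setT (EFin \o f i)) ->
  (\int[m]_w (\sum_(i <- s) f i w) = \sum_(i <- s) \int[m]_w f i w)%R.
Proof.
move=> fi; elim: s => [|i s IH].
  by under eq_Rintegral do rewrite big_nil; rewrite big_nil Rintegral_cst// mul0r.
under eq_Rintegral do rewrite big_cons.
by rewrite RintegralD// ?IH ?big_cons//; exact: integrable_sum_EFin.
Qed.

Lemma markov_ineq (f : T -> R) (l : R) : (0 < l)%R -> measurable_fun setT f ->
  (forall w, (0 <= f w)%R) ->
  P [set w | (l <= f w)%R] <= (l^-1)%:E * \int[P]_w (f w)%:E.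
Proof.
move=> l0 mf f0; set A := [set w | _].
have mA : measurable A by apply: measurable_le => //; exact: measurable_cst.
have mEf : measurable_fun setT (EFin \o f) by exact/measurable_EFinP.
have H : l%:E * P A <= \int[P]_w (f w)%:E.
  rewrite -integral_cst//; apply: (@le_trans _ _ (\int[P]_(w in A) (f w)%:E)).
    apply: ge0_le_integral => //; first by move=> w _; rewrite lee_fin ltW.
    by apply: measurable_funTS.
  by apply: ge0_subset_integral => //; move=> w _; rewrite lee_fin.
rewrite -[leLHS]mul1e -(mulVf (lt0r_neq0 l0)) EFinM -muleA.
by rewrite lee_wpmul2l// lee_fin invr_ge0 ltW.
Qed.

Lemma markov_indic (I : Type) (s : seq I) (A : I -> set T) (c l : R) :
  (0 < l)%R -> (forall i, measurable (A i)) ->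
  \sum_(i <- s) P (A i) <= c%:E ->
  P [set w | (l <= \sum_(i <- s) \1_(A i) w)%R] <= (c / l)%:E.
Proof.
move=> l0 mA Hc; have mi i : measurable_fun setT (\1_(A i) : T -> R).
  exact: measurable_indic.
apply: le_trans (markov_ineq l0 _ _) _.
- exact: measurable_sum.
- by move=> w; rewrite sumr_ge0.
under eq_integral do rewrite -sumEFin.
rewrite ge0_integral_sum//.
  under eq_bigr do rewrite integral_indic// setIT.
  by rewrite mulrC EFinM lee_wpmul2l// lee_fin invr_ge0 ltW.
by move=> i; exact/measurable_EFinP.
Qed.

(** Markov's inequality at level 1: a sum of indicators is a natural number, so it vanishes as soon
    as it is below 1. *)
Lemma union_bound (I : Type) (s : seq I) (A : I -> set T) (c : R) :
  (forall i, measurable (A i)) -> \sum_(i <- s) P (A i) <= c%:E ->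
  exists B, [/\ measurable B, P B <= c%:E &
    forall w, ~ B w -> (\sum_(i <- s) \1_(A i) w)%R = 0%R :> R].
Proof.
move=> mA Hc.
exists [set w | (1 <= \sum_(i <- s) \1_(A i) w :> R)%R]; split.
- apply: measurable_le; first exact: measurable_cst.
  by apply: measurable_sum => i; exact: measurable_indic.
- by rewrite -[c]divr1; exact: markov_indic.
move=> w /= /negP; rewrite -ltNge.
have -> : (\sum_(i <- s) \1_(A i) w)%R = ((\sum_(i <- s) (w \in A i : nat))%N%:R : R)%R.
  by rewrite natr_sum; apply: eq_bigr => i _; rewrite indicE.
by rewrite -[X in (_ < X)%R]/(1%N%:R)%R ltr_nat ltnS leqn0 => /eqP ->.
Qed.

Lemma joint_law d1 d2 (T1 : measurableType d1) (T2 : measurableType d2)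
    (m1 : probability T1 R) (m2 : probability T2 R)
    (X : T -> T1) (Y : T -> T2) :
  measurable_fun setT X -> measurable_fun setT Y ->
  (forall A B, measurable A -> measurable B ->
     P (X @^-1` A `&` Y @^-1` B) = m1 A * m2 B) ->
  forall S, measurable S -> P ((fun w => (X w, Y w)) @^-1` S) = (m1 \x m2) S.
Proof.
move=> mX mY H S mS.
have mXY : measurable_fun setT (fun w => (X w, Y w)) by exact: measurable_fun_pair.
rewrite -[LHS]/(image_measure P mXY S); apply/esym.
by apply: product_measure_unique.
Qed.

(** Fubini in place of conditioning: for each frozen value of [Y] the bad values of [X] have measure
    at most [c], and this bound is integrated against the law of [Y]. *)
Lemma independent_section_bound d1 d2 (T1 : measurableType d1)
    (T2 : measurableType d2) (m : probability T2 R)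
    (Y : T -> T1) (X : T -> T2) (c : R) (S : set (T1 * T2)) :
  measurable_fun setT X -> measurable_fun setT Y ->
  (forall A B, measurable A -> measurable B ->
     P (Y @^-1` A `&` X @^-1` B) = P (Y @^-1` A) * m B) ->
  measurable S -> (forall y, m [set x | S (y, x)] <= c%:E) ->
  P [set w | S (Y w, X w)] <= c%:E.
Proof.
move=> mX mY H mS Hc.
pose mix := isMeasurableFun.Build _ _ _ _ _ mY.
pose Ym : {mfun T >-> T1} := HB.pack Y mix.
rewrite -[leLHS]/(P ((fun w => (Y w, X w)) @^-1` S)).
rewrite (@joint_law _ _ _ _ (distribution P Ym) m)//.
rewrite /product_measure1 /=.
apply: (@le_trans _ _ (\int[distribution P Ym]_x (cst c%:E) x)).
  apply: ge0_le_integral => //.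
  - exact: measurable_fun_xsection.
  - move=> y _; apply: le_trans (Hc y).
    by rewrite le_eqVlt; apply/orP; left; apply/eqP; congr (m _);
       apply/seteqP; split => x; rewrite /xsection /= inE.
rewrite integral_cst// -[X in _ * X]/(distribution P Ym setT) probability_setT.
by rewrite mule1.
Qed.

Lemma product_mean0 d1 (T1 : measurableType d1) (m : probability T1 R)
    (X Y : T -> T1) (g : T1 -> R) (M : R) :
  measurable_fun setT X -> measurable_fun setT Y ->
  (forall A B, measurable A -> measurable B ->
     P (X @^-1` A `&` Y @^-1` B) = m A * m B) ->
  measurable_fun setT g -> (forall x, (`|g x| <= M)%R) ->
  \int[m]_x (g x)%:E = 0 ->
  \int[P]_w (g (X w) * g (Y w))%:E = 0.
Proof.
move=> mX mY H mg gM g0.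
have mXY : measurable_fun setT (fun w => (X w, Y w)) by exact: measurable_fun_pair.
pose F (z : T1 * T1) : R := (g z.1 * g z.2)%R.
have mF : measurable_fun setT F.
  apply: measurable_funM.
    exact: (measurableT_comp mg measurable_fst).
  exact: (measurableT_comp mg measurable_snd).
have FM z : (`|F z| <= M * M)%R by rewrite normrM ler_pM.
have iF : (m \x m).-integrable setT (EFin \o F).
  apply: measurable_bounded_integrable => //.
    rewrite -setXTT [ltLHS]product_measure1E//.
    by rewrite [X in X * X](@probability_setT _ _ _ m) mule1 ltry.
  exists (M * M)%R; split; first exact: num_real.
  by move=> x Mx w _; exact: le_trans (FM w) (ltW Mx).
transitivity (\int[image_measure P mXY]_z (F z)%:E).
  rewrite /image_measure integral_pushforward//.
  - exact/measurable_EFinP.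
  - rewrite preimage_setT; apply: (@bounded_integrable _ _ _ _ (M * M)) => [|w].
      exact: measurableT_comp.
    exact: FM.
transitivity (\int[(m \x m)]_z (F z)%:E).
  by apply: eq_measure_integral => S mS _; exact: joint_law.
rewrite -(integral12_prod_meas1 iF).
apply: integral0_eq => x _; rewrite /fubini_F /=.
transitivity (\int[m]_y ((g x)%:E * (EFin \o g) y)).
  by apply: eq_integral => y _.
rewrite integralZl//; first by rewrite g0 mule0.
exact: bounded_integrable gM.
Qed.

End elementary_probability.

(** * Independence of one variable from all the others *)

Section mutual_independence.
Context d d' (T : measurableType d) (T' : measurableType d') (R : realType).
Variables (P : probability T R) (n : nat) (X : 'I_n -> {RV P >-> T'}).
Variable m : probability T' R.
Hypothesis indep : mutually_independent X.
Hypothesis law : forall k A, measurable A -> P (X k @^-1` A) = m A.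
Local Open Scope ereal_scope.

Let rest (i : 'I_n) (B : 'I_n -> set T') : set T :=
  \bigcap_(k in [set k | k != i]) (X k @^-1` B k).

Lemma indep_one_rest i A B : measurable A -> (forall k, measurable (B k)) ->
  P (X i @^-1` A `&` rest i B) = m A * P (rest i B).
Proof.
move=> mA mB.
have H C : measurable C ->
    P (X i @^-1` C `&` rest i B) = m C * \prod_(k < n | k != i) P (X k @^-1` B k).
  move=> mC; pose B1 k := if k == i then C else B k.
  have mB1 k : measurable (B1 k) by rewrite /B1; case: ifP.
  have := indep mB1; rewrite (bigD1 i)//= /B1 eqxx law//.
  rewrite (eq_bigr (fun k => P (X k @^-1` B k))) => [<-|k /negbTE -> //].
  congr (P _); apply/seteqP; split => w.
    by move=> [wC wB] k _ /=; case: eqP => [->//|/eqP ki]; exact: wB.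
  move=> wB; split; first by have := wB i I; rewrite /= eqxx.
  by move=> k /negbTE ki; have := wB k I; rewrite /= ki.
rewrite H//; congr (_ * _).
(* Taking the whole space for the event at [i] turns the product formula into the probability of the
   remaining events. *)
have := H setT measurableT; rewrite preimage_setT setTI => ->.
by rewrite probability_setT mul1e.
Qed.

Lemma indep_pair i j A B : i != j -> measurable A -> measurable B ->
  P (X i @^-1` A `&` X j @^-1` B) = m A * m B.
Proof.
move=> ij mA mB; pose B' k := if k == j then B else setT.
have mB' k : measurable (B' k) by rewrite /B'; case: ifP.
have E : rest i B' = X j @^-1` B.
  rewrite /rest /B'; apply/seteqP; split => w.
    by move=> /(_ j); rewrite /= eqxx; apply; rewrite eq_sym.
  by move=> wB k _ /=; case: eqP => [->|].
by have := indep_one_rest i mA mB'; rewrite E => ->; rewrite law.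
Qed.

(** A pi-system that generates the sigma-algebra of all the variables except [X i]. *)
Definition other_events (i : 'I_n) : set (set T) :=
  [set E | exists2 B, (forall k, measurable (B k)) & E = rest i B].

Lemma measurable_other_events i : other_events i `<=` measurable.
Proof.
move=> _ [B mB ->]; apply: fin_bigcap_measurable; first exact: finite_finset.
by move=> k _; exact: measurable_preimage.
Qed.

(** As functions of [E], both sides are finite measures. They agree on the pi-system
    [other_events i], hence on the sigma-algebra it generates. *)
Lemma indep_other_events i A E : measurable A -> <<s other_events i >> E ->
  P (E `&` X i @^-1` A) = P E * m A.
Proof.
move=> mA GE.
have mXA : measurable (X i @^-1` A) by exact: measurable_preimage.
have c0 : (0 <= fine (m A))%R by rewrite fine_ge0.
have mAE : m A = (fine (m A))%:E by rewrite fineK// fin_num_measure.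
suff : mrestr P mXA E = mscale (NngNum c0) P E.
  by rewrite /mrestr /mscale /= -mAE muleC.
apply: (g_sigma_algebra_measure_unique (other_events i)
  (@measurable_other_events i) (fun=> setT)) => //.
- move=> _; exists (fun=> setT) => //.
  by rewrite /rest; apply/seteqP; split.
- by apply/seteqP; split => // w _; exists 0%N.
- move=> _ _ [B1 mB1 ->] [B2 mB2 ->].
  exists (fun k => B1 k `&` B2 k); first by move=> k; exact: measurableI.
  apply/seteqP; split => w.
    by move=> [h1 h2] k ki; split; [exact: h1|exact: h2].
  by move=> h; split => k ki; have [] := h k ki.
- move=> _ [B mB ->]; rewrite -[LHS]/(P (rest i B `&` X i @^-1` A)).
  rewrite -[RHS]/((fine (m A))%:E * P (rest i B)) -mAE setIC.
  exact: indep_one_rest.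
- by move=> _; rewrite /mrestr (le_lt_trans (probability_le1 _ _)) ?ltry// setTI.
Qed.

Lemma measurable_other i k : k != i ->
  measurable_fun setT (X k : g_sigma_algebraType (other_events i) -> T').
Proof.
move=> ki _ A mA; rewrite setTI; apply: sub_sigma_algebra.
exists (fun j => if j == k then A else setT); first by move=> j; case: ifP.
apply/seteqP; split => w.
  by move=> wA j _ /=; case: eqP => [->|].
by move=> /(_ k ki); rewrite /= eqxx.
Qed.

Lemma indep_function i d2 (T2 : measurableType d2) (Y : T -> T2) A B :
  measurable_fun setT (Y : g_sigma_algebraType (other_events i) -> T2) ->
  measurable A -> measurable B ->
  P (Y @^-1` A `&` X i @^-1` B) = P (Y @^-1` A) * m B.
Proof.
move=> mY mA mB; apply: indep_other_events => //.
by have := mY measurableT A mA; rewrite setTI.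
Qed.

End mutual_independence.

(** * Weak law of large numbers for bounded functions *)

Section law_of_large_numbers.
Context d d' (T : measurableType d) (T' : measurableType d') (R : realType).
Variables (P : probability T R) (n : nat) (X : 'I_n -> {RV P >-> T'}).
Variable m : probability T' R.
Hypothesis indep : mutually_independent X.
Hypothesis law : forall k A, measurable A -> P (X k @^-1` A) = m A.
Local Open Scope ereal_scope.

(** Expanding the square, the off-diagonal products have mean 0 by pairwise independence, and the
    [n] diagonal ones are at most [M ^+ 2]. *)
Lemma second_moment_sum (g : T' -> R) (M : R) :
  measurable_fun setT g -> (forall x, (`|g x| <= M)%R) ->
  \int[m]_x (g x)%:E = 0 ->
  \int[P]_w ((\sum_(k < n) g (X k w)) ^+ 2)%:E <= (n%:R * M ^+ 2)%:E.
Proof.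
move=> mg gM g0.
have mgX k : measurable_fun setT (fun w => g (X k w)) by exact: measurableT_comp.
have int i j : P.-integrable setT (EFin \o (fun w => g (X i w) * g (X j w))%R).
  apply: (@bounded_integrable R _ _ _ _ ((M * M)%R)); first exact: measurable_funM.
  by move=> w; rewrite normrM ler_pM.
rewrite (eq_integral (fun w => \sum_(i < n) \sum_(j < n)
    (g (X i w) * g (X j w))%:E)); last first.
  move=> w _; rewrite expr2 mulr_suml -sumEFin; apply: eq_bigr => i _.
  by rewrite mulr_sumr -sumEFin.
rewrite integral_sum//; last by move=> i; apply: integrable_sum => // j _; exact: int.
have -> : (n%:R * M ^+ 2)%:E = \sum_(i < n) (M ^+ 2)%:E.
  by rewrite sumEFin sumr_const card_ord mulr_natl.
apply: lee_sum => i _; rewrite integral_sum//; last by move=> j; exact: int.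
rewrite (bigD1 i)//= big1 ?adde0 => [|j ji]; last first.
  apply: (product_mean0 (M := M) _ _ _ mg gM g0) => //.
  by move=> A B mA mB; apply: (indep_pair indep law) => //; rewrite eq_sym.
apply: (@le_trans _ _ (\int[P]_w (cst (M ^+ 2)%:E) w)).
  apply: ge0_le_integral => //.
  - by move=> w _; rewrite lee_fin -expr2 sqr_ge0.
  - by case/integrableP: (int i i).
  - by move=> w _; rewrite lee_fin -expr2 -real_normK ?num_real// lerXn2r//
      nnegrE (le_trans _ (gM (X i w))).
by rewrite integral_cst// [X in _ * X](@probability_setT _ _ _ P) mule1.
Qed.

Lemma weak_law (g : T' -> R) (M e : R) : (0 < n)%N -> (0 < e)%R ->
  measurable_fun setT g -> (forall x, (`|g x| <= M)%R) ->
  exists B, [/\ measurable B, P B <= ((2 * M) ^+ 2 / e ^+ 2 / n%:R)%:E &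
    forall w, ~ B w ->
      (`|\sum_(k < n) g (X k w) - n%:R * (\int[m]_x g x)| <= n%:R * e)%R].
Proof.
move=> n0 e0 mg gM; set c := (\int[m]_x g x)%R.
have ig := bounded_integrable m mg gM.
have cM : (`|c| <= M)%R.
  rewrite (le_trans (le_normr_Rintegral _ _))//.
  have -> : M = (\int[m]_x (cst M) x)%R.
    by rewrite Rintegral_cst// [X in fine X](@probability_setT _ _ _ m) mulr1.
  apply: le_Rintegral => //.
  - exact: integrable_norm.
  - apply: (@bounded_integrable R _ _ _ _ (`|M|%R)) => //.
have mG : measurable_fun setT (fun x => g x - c)%R by exact: measurable_funB.
have GM x : (`|g x - c| <= 2 * M)%R.
  rewrite (le_trans (ler_normB _ _))//; have := gM x; lra.
have G0 : \int[m]_x (g x - c)%:E = 0.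
  under eq_integral do rewrite EFinB.
  rewrite integralB_EFin//; last first.
    by apply: (@bounded_integrable R _ _ _ _ (`|c|%R)).
  rewrite integral_cst// [X in _ * X](@probability_setT _ _ _ m) mule1.
  by rewrite /c /Rintegral fineK ?subee//; exact: integrable_fin_num.
pose f w := ((\sum_(k < n) (g (X k w) - c)) ^+ 2)%R.
have mf : measurable_fun setT f.
  apply: measurable_funX; apply: measurable_sum => k.
  exact: (measurableT_comp mG).
have nR : (0 < n%:R :> R)%R by rewrite ltr0n.
have ne0 : (0 < (n%:R * e) ^+ 2)%R by rewrite exprn_gt0// mulr_gt0.
exists [set w | ((n%:R * e) ^+ 2 <= f w)%R]; split.
- by apply: measurable_le => //; exact: measurable_cst.
- apply: le_trans (markov_ineq P ne0 mf _) _; first by move=> w; exact: sqr_ge0.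
  have H := second_moment_sum mG GM G0.
  apply: le_trans (lee_wpmul2l _ H) _; first by rewrite lee_fin invr_ge0 ltW.
  rewrite -EFinM lee_fin le_eqVlt; apply/orP; left; apply/eqP.
  by field; rewrite !gt_eqF.
move=> w /= /negP; rewrite -ltNge /f => H.
have -> : (\sum_(k < n) g (X k w) - n%:R * c = \sum_(k < n) (g (X k w) - c))%R.
  by rewrite sumrB sumr_const card_ord mulr_natl.
apply: ler_sqrW; first by rewrite mulr_ge0// ltW.
by rewrite real_normK ?num_real// ltW.
Qed.

End law_of_large_numbers.

(** * Roots of a random polynomial and of its shift *)

Section high_probability.
Context d (T : measurableType d) (R : realType) (P : probability T R).

(* Up to an exceptional measurable set of probability at most [p], which spares
   us the measurability of [Q n] itself. *)
Definition eventually_off (p : R) (Q : nat -> T -> Prop) : Prop :=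
  exists n0, forall n, (n0 <= n)%N ->
    exists B, [/\ measurable B, (P B <= p%:E)%E & forall w, ~ B w -> Q n w].

Lemma eventually_off_and p1 p2 (Q1 Q2 : nat -> T -> Prop) :
  eventually_off p1 Q1 -> eventually_off p2 Q2 ->
  eventually_off (p1 + p2) (fun n w => Q1 n w /\ Q2 n w).
Proof.
move=> [n1 H1] [n2 H2]; exists (maxn n1 n2) => n.
rewrite geq_max => /andP[/H1 [B1 [mB1 P1 Q1']] /H2 [B2 [mB2 P2 Q2']]].
exists (B1 `|` B2); split; first exact: measurableU.
  by rewrite (le_trans (measureU2 _ _ _))// EFinD leeD.
by move=> w /not_orP [/Q1' ? /Q2' ?].
Qed.

Lemma eventually_off_sub p (Q1 Q2 : nat -> T -> Prop) n1 :
  (forall n w, (n1 <= n)%N -> Q1 n w -> Q2 n w) ->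
  eventually_off p Q1 -> eventually_off p Q2.
Proof.
move=> Q12 [n0 H]; exists (maxn n0 n1) => n.
rewrite geq_max => /andP[/H [B [mB PB HB]] nn1].
by exists B; split=> // w /HB; exact: Q12.
Qed.

Lemma eventually_off_rate (K p : R) (Q : nat -> T -> Prop) : 0 < p ->
  (forall n, (0 < n)%N -> exists B,
     [/\ measurable B, (P B <= (K / n%:R)%:E)%E & forall w, ~ B w -> Q n w]) ->
  eventually_off p Q.
Proof.
move=> p0 H; exists (Num.truncn (K / p)).+1 => n nK.
have n0 : (0 < n)%N by case: n nK.
have [B [mB PB HB]] := H n n0; exists B; split=> //.
rewrite (le_trans PB)// lee_fin ler_pdivrMr ?ltr0n// mulrC -ler_pdivrMr//.
by rewrite ltW// (lt_le_trans (truncnS_gt _))// ler_nat.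
Qed.

Lemma eventually_off_seq (I : eqType) (s : seq I) (p : R) (Q : I -> nat -> T -> Prop) :
  0 < p ->
  (forall i p', i \in s -> 0 < p' -> eventually_off p' (Q i)) ->
  eventually_off p (fun n w => forall i, i \in s -> Q i n w).
Proof.
elim: s p => [|i s IH] p p0 H.
  exists 0%N => n _; exists set0; split=> //; first by rewrite measure0 lee_fin ltW.
have p20 : 0 < p / 2 by rewrite divr_gt0.
have H1 := H i _ (mem_head _ _) p20.
have H2 : eventually_off (p / 2) (fun n w => forall i, i \in s -> Q i n w).
  by apply: IH => // j p' js; apply: H; rewrite inE js orbT.
rewrite (splitr p); apply: (@eventually_off_sub _ _ _ 0%N)
  (eventually_off_and H1 H2) => n w _ [h1 h2] j.
by rewrite inE => /orP[/eqP ->|/h2].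
Qed.

End high_probability.

(** * Dyadic count of the truncation error *)

Section dyadic.
Variable R : realType.

(** Halving the truncation level lowers the truncated logarithm by at most [ln 2 <= 1], and only if
    [|x|] is below the level. The error thus becomes a sum of indicators of disks, whose expectation
    [mu_ball] controls. *)
Lemma logmax_dyadic m (r : R) (x : R[i]) : 0 < r -> r / 2 ^+ m <= cmod x ->
  logmax r x - ln (cmod x) <= \sum_(i < m) (cmod x < r / 2 ^+ i)%R%:R.
Proof.
elim: m r => [|m IH] r r0.
  rewrite expr0 divr1 big_ord0 => rx.
  by rewrite /logmax max_l// subrr.
move=> Hx; have x0 : 0 < cmod x by rewrite (lt_le_trans _ Hx)// divr_gt0// exprn_gt0.
have r20 : 0 < r / 2 by rewrite divr_gt0.
have [rx|xr] := leP r (cmod x).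
  by rewrite /logmax max_l// subrr sumr_ge0.
rewrite big_ord_recl expr0 divr1 xr mulr1n.
have := IH (r / 2) r20; rewrite -mulrA -invfM -exprS => /(_ Hx).
have -> : \sum_(i < m) (cmod x < r / 2 / 2 ^+ i)%R%:R =
    \sum_(i < m) (cmod x < r / 2 ^+ (lift ord0 i))%R%:R :> R.
  by apply: eq_bigr => i _; rewrite -mulrA -invfM -exprS.
have : logmax r x <= 1 + logmax (r / 2) x.
  apply: (@le_trans _ _ (ln 2 + logmax (r / 2) x)); last by rewrite lerD2r ln2_le1.
  rewrite /logmax (max_r (ltW xr)) -lnM ?posrE ?lt_max ?r20 ?orbT//.
  apply: ler_lnW => //; rewrite -ler_pdivrMl// mulrC.
  by rewrite le_max lexx orbT.
lra.
Qed.

Lemma sum_quarter_le n : \sum_(i < n) (4 ^+ i)^-1 <= (2 : R).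
Proof.
suff : \sum_(i < n) (4 ^+ i)^-1 <= (2 - 2 * (4 ^+ n)^-1 : R).
  by move/le_trans; apply; rewrite gerBl mulr_ge0// invr_ge0 exprn_ge0.
elim: n => [|n IH]; first by rewrite big_ord0 expr0 invr1; lra.
rewrite big_ord_recr /= exprS invfM.
have : (0 : R) <= (4 ^+ n)^-1 by rewrite invr_ge0 exprn_ge0.
by move: IH; set q : R := (4 ^+ n)^-1; lra.
Qed.

Lemma sqr_le_4X n : (n%:R ^+ 2 <= 4 ^+ n :> R).
Proof.
have -> : (4 : R) = 2 ^+ 2 by rewrite expr2; ring.
rewrite -exprM mulnC exprM lerXn2r// ?nnegrE ?exprn_ge0//.
by rewrite -natrX ler_nat ltnW// ltn_expl.
Qed.

End dyadic.

(** * Potentials of independent points with the radial law *)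

Section planar_sample.
Variables (R : realType) (mu : probability (plane R) R).
Context d (T : measurableType d) (P : probability T R).
Variable Z : forall n : nat, 'I_n -> {RV P >-> plane R}.
Hypothesis Z_indep : forall n, mutually_independent (Z (n := n)).
Hypothesis Z_law : forall n (k : 'I_n) (A : set (plane R)), measurable A ->
  P (Z k @^-1` A) = mu A.
Variables (b C : R).
Hypothesis b1 : 1 <= b.
Hypothesis mu_supp : mu [set p | ~ (1 <= cmod (to_complex p) <= b)] = 0.
Hypothesis C0 : 0 <= C.
Hypothesis mu_ball : forall (z : R[i]) (r : R), 0 <= r ->
  (mu [set p | (cmod (to_complex p - z) < r)%R] <= (C * r ^+ 2)%:E)%E.
Hypothesis mu_rotate : forall (u : R[i]) (A : set (plane R)), cmod u = 1 ->
  measurable A -> mu (rotate u @^-1` A) = mu A.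

Definition sample n w : seq R[i] := [seq to_complex (Z k w) | k : 'I_n].

Lemma size_sample n w : size (sample n w) = n.
Proof. by rewrite size_map size_enum_ord. Qed.

Lemma big_sample (V : Type) (idx : V) (op : Monoid.com_law idx) n w (F : R[i] -> V) :
  \big[op/idx]_(z <- sample n w) F z = \big[op/idx]_(k < n) F (to_complex (Z k w)).
Proof. by rewrite big_map big_enum. Qed.

Let mid : measurable_complex (@to_complex R).
Proof. exact: (measurable_to_complex (@measurable_id _ _ _)). Qed.

Let mcmod z : measurable_fun setT (fun p : plane R => cmod (to_complex p - z)).
Proof.
by apply: measurable_cmod; apply: measurable_complexB => //; exact: measurable_complex_cst.
Qed.

Let mcmod0 : measurable_fun setT (fun p : plane R => cmod (to_complex p)).
Proof. exact: measurable_cmod. Qed.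

Let annulus : set (plane R) := [set p | 1 <= cmod (to_complex p) <= b].

Let mannulus : measurable annulus.
Proof.
rewrite (_ : annulus = [set p | 1 <= cmod (to_complex p)] `&`
      [set p | cmod (to_complex p) <= b]).
  by apply: measurableI; apply: measurable_le => //; exact: measurable_cst.
by apply/seteqP; split => p /=; [move=> /andP[]|move=> [h1 h2]; apply/andP].
Qed.

Lemma sample_supp n : exists B, [/\ measurable B, (P B <= 0)%E &
  forall w, ~ B w -> forall z, z \in sample n w -> 1 <= cmod z <= b].
Proof.
have mA : measurable (~` annulus) by exact: measurableC.
have mAk (k : 'I_n) : measurable (Z k @^-1` (~` annulus)).
  exact: measurable_preimage.
have H : (\sum_(k <- enum 'I_n) P (Z k @^-1` (~` annulus)) <= (0 : R)%:E)%E.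
  rewrite big1// => k _; rewrite Z_law//.
have [B [mB PB HB]] := union_bound mAk H.
exists B; split=> // w /HB H0 z /mapP[k _ ->].
apply: contrapT => nk.
have : 0 < \sum_(i <- enum 'I_n) (\1_(Z i @^-1` (~` annulus)) w) :> R.
  rewrite big_enum /= (bigD1 k)//= indicE mem_set// ltr_pwDl//.
  by rewrite sumr_ge0.
by rewrite H0 ltxx.
Qed.

(** Logarithms are unbounded on the plane, while the law of large numbers above is for bounded
    functions. Almost surely the sample lies in the annulus, where clipping changes nothing. *)
Let clip (f : R[i] -> R) (p : plane R) : R := f (to_complex p) * \1_annulus p.

Let mclip f : measurable_fun setT (fun p : plane R => f (to_complex p)) ->
  measurable_fun setT (clip f).
Proof. by move=> mf; apply: measurable_funM => //; exact: measurable_indic. Qed.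

Let mlogmax r x : measurable_fun setT (fun p : plane R => logmax r (to_complex p - x)).
Proof.
by apply: measurable_logmax; apply: measurable_complexB => //; exact: measurable_complex_cst.
Qed.

Let bclip r x : 0 < r -> exists M, forall p, `|clip (fun z => logmax r (z - x)) p| <= M.
Proof.
move=> r0; exists (`|logmax r 0| + (`|b| + cmod x) / r) => p.
have h0 : 0 <= (`|b| + cmod x) / r.
  by rewrite divr_ge0 ?addr_ge0 ?cmod_ge0// ltW.
rewrite /clip indicE; case: (boolP (p \in annulus)) => [|_]; last first.
  by rewrite mulr0 normr0 addr_ge0.
rewrite inE /annulus /= => /andP[_ pb]; rewrite mulr1.
have := dist_logmax (to_complex p - x) 0 r0; rewrite subr0 => H.
rewrite -[X in `|X|](subrK (logmax r 0)) addrC (le_trans (ler_normD _ _))// lerD2l.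
rewrite (le_trans H)// ler_wpM2r ?invr_ge0 ?(ltW r0)//.
by rewrite (le_trans (cmodD _ _))// cmodN lerD2r (le_trans pb)// ler_norm.
Qed.

Let clipln : clip (fun z => ln (cmod z)) = clip (fun z => logmax 1 (z - 0)).
Proof.
apply/funext => p; rewrite /clip indicE; case: (boolP (p \in annulus)) => [|_]; last first.
  by rewrite !mulr0.
by rewrite inE /annulus /= => /andP[p1 _]; rewrite !mulr1 subr0 /logmax max_l.
Qed.

(* Averaging over the rotations by the [N]-th roots of unity replaces
   [logmax r (z - x)] by a mean over a polygon, which is at least
   [ln (max |x| |z|)] up to [O(1/N)]. *)
Lemma potential_min (x : R[i]) (r : R) : 0 < r ->
  \int[mu]_p clip (fun z => ln (cmod z)) p <=
  \int[mu]_p clip (fun z => logmax r (z - x)) p.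
Proof.
move=> r0; set g0 := clip _; set g := clip _.
have mg0 : measurable_fun setT g0 by rewrite /g0 clipln; exact: mclip.
have mg : measurable_fun setT g by exact: mclip.
have [M0 HM0] : exists M, forall p, `|g0 p| <= M by rewrite /g0 clipln; exact: bclip.
have [M HM] := bclip x r0.
have ig0 := bounded_integrable mu mg0 HM0.
pose B := Num.max b (cmod x).
pose K := B / r; have K0 : 0 <= K by rewrite divr_ge0 ?(ltW r0)// le_max (le_trans ler01 b1).
apply: (@le_of_mul_natP _ _ _ K 1) => N N0.
have gu u p : u \in unity R N ->
    g (rotate u p) = logmax r (u * to_complex p - x) * \1_annulus p.
  move=> uN; rewrite /g /clip; congr (_ * _).
    by rewrite /rotate /to_complex /of_complex /=; case: (u * _).
  have cu : cmod (to_complex (rotate u p)) = cmod (to_complex p).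
    by rewrite -[LHS]/(cmod (u * to_complex p)) cmodM (cmod_unity N0 uN) mul1r.
  by rewrite !indicE; congr (_%:R); congr nat_of_bool; apply/idP/idP; rewrite !inE /annulus /= cu.
have mgu u : measurable_fun setT (fun p => g (rotate u p)).
  by apply: measurableT_comp => //; exact: measurable_rotate.
have igu u : mu.-integrable setT (EFin \o (fun p => g (rotate u p))).
  by apply: (bounded_integrable mu (mgu u)) => p; exact: HM.
have Eu u : u \in unity R N -> \int[mu]_p g (rotate u p) = \int[mu]_p g p.
  move=> uN; rewrite /Rintegral; congr fine.
  have := @integral_invariant _ _ _ mu _ (measurable_rotate u) _ setT (EFin \o g) measurableT _.
  rewrite preimage_setT; apply; last exact/measurable_EFinP.
  by move=> A mA; apply: mu_rotate => //; exact: cmod_unity uN.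
have : \int[mu]_p (N%:R * g0 p - K) <= \int[mu]_p (\sum_(u <- unity R N) g (rotate u p)).
  apply: le_Rintegral => //; [|exact: integrable_sum_EFin|].
    apply: (@bounded_integrable _ _ _ _ _ (N%:R * M0 + K)) => [|p].
      by apply: measurable_funB; [apply: measurable_funM|]; do ?exact: measurable_cst.
    rewrite (le_trans (ler_normB _ _))// (ger0_norm K0) lerD2r normrM ger0_norm//.
    by rewrite ler_wpM2l.
  move=> p _; rewrite big_seq.
  rewrite (eq_bigr (fun u => logmax r (u * to_complex p - x) * \1_annulus p))
    => [|u uN]; last exact: gu.
  rewrite -big_seq -mulr_suml /g0 /clip indicE.
  case: (boolP (p \in annulus)) => [|_]; last first.
    by rewrite !mulr0 sub0r oppr_le0.
  rewrite inE /annulus /= => /andP[p1 pb]; rewrite !mulr1 lerBlDr.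
  have pp : 0 < cmod (to_complex p) by rewrite (lt_le_trans ltr01).
  have pB : cmod (to_complex p) <= B by rewrite le_max pb.
  have xB : cmod x <= B by rewrite le_max lexx orbT.
  have := logmax_polygon_ge N0 r0 pp pB xB.
  rewrite -/K => H; apply: (le_trans _ (le_trans H _)).
    by rewrite ler_wpM2l// ler_lnW// le_max lexx orbT.
  rewrite lerD2r; apply: ler_sum => u _; rewrite /logmax.
  by rewrite cmodB.
rewrite Rintegral_sum// big_seq (eq_bigr (fun=> \int[mu]_p g p)) => [|u uN]; last exact: Eu.
rewrite -big_seq sum_unity_const//.
rewrite RintegralB//; last 2 first.
- apply: (@bounded_integrable _ _ _ _ _ (N%:R * M0)) => [|p].
    by apply: measurable_funM => //; exact: measurable_cst.
  by rewrite normrM ger0_norm// ler_wpM2l.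
- by apply: (@bounded_integrable _ _ _ _ _ `|K|) => //; exact: measurable_cst.
rewrite RintegralZl// Rintegral_cst// [X in _ - K * fine X](@probability_setT _ _ _ mu) mulr1.
by rewrite lerBlDr.
Qed.

Let sum_clip n w f : (forall z, z \in sample n w -> 1 <= cmod z <= b) ->
  \sum_(k < n) clip f (Z k w) = \sum_(z <- sample n w) f z.
Proof.
move=> H; rewrite big_sample; apply: eq_bigr => k _; rewrite /clip indicE.
rewrite mem_set ?mulr1//; apply: H.
by apply/mapP; exists k; rewrite ?mem_enum.
Qed.

Let eventually_supp p : 0 < p -> eventually_off P p
  (fun n w => forall z, z \in sample n w -> 1 <= cmod z <= b).
Proof.
move=> p0; exists 0%N => n _; have [B [mB PB HB]] := sample_supp n.
by exists B; split=> //; rewrite (le_trans PB)// lee_fin ltW.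
Qed.

Let eventually_clip f M e p : 0 < e -> 0 < p -> measurable_fun setT (clip f) ->
  (forall q, `|clip f q| <= M) ->
  eventually_off P p (fun n w =>
    `|\sum_(z <- sample n w) f z - n%:R * \int[mu]_q clip f q| <= n%:R * e).
Proof.
move=> e0 p0 mf fM; have p20 : 0 < p / 2 by rewrite divr_gt0.
have H : eventually_off P (p / 2) (fun n w =>
    `|\sum_(k < n) clip f (Z k w) - n%:R * \int[mu]_q clip f q| <= n%:R * e).
  apply: (@eventually_off_rate _ _ _ _ ((2 * M) ^+ 2 / e ^+ 2)) => // n n0.
  exact: (weak_law (@Z_indep n) (@Z_law n) n0 e0 mf fM).
rewrite (splitr p); apply: (@eventually_off_sub _ _ _ _ _ _ _ 0%N)
  (eventually_off_and H (eventually_supp p20)).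
by move=> n w _ [+ /sum_clip <-].
Qed.

(** The event must serve all [x] of the disk at once. The law of large numbers is applied at the
    points of a finite net of mesh [r * (e / 4)], and the Lipschitz constant [1 / r] of [logmax r]
    extends the bound to the disk at a cost of [e / 4] per root. *)
Lemma sample_low (D r e p : R) : 0 < r -> 0 < e -> 0 < p ->
  eventually_off P p (fun n w => forall x, cmod x <= D ->
    \sum_(z <- sample n w) ln (cmod z) <=
    \sum_(z <- sample n w) logmax r (z - x) + n%:R * e).
Proof.
move=> r0 e0 p0.
have e40 : 0 < e / 4 by rewrite divr_gt0.
have p20 : 0 < p / 2 by rewrite divr_gt0.
have [s Hs] := finite_net D (mulr_gt0 r0 e40).
have Hx x p' : 0 < p' -> eventually_off P p' (fun n w =>
    `|\sum_(z <- sample n w) logmax r (z - x) -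
      n%:R * \int[mu]_q clip (fun z => logmax r (z - x)) q| <= n%:R * (e / 4)).
  move=> p'0; have [M HM] := bclip x r0.
  by apply: eventually_clip HM => //; exact: mclip.
have H0 : eventually_off P (p / 2) (fun n w =>
    `|\sum_(z <- sample n w) ln (cmod z) -
      n%:R * \int[mu]_q clip (fun z => ln (cmod z)) q| <= n%:R * (e / 4)).
  have [M HM] := bclip 0 ltr01.
  apply: (@eventually_clip _ M) => //; rewrite clipln //.
  exact: mclip.
have H1 := eventually_off_seq (s := s) p20 (fun x p' _ => Hx x p').
rewrite (splitr p); apply: (@eventually_off_sub _ _ _ _ _ _ _ 0%N) (eventually_off_and H0 H1).
move=> n w _ [h0 h1] x /Hs[y ys xy].
have {h1} := h1 y ys; move: h0; rewrite !ler_norml => /andP[_ h0] /andP[h1 _].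
have hm := ler_wpM2l (ler0n R n) (potential_min y r0).
have : \sum_(z <- sample n w) logmax r (z - y) <=
    \sum_(z <- sample n w) logmax r (z - x) + n%:R * (e / 4).
  rewrite -[n in n%:R](size_sample n w) -sum_const_seq -big_split /=.
  apply: ler_sum => z _; apply: (le_trans (logmax_lipschitz _ (z - x) r0)).
  rewrite lerD2l ler_pdivrMr// mulrC.
  by have -> : z - y - (z - x) = x - y by ring.
have n0 : (0 : R) <= n%:R by [].
have := mulr_ge0 n0 (ltW e0); lra.
Qed.

(* Here [A] and [B] are the products of [x - z_k] and of [0 - z_k] over all roots
   but one: the roots [z] for which [|p(x) - p(0)| < t * |p(x)|] lie in a disk of
   radius [O(t)]. *)
Let anticoncentration_static (x A B z z' : R[i]) (t : R) : x != 0 -> 0 < t ->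
  t * (cmod x + b) <= cmod x / 2 -> cmod z <= b -> cmod z' <= b ->
  cmod (A * (x - z) - B * (0 - z)) < t * cmod (A * (x - z)) ->
  cmod (A * (x - z') - B * (0 - z')) < t * cmod (A * (x - z')) ->
  cmod (z' - z) < 4 * b * (cmod x + b) / cmod x * t.
Proof.
move=> x0 t0 tx zb z'b.
have cx : 0 < cmod x by rewrite cmod_gt0.
have b0 : 0 < b by rewrite (lt_le_trans ltr01).
have xb (y : R[i]) : cmod y <= b -> cmod (x - y) <= cmod x + b.
  by move=> yb; rewrite (le_trans (cmodD _ _))// cmodN lerD2l.
rewrite !cmodM; set a := cmod A => Hz Hz'.
have a0 : 0 < a.
  rewrite lt_def cmod_ge0 andbT; apply/eqP => a0.
  by move: Hz; rewrite a0 mul0r mulr0 ltNge cmod_ge0.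
(* As a function of the left-out root [y], the difference is affine with slope [- D]. Two bad roots
   give [|z' - z| |D| < 2 k], while the smallness of [t] forces [|z D| >= a |x| / 2], which bounds
   [|D|] from below. *)
pose D := A - B; pose k := t * a * (cmod x + b).
have E (y : R[i]) : A * (x - y) - B * (0 - y) = A * x - y * D by rewrite /D; ring.
have Hk (y : R[i]) : cmod y <= b -> t * (a * cmod (x - y)) <= k.
  by move=> yb; rewrite mulrA ler_wpM2l ?xb// mulr_ge0 ?cmod_ge0// ltW.
have h1 : cmod (A * x - z * D) < k by rewrite -E (lt_le_trans Hz)// Hk.
have h2 : cmod (A * x - z' * D) < k by rewrite -E (lt_le_trans Hz')// Hk.
have kx : k <= a * cmod x / 2.
  have -> : k = a * (t * (cmod x + b)) by rewrite /k; ring.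
  by rewrite -mulrA ler_wpM2l ?cmod_ge0.
have zD : a * cmod x / 2 <= b * cmod D.
  apply: (@le_trans _ _ (cmod z * cmod D)); last by rewrite ler_wpM2r ?cmod_ge0.
  have := ler_cmodB (A * x) (A * x - z * D).
  rewrite subKr cmodM -/a [cmod (z * D)]cmodM; lra.
have zz : cmod (z' - z) * cmod D < 2 * k.
  rewrite -cmodM.
  have -> : (z' - z) * D = (A * x - z * D) - (A * x - z' * D) by ring.
  rewrite (le_lt_trans (cmodD _ _))// cmodN; lra.
have ax0 : 0 < a * cmod x by rewrite mulr_gt0.
rewrite mulrAC ltr_pdivlMr// -(ltr_pM2l a0).
have : cmod (z' - z) * (a * cmod x / 2) <= cmod (z' - z) * (b * cmod D).
  by rewrite ler_wpM2l ?cmod_ge0.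
have : b * (cmod (z' - z) * cmod D) < b * (2 * k) by rewrite ltr_pM2l.
have -> : a * (4 * b * (cmod x + b) * t) = 2 * (b * (2 * k)) by rewrite /k; ring.
have -> : a * (cmod (z' - z) * cmod x) = 2 * (cmod (z' - z) * (a * cmod x / 2)).
  by field.
by rewrite mulrCA; lra.
Qed.

(** The root of index 0 is singled out, hence [n.+1]. Once the other roots are frozen, its bad
    values lie in a disk of radius [rho], to which [mu_ball] applies. *)
Let anticoncentration n (x : R[i]) (t : R) : x != 0 -> 0 < t ->
  t * (cmod x + b) <= cmod x / 2 ->
  exists B, [/\ measurable B,
   (P B <= (C * (4 * b * (cmod x + b) / cmod x * t) ^+ 2)%:E)%E &
   forall w, ~ B w -> (forall z, z \in sample n.+1 w -> 1 <= cmod z <= b) ->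
     t * cmod (\prod_(z <- sample n.+1 w) (x - z)) <=
     cmod (\prod_(z <- sample n.+1 w) (x - z) - \prod_(z <- sample n.+1 w) (0 - z))].
Proof.
move=> x0 t0 tx; set rho := _ * t.
have b0 : 0 < b by rewrite (lt_le_trans ltr01).
have cx : 0 < cmod x by rewrite cmod_gt0.
have rho0 : 0 <= rho.
  by rewrite !mulr_ge0 ?invr_ge0 ?cmod_ge0 ?addr_ge0 ?(ltW t0) ?(ltW b0) ?cmod_ge0.
pose Z0 := Z (ord0 : 'I_n.+1).
pose F (y : R[i]) (w : T) : R[i] :=
  \prod_(k < n.+1 | k != ord0) (y - to_complex (Z k w)).
pose Y w : plane R * plane R := (of_complex (F x w), of_complex (F 0 w)).
pose A (v : (plane R * plane R) * plane R) := to_complex v.1.1.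
pose B (v : (plane R * plane R) * plane R) := to_complex v.1.2.
pose z (v : (plane R * plane R) * plane R) := to_complex v.2.
pose S : set ((plane R * plane R) * plane R) := [set v | annulus v.2] `&`
  [set v | cmod (A v * (x - z v) - B v * (0 - z v)) < t * cmod (A v * (x - z v))].
(* Measurability with respect to the other roots is what makes [Y] independent of [Z0]. *)
have mY : measurable_fun setT
    (Y : g_sigma_algebraType (other_events (@Z n.+1) ord0) -> _).
  have mF y : measurable_fun setT ((fun w => of_complex (F y w)) :
      g_sigma_algebraType (other_events (@Z n.+1) ord0) -> plane R).
    apply: measurable_of_complex; apply: measurable_complex_prod => k k0.
    apply: measurable_complexB; first exact: measurable_complex_cst.
    by apply: measurable_to_complex; exact: measurable_other.
  by apply: measurable_fun_pair; exact: mF.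
have mYT : measurable_fun setT Y.
  have mF y : measurable_fun setT (fun w => of_complex (F y w) : plane R).
    apply: measurable_of_complex; apply: measurable_complex_prod => k k0.
    apply: measurable_complexB; first exact: measurable_complex_cst.
    by apply: measurable_to_complex.
  by apply: measurable_fun_pair; exact: mF.
have mA : measurable_complex A.
  by apply: measurable_to_complex; apply: measurableT_comp measurable_fst; exact: measurable_fst.
have mB : measurable_complex B.
  by apply: measurable_to_complex; apply: measurableT_comp measurable_fst; exact: measurable_snd.
have mz : measurable_complex z.
  by apply: measurable_to_complex; exact: measurable_snd.
have mS : measurable S.
  apply: measurableI.
    by apply: (@measurable_preimage _ _ _ _ snd annulus) => //; exact: measurable_snd.
  have mxz y : measurable_complex (fun v => y - z v).
    by apply: measurable_complexB => //; exact: measurable_complex_cst.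
  apply: measurable_lt.
    apply: measurable_cmod; apply: measurable_complexB; exact: measurable_complexM.
  apply: measurable_funM; first exact: measurable_cst.
  by apply: measurable_cmod; exact: measurable_complexM.
exists [set w | S (Y w, Z0 w)]; split.
- have -> : [set w | S (Y w, Z0 w)] = (fun w => (Y w, Z0 w)) @^-1` S by [].
  by apply: measurable_preimage => //; apply: measurable_fun_pair.
- apply: (@independent_section_bound _ _ _ _ _ _ _ _ mu) => //.
    move=> C1 D1 mC1 mD1.
    by rewrite (indep_function (@Z_indep n.+1) (@Z_law n.+1)).
  (* Any bad value can be taken as the centre of the disk that contains all of them. *)
  move=> y; have [[z1 Sz1]|none] := pselect (exists z1, S (y, z1)); last first.
    have -> : [set q | S (y, q)] = set0.
      by apply/seteqP; split => // q Sq; apply: none; exists q.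
    rewrite measure0 lee_fin mulr_ge0//; exact: exprn_ge0.
  apply: le_trans (mu_ball (to_complex z1) rho0).
  apply: le_measure; rewrite ?inE.
  + have -> : [set q | S (y, q)] = (fun q => (y, q)) @^-1` S by [].
    by apply: measurable_preimage => //; apply: measurable_fun_pair => //; exact: measurable_cst.
  + by apply: measurable_lt => //; exact: measurable_cst.
  move=> q /= [/andP[_ qb] Sq]; case: Sz1 => /andP[_ z1b] Sz1.
  exact: (anticoncentration_static x0 t0 tx z1b qb Sz1 Sq).
move=> w nS Hw.
have prodE y : \prod_(u <- sample n.+1 w) (y - u) = F y w * (y - to_complex (Z0 w)).
  rewrite (big_sample (V := R[i])) (bigD1 ord0)//= mulrC.
  by congr (_ * _); apply: eq_bigl => k.
rewrite leNgt; apply/negP => Hlt; apply: nS; split=> /=.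
  by apply: Hw; apply/mapP; exists ord0; rewrite ?mem_enum.
have FE y : to_complex (of_complex (F y w)) = F y w.
  by rewrite /to_complex /of_complex /=; case: (F y w).
by rewrite /A /B /z /= !FE -!prodE.
Qed.

Lemma sample_anticoncentration (x : R[i]) (e p : R) : x != 0 -> 0 < e -> 0 < p ->
  eventually_off P p (fun n w =>
    expR (- (n%:R * e)) * cmod (\prod_(z <- sample n w) (x - z)) <=
    cmod (\prod_(z <- sample n w) (x - z) - \prod_(z <- sample n w) (0 - z))).
Proof.
move=> x0 e0 p0.
have p20 : 0 < p / 2 by rewrite divr_gt0.
have cx : 0 < cmod x by rewrite cmod_gt0.
have b0 : 0 < b by rewrite (lt_le_trans ltr01).
have xb0 : 0 < cmod x + b by rewrite addr_gt0.
pose kappa := 4 * b * (cmod x + b) / cmod x.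
pose t0 := cmod x / 2 / (cmod x + b).
have t00 : 0 < t0 by rewrite !divr_gt0.
have H : eventually_off P (p / 2) (fun n w =>
    (forall z, z \in sample n w -> 1 <= cmod z <= b) ->
    expR (- (n%:R * e)) * cmod (\prod_(z <- sample n w) (x - z)) <=
    cmod (\prod_(z <- sample n w) (x - z) - \prod_(z <- sample n w) (0 - z))).
  (* With [t = exp(- n e) <= 1 / (n e)], the first summand dominates the probability
     [C (kappa t)^2]. While [t] is still too large for [anticoncentration], one has [t0 < t]; then
     the second summand alone makes the bound at least 1, and the whole space serves as exceptional
     set. *)
  apply: (@eventually_off_rate _ _ _ _ (C * kappa ^+ 2 / e + t0^-1 / e)) => // -[//|n] _.
  set t := expR _; have tt0 : 0 < t by exact: expR_gt0.
  have ne0 : 0 < n.+1%:R * e by rewrite mulr_gt0.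
  have t1 : t <= e^-1 / n.+1%:R.
    rewrite /t expRN -invfM lef_pV2 ?posrE ?expR_gt0 ?mulr_gt0//.
    by rewrite (mulrC e) (le_trans _ (expR_ge1Dx _))// lerDr.
  have tle1 : t <= 1 by rewrite /t -[leRHS]expR0 ler_expR oppr_le0 ltW.
  have c1 : 0 <= C * kappa ^+ 2 / e / n.+1%:R.
    apply: divr_ge0 => //; apply: divr_ge0; last exact: ltW.
    by apply: mulr_ge0 => //; exact: sqr_ge0.
  have c2 : 0 <= t0^-1 / e / n.+1%:R.
    apply: divr_ge0 => //; apply: divr_ge0; last exact: ltW.
    by rewrite invr_ge0 ltW.
  have [tx|tx] := leP (t * (cmod x + b)) (cmod x / 2).
    have [B [mB PB HB]] := anticoncentration n x0 tt0 tx.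
    exists B; split=> //; rewrite (le_trans PB)// lee_fin [leRHS]mulrDl.
    rewrite -[leLHS]addr0 lerD// -/kappa.
    have -> : C * (kappa * t) ^+ 2 = C * kappa ^+ 2 * t ^+ 2 by ring.
    have -> : C * kappa ^+ 2 / e / n.+1%:R = C * kappa ^+ 2 * (e^-1 / n.+1%:R).
      by rewrite !mulrA.
    apply: ler_wpM2l; first by apply: mulr_ge0 => //; exact: sqr_ge0.
    by rewrite (le_trans _ t1)// expr2 ger_pMl.
  exists setT; split=> //; last by move=> w /(_ I).
  rewrite probability_setT lee_fin [leRHS]mulrDl -[leLHS]add0r lerD//.
  have : t0 <= e^-1 / n.+1%:R.
    by rewrite (le_trans _ t1)// /t0 ler_pdivrMr// ltW.
  have -> : t0^-1 / e / n.+1%:R = t0^-1 * (e^-1 / n.+1%:R) by rewrite !mulrA.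
  by rewrite -[X in _ -> X <= _](mulVf (lt0r_neq0 t00)) ler_pM2l ?invr_gt0.
rewrite (splitr p); apply: (@eventually_off_sub _ _ _ _ _ _ _ 0%N)
  (eventually_off_and H (eventually_supp p20)).
by move=> n w _ [h1 /h1].
Qed.

(* The truncation at the scale [r] is cheap: the expected number of [z_k] in a
   disk of radius [r / 2 ^ i] is [O(n * r ^ 2 / 4 ^ i)], uniformly in the centre. *)
Lemma sample_spread (e p : R) : 0 < e -> 0 < p -> exists2 r, 0 < r &
  forall N z0 (s : R[i]), (0 < N)%N ->
  eventually_off P p (fun n w =>
    (forall u z, u \in unity R N -> z \in sample n w -> z0 + u * s != z) /\
    \sum_(u <- unity R N) \sum_(z <- sample n w)
      (logmax r (z0 + u * s - z) - ln (cmod (z0 + u * s - z))) <=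
    N%:R * (n%:R * e)).
Proof.
move=> e0 p0; have C1 : 0 < C + 1 by rewrite ltr_wpDl.
(* Chosen so that Markov's inequality below yields [2 C r^2 / e <= p / 2]; [C + 1] guards against
   [C = 0]. *)
pose r := Num.sqrt (p * e / (4 * (C + 1))).
have r20 : 0 < p * e / (4 * (C + 1)) by rewrite divr_gt0 ?mulr_gt0.
have r0 : 0 < r by rewrite sqrtr_gt0.
have r2 : 4 * C * r ^+ 2 <= p * e.
  rewrite sqr_sqrtr ?(ltW r20)//.
  have -> : 4 * C * (p * e / (4 * (C + 1))) = (p * e) * (C / (C + 1)).
    by field; rewrite gt_eqF.
  rewrite ler_piMr ?mulr_ge0 ?(ltW p0) ?(ltW e0)//.
  by rewrite ler_pdivrMr// mul1r lerDl.
exists r => // N z0 s N0.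
have p20 : 0 < p / 2 by rewrite divr_gt0.
pose A n (i : nat) (uk : R[i] * 'I_n) : set T := Z uk.2 @^-1`
  [set q | cmod (to_complex q - (z0 + uk.1 * s)) < r / 2 ^+ i].
have mball (v : R[i]) (t : R) : measurable [set q : plane R | cmod (to_complex q - v) < t].
  by apply: measurable_lt => //; exact: measurable_cst.
have mA n i uk : measurable (@A n i uk) by apply: measurable_preimage.
have PA n i uk : (P (@A n i uk) <= (C * r ^+ 2 / 4 ^+ i)%:E)%E.
  rewrite /A Z_law//; apply: (le_trans (mu_ball _ _)).
    by rewrite divr_ge0 ?(ltW r0)// exprn_ge0.
  rewrite lee_fin exprMn exprVn -exprM mulnC exprM mulrA.
  by have -> : (2 : R) ^+ 2 = 4 by ring.
have Cr0 : 0 <= C * r ^+ 2 by rewrite mulr_ge0// exprn_ge0// ltW.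
have NR : 0 < (N%:R : R) by rewrite ltr0n.
(* At most [n] dyadic scales are needed: since [n^2 <= 4^n], the chance that one of the [n] points
   comes within [r / 2^n] of one of the [N] vertices is [O(N / n)]. This also keeps the sample off
   the vertices. *)
have H1 : eventually_off P (p / 2) (fun n w => forall u (k : 'I_n), u \in unity R N ->
    r / 2 ^+ n <= cmod (to_complex (Z k w) - (z0 + u * s))).
  apply: (@eventually_off_rate _ _ _ _ (N%:R * (C * r ^+ 2))) => // n n0.
  have nR : 0 < (n%:R : R) by rewrite ltr0n.
  have H : (\sum_(uk <- [seq (u, k) | u <- unity R N, k <- enum 'I_n]) P (@A n n uk) <=
      (N%:R * (C * r ^+ 2) / n%:R)%:E)%E.
    apply: (@le_trans _ _ (\sum_(uk <- [seq (u, k) | u <- unity R N, k <- enum 'I_n])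
      (C * r ^+ 2 / 4 ^+ n)%:E)%E); first by apply: lee_sum => uk _.
    rewrite sumEFin lee_fin sum_const_seq size_allpairs size_unity// size_enum_ord natrM.
    have q0 : 0 < (4 ^+ n : R) by rewrite exprn_gt0.
    move: (C * r ^+ 2) Cr0 => X X0.
    have -> : N%:R * n%:R * (X / 4 ^+ n) = N%:R * X * (n%:R / 4 ^+ n).
      by field; rewrite gt_eqF.
    apply: ler_wpM2l; first exact: mulr_ge0.
    by rewrite ler_pdivrMr// mulrC ler_pdivlMr// -expr2 sqr_le_4X.
  have [B [mB PB HB]] := union_bound (@mA n n) H.
  exists B; split=> // w /HB H0 u k uN; rewrite leNgt; apply/negP => Hlt.
  have : 0 < \sum_(uk <- [seq (u, k) | u <- unity R N, k <- enum 'I_n]) \1_(@A n n uk) w :> R.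
    have uk : (u, k) \in [seq (u, k) | u <- unity R N, k <- enum 'I_n].
      by apply: allpairs_f; rewrite ?mem_enum.
    by rewrite (big_rem _ uk)//= indicE mem_set// ltr_pwDl// sumr_ge0.
  by rewrite H0 ltxx.
have H2 : eventually_off P (p / 2) (fun n w =>
    \sum_(u <- unity R N) \sum_(k < n) \sum_(i < n)
      (cmod (z0 + u * s - to_complex (Z k w)) < r / 2 ^+ i)%R%:R <= N%:R * (n%:R * e)).
  exists 1%N => n n0.
  have nR : 0 < (n%:R : R) by rewrite ltr0n.
  pose I := (R[i] * ('I_n * 'I_n))%type.
  pose A' (t : I) := @A n t.2.2 (t.1, t.2.1).
  pose S : seq I := [seq (u, ki) | u <- unity R N, ki <- enum [the finType of ('I_n * 'I_n)%type]].
  have Sum (V : nmodType) (F : I -> V) : \sum_(t <- S) F t =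
      \sum_(u <- unity R N) \sum_(k < n) \sum_(i < n) F (u, (k, i)).
    rewrite /S big_allpairs; apply: eq_bigr => u _.
    by rewrite big_enum /= pair_bigA; apply: eq_bigr => -[].
  have H : (\sum_(t <- S) P (A' t) <= (N%:R * (n%:R * (2 * (C * r ^+ 2))))%:E)%E.
    apply: (@le_trans _ _ (\sum_(t <- S) (C * r ^+ 2 / 4 ^+ t.2.2)%:E)%E).
      by apply: lee_sum => t _; exact: PA.
    rewrite sumEFin lee_fin Sum -sum_unity_const//; apply: ler_sum => u _.
    have -> : n%:R * (2 * (C * r ^+ 2)) = \sum_(k < n) (2 * (C * r ^+ 2)).
      by rewrite sumr_const card_ord mulr_natl.
    apply: ler_sum => k _ /=.
    by rewrite -mulr_sumr mulrC ler_wpM2r// sum_quarter_le.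
  have l0 : 0 < N%:R * (n%:R * e) by rewrite !mulr_gt0.
  exists [set w | N%:R * (n%:R * e) <= \sum_(t <- S) \1_(A' t) w]; split.
  - apply: measurable_le; first exact: measurable_cst.
    apply: measurable_sum => t; apply: measurable_indic; exact: mA.
  - apply: le_trans (markov_indic l0 _ H) _; first by move=> t; exact: mA.
    have -> : N%:R * (n%:R * (2 * (C * r ^+ 2))) / (N%:R * (n%:R * e)) = 2 * (C * r ^+ 2) / e.
      by field; rewrite !gt_eqF.
    rewrite lee_fin ler_pdivrMr//; lra.
  move=> w /= /negP; rewrite -ltNge => /ltW; apply: le_trans.
  rewrite Sum le_eqVlt; apply/orP; left; apply/eqP.
  apply: eq_bigr => u _; apply: eq_bigr => k _; apply: eq_bigr => i _.
  rewrite /A' /A indicE cmodB; congr (_%:R); congr nat_of_bool.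
  by apply/idP/idP; rewrite inE.
rewrite (splitr p).
apply: (@eventually_off_sub _ _ _ _ _ _ _ 0%N) (eventually_off_and H1 H2).
move=> n w _ [h1 h2]; split.
  move=> u _ uN /mapP[k _ ->]; apply/eqP => E.
  have := h1 u k uN; rewrite E subrr cmod0 leNgt => /negP; apply.
  by rewrite divr_gt0// exprn_gt0.
apply: le_trans h2; rewrite big_seq [leRHS]big_seq; apply: ler_sum => u uN.
rewrite (big_sample (V := R)); apply: ler_sum => k _.
by apply: logmax_dyadic => //; rewrite cmodB h1.
Qed.

(** Anticoncentration fails at 0, where [q] vanishes, so no vertex may be 0. If the polygon with
    [s = r] has 0 as a vertex, turning it by an [N]-th root of [-1] moves all its vertices, because
    [s^N] changes sign. *)
Let polygon_avoiding0 (z0 : R[i]) (r : R) N : (0 < N)%N -> 0 < r ->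
  exists2 s : R[i], cmod s = r & forall u, u \in unity R N -> z0 + u * s != 0.
Proof.
move=> N0 r0; have cr : cmod r%:C = r by rewrite cmodC// ltW.
have avoid (s : R[i]) : (- z0) ^+ N != s ^+ N -> forall u, u \in unity R N -> z0 + u * s != 0.
  move=> zs u uN; apply: contra zs => /eqP us; rewrite -subr_eq0 subXX_unity//.
  by rewrite (big_rem u)//= -opprD us oppr0 mul0r.
have [E|E] := eqVneq ((- z0) ^+ N) (r%:C ^+ N); last by exists r%:C => //; exact: avoid.
pose c : R[i] := N.-root (- 1).
have cN : c ^+ N = -1 by exact: rootCK.
have c1 : cmod c = 1.
  have := congr1 (@cmod R) cN; rewrite cmodX cmodN cmod1 => /eqP.
  by rewrite pexpr_eq1 ?cmod_ge0// -?lt0n// => /eqP.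
exists (r%:C * c); first by rewrite cmodM c1 mulr1.
apply: avoid; rewrite E exprMn cN mulrN1 -subr_eq0 opprK -mulr2n mulrn_eq0 /=.
by rewrite expf_eq0 N0 /= -cmod_eq0 cr gt_eqF.
Qed.

(** The exceptional set is chosen before [qs]: [roots_upper] and [roots_lower] are deterministic,
    and all their random hypotheses concern the sample alone. *)
Lemma sample_roots_close (z0 : R[i]) (r e p : R) : 0 < r -> 0 < e -> 0 < p ->
  eventually_off P p (fun n w => forall qs,
    shifted_roots (sample n w) qs -> size qs = n ->
    `|\sum_(a <- qs) logmax r (a - z0) -
      \sum_(z <- sample n w) logmax r (z - z0)| <= n%:R * e).
Proof.
move=> r0 e0 p0.
have p40 : 0 < p / 4 by rewrite divr_gt0.
have e40 : 0 < e / 4 by rewrite divr_gt0.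
have d0 : 0 < r * (e / 4) by rewrite mulr_gt0.
have Hup := sample_low (cmod z0 + 2 * r) d0 e40 p40.
have [dl dl0 Hspread] := sample_spread e40 p40.
pose B := b + cmod z0 + r.
have B0 : 0 < B by rewrite ltr_wpDl// addr_ge0 ?cmod_ge0// (le_trans ler01).
(* This makes the polygon error [1 + B / dl] of [roots_lower] at most [N * (e / 2)]. There is no
   circularity, because [sample_spread] provides [dl] independently of [N]. *)
pose N := (Num.truncn ((1 + B / dl) / (e / 2))).+1.
have N0 : (0 < N)%N by [].
have HN : 1 + B / dl <= N%:R * (e / 2).
  by rewrite -ler_pdivrMr ?divr_gt0// ltW// truncnS_gt.
have [s cs Hs] := polygon_avoiding0 z0 N0 r0.
have Hanti : eventually_off P (p / 4) (fun n w => forall u, u \in unity R N ->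
    expR (- (n%:R * (e / 4))) * cmod (\prod_(z <- sample n w) (z0 + u * s - z)) <=
    cmod (\prod_(z <- sample n w) (z0 + u * s - z) - \prod_(z <- sample n w) (0 - z))).
  apply: eventually_off_seq => // u p' uN p'0.
  by apply: sample_anticoncentration => //; exact: Hs.
have pE : p = (p / 4 + p / 4) + (p / 4 + p / 4) by field.
(* From [n1] on, [n * (e / 2)] is at least 1 and absorbs the [ln 2] of [roots_upper]. *)
rewrite pE; pose n1 := (Num.truncn (2 / e)).+1.
apply: (@eventually_off_sub _ _ _ _ _ _ _ n1)
  (eventually_off_and (eventually_off_and Hup (eventually_supp p40))
    (eventually_off_and (Hspread N z0 s N0) Hanti)).
move=> n w nn1 [[h1 h2] [[h3 h4] h5]] qs zqs sq.
have sz := size_sample n w.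
have ne : 1 <= n%:R * (e / 2).
  rewrite -ler_pdivrMr ?divr_gt0// mul1r invf_div ltW// (lt_le_trans (truncnS_gt _))//.
  by rewrite ler_nat.
have up : \sum_(a <- qs) logmax r (a - z0) <=
    \sum_(z <- sample n w) logmax r (z - z0) + n%:R * e.
  have := @roots_upper R (sample n w) qs z0 r (r * (e / 4)) (e / 4) r0 d0 (ltW e40) zqs.
  rewrite sz sq => /(_ erefl) H; apply: le_trans (H _ h1) _.
    move=> z /h2 /andP[z1 _]; rewrite -cmod_gt0; exact: lt_le_trans z1.
  have -> : e / 4 + r * (e / 4) / r = e / 2 by field; rewrite gt_eqF.
  rewrite -addrA lerD2l; have := ln2_le1 R.
  have -> : n%:R * e = n%:R * (e / 2) + n%:R * (e / 2) by field.
  lra.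
have low : \sum_(z <- sample n w) logmax r (z - z0) <=
    \sum_(a <- qs) logmax r (a - z0) + n%:R * e.
  have s0 : 0 < cmod s by rewrite cs.
  have sB : cmod s <= B by rewrite cs /B lerDr addr_ge0 ?cmod_ge0// (le_trans ler01).
  have := @roots_lower R (sample n w) qs z0 s dl (e / 4) B N N0 s0 dl0 zqs.
  rewrite sz sq cs => /(_ erefl) H.
  have {}H := H _ _ h3 h5 h4.
  have {H} : N%:R * \sum_(z <- sample n w) logmax r (z - z0) <=
     N%:R * (\sum_(a <- qs) logmax r (a - z0) + 2 * (n%:R * (e / 4))) +
     n%:R * (1 + B / dl).
    apply: H; first by rewrite -cs.
    move=> z /h2 /andP[_ zb]; rewrite (le_trans (cmodD _ _))// cmodN /B.
    by rewrite -[leLHS]addr0 lerD ?lerD2r// ltW.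
  move=> H; have {}H := le_trans H (lerD (lexx _) (ler_wpM2l (ler0n R n) HN)).
  have NR : 0 < (N%:R : R) by rewrite ltr0n.
  rewrite -(ler_pM2l NR); apply: (le_trans H).
  by rewrite le_eqVlt; apply/orP; left; apply/eqP; field.
by rewrite ler_norml; apply/andP; split; lra.
Qed.

Lemma sample_roots_logspan g (e p : R) : logspan g -> 0 < e -> 0 < p ->
  eventually_off P p (fun n w => forall qs,
    shifted_roots (sample n w) qs -> size qs = n ->
    `|\sum_(a <- qs) g a - \sum_(z <- sample n w) g z| <= n%:R * e).
Proof.
move=> lg; elim: lg e p => [|c r z f r0 _ IH] e p e0 p0.
  exists 0%N => n _; exists set0; split=> //.
    by rewrite measure0 lee_fin ltW.
  by move=> w _ qs _ _; rewrite !big1_eq subrr normr0 mulr_ge0// ltW.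
have p20 : 0 < p / 2 by rewrite divr_gt0.
have e20 : 0 < e / 2 by rewrite divr_gt0.
have c1 : 0 < `|c| + 1 by rewrite ltr_wpDl.
have H1 := sample_roots_close z r0 (divr_gt0 e20 c1) p20.
have H2 := IH _ _ e20 p20.
rewrite (splitr p); apply: (@eventually_off_sub _ _ _ _ _ _ _ 0%N) (eventually_off_and H1 H2).
move=> n w _ [h1 h2] qs zqs sq; have {}h1 := h1 qs zqs sq; have {}h2 := h2 qs zqs sq.
rewrite !big_split /= -!mulr_sumr opprD addrACA -mulrBr.
have -> : n%:R * e = n%:R * (e / 2) + n%:R * (e / 2) by field.
rewrite (le_trans (ler_normD _ _))// lerD// normrM.
apply: (@le_trans _ _ ((`|c| + 1) * (n%:R * (e / 2 / (`|c| + 1))))).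
  by rewrite ler_pM// lerDl.
by rewrite mulrCA [_ * (e / 2 / _)]mulrC divfK// gt_eqF.
Qed.

Lemma measurable_logspan g : logspan g ->
  measurable_fun setT (fun q : plane R => g (to_complex q)).
Proof.
elim=> [|c r z f r0 _ IH]; first exact: measurable_cst.
by apply: measurable_funD => //; apply: measurable_funM => //; exact: measurable_cst.
Qed.

Lemma measurable_nice F : nice F ->
  measurable_fun setT (fun q : plane R => F (to_complex q)).
Proof.
move=> nF.
have /choice[g Hg] : forall N, exists g, logspan g /\
    forall x, `|F x - g x| <= (N.+1%:R^-1 : R).
  move=> N; have [|g lg Hg] := logspan_dense nF (_ : 0 < N.+1%:R^-1).
    by rewrite invr_gt0.
  by exists g.
apply: (@measurable_fun_cvg _ _ _ _ (fun N q => g N (to_complex q))) => [N|q _].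
  by apply: measurable_logspan; case: (Hg N).
apply: (@cvg_rate _ _ _ 1 0%N) => N _; rewrite distrC mul1r.
by case: (Hg N).
Qed.

(** One quarter of [e] goes to each of four errors: replacing [F] by a logarithmic combination on
    either list of [n] points, comparing the two lists, and the law of large numbers. *)
Lemma sample_roots_nice F (e p : R) : nice F -> 0 < e -> 0 < p ->
  eventually_off P p (fun n w => forall qs,
    shifted_roots (sample n w) qs -> size qs = n ->
    `|\sum_(a <- qs) F a - n%:R * \int[mu]_q F (to_complex q)| <= n%:R * e).
Proof.
move=> nF e0 p0.
have p20 : 0 < p / 2 by rewrite divr_gt0.
have e40 : 0 < e / 4 by rewrite divr_gt0.
have [g lg Hg] := logspan_dense nF e40.
have H1 := sample_roots_logspan lg e40 p20.
have H2 : eventually_off P (p / 2) (fun n w =>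
    `|\sum_(z <- sample n w) F z - n%:R * \int[mu]_q F (to_complex q)| <= n%:R * (e / 4)).
  have [M HM] := nice_bounded nF.
  apply: (@eventually_off_rate _ _ _ _ ((2 * M) ^+ 2 / (e / 4) ^+ 2)) => // n n0.
  have [//|B [mB PB HB]] := weak_law (@Z_indep n) (@Z_law n) n0 e40 (measurable_nice nF) (M := M).
  by exists B; split=> // w /HB; rewrite big_sample.
rewrite (splitr p); apply: (@eventually_off_sub _ _ _ _ _ _ _ 0%N) (eventually_off_and H1 H2).
move=> n w _ [h1 h2] qs zqs sq; have {}h1 := h1 qs zqs sq.
have close s : size s = n -> `|\sum_(a <- s) F a - \sum_(a <- s) g a| <= n%:R * (e / 4).
  move=> <-; rewrite -sumrB -sum_const_seq (le_trans (ler_norm_sum _ _ _))//.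
  by apply: ler_sum => a _.
have {close} [c1 c2] := (close _ sq, close _ (size_sample n w)).
move: h1 h2 c1 c2; rewrite !ler_norml => /andP[a1 a2] /andP[a3 a4] /andP[a5 a6] /andP[a7 a8].
have -> : n%:R * e = n%:R * (e / 4) + n%:R * (e / 4) + n%:R * (e / 4) + n%:R * (e / 4) by field.
by apply/andP; split; lra.
Qed.

(** A tent at 0 supported in the open unit disk has integral 0 against [mu], while each root at 0
    contributes [ln 2] to its sum. The radius [1 / 4] puts the support in the disk of radius
    [1 / 2]. *)
Lemma sample_roots_zero (e p : R) : 0 < e -> 0 < p ->
  eventually_off P p (fun n w => forall qs,
    shifted_roots (sample n w) qs -> size qs = n ->
    (count_mem (0 : R[i]) qs)%:R <= n%:R * e).
Proof.
move=> e0 p0; have l2 : 0 < ln (2 : R) by rewrite ln_gt0// ltr1n.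
have q0 : (0 : R) < 1 / 4 by rewrite divr_gt0.
have nF := nice_tent 0 q0.
have I0 : \int[mu]_q tent (1 / 4) (to_complex q - 0) = 0.
  have mF := measurable_nice nF.
  rewrite /Rintegral (@ae_eq_integral _ _ _ mu setT (cst 0%E))//.
  - by rewrite integral0.
  - exact/measurable_EFinP.
  - exists (~` annulus); split; first exact: measurableC.
      exact: mu_supp.
    move=> q /= nq; apply: contra_not nq => /andP[q1 _] _; congr (_%:E).
    by apply: tent_out => //; rewrite subr0; lra.
apply: (@eventually_off_sub _ _ _ _ _ _ _ 0%N) (sample_roots_nice nF (mulr_gt0 e0 l2) p0).
move=> n w _ H qs zqs sq; have := H qs zqs sq; rewrite I0 mulr0 subr0 => {}H.
rewrite -(ler_pM2r l2) -mulrA (le_trans _ (le_trans (ler_norm _) H))//.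
rewrite -sum1_count natr_sum mulr_suml big_mkcond /=.
apply: ler_sum => a _; case: eqP => [->|_].
  by rewrite subr0 tent_in ?cmod0 ?(ltW q0)// [leLHS]mul1r.
exact: tent_ge0.
Qed.

Lemma integral_reflect_fun (h : R[i] -> R) : nice h ->
  \int[mu]_q reflect_fun h (to_complex q) = \int[mu]_q h (to_complex q).
Proof.
move=> nh; rewrite /Rintegral; congr fine; apply: ae_eq_integral => //.
- by apply/measurable_EFinP; apply: measurable_nice; exact: nice_reflect_fun.
- by apply/measurable_EFinP; exact: measurable_nice.
- exists (~` annulus); split; first exact: measurableC.
    exact: mu_supp.
  move=> q /= nq; apply: contra_not nq => /andP[q1 _] _; congr (_%:E).
  rewrite /reflect_fun; set z := to_complex q in q1 *.
  have z0 : z != 0 by rewrite -cmod_gt0 (lt_le_trans ltr01).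
  rewrite (negbTE z0) reflect_inE; case: ifP => // z1.
  (* Within the support of [mu], inversion is applied only on the unit circle, which it fixes
     pointwise. *)
  have c1 : cmod z = 1 by apply/eqP; rewrite eq_le z1.
  congr h; apply: (mulfI z0).
  have zz : z * (z^*)%C = 1 by rewrite -sqr_normc normr_cmod c1 expr1n.
  have -> : (z^*)%C^-1 = z by rewrite -[LHS]mul1r -zz mulfK// conjc_eq0.
  by [].
Qed.

End planar_sample.

(** * The outer factor *)

Section random_polynomial_roots.
Context (R : realType) d (T : measurableType d) (P : probability T R).
Context n (Z : 'I_n -> {RV P >-> plane R}).
Implicit Types w : T.

Definition shifted_poly w : {poly R[i]} :=
  random_poly Z w - (random_poly Z w).[0]%:P.

Let random_poly_monic w : random_poly Z w \is monic.
Proof. exact: monic_prod_XsubC. Qed.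

Let size_random_poly w : size (random_poly Z w) = n.+1.
Proof.
rewrite /random_poly size_prod_XsubC.
by rewrite -sum1_size big_const_ord iter_addn_0 mul1n.
Qed.

Lemma horner_random_poly w x :
  (random_poly Z w).[x] = \prod_(k < n) (x - to_complex (Z k w)).
Proof. by rewrite horner_prod; apply: eq_bigr => k _; rewrite !hornerE. Qed.

Hypothesis n0 : (0 < n)%N.

Let size_const w : (size (- (random_poly Z w).[0]%:P) < size (random_poly Z w))%N.
Proof.
by rewrite size_polyN size_random_poly (leq_ltn_trans (size_polyC_leq1 _)).
Qed.

Lemma shifted_polyE w :
  shifted_poly w = \prod_(a <- poly_roots (shifted_poly w)) ('X - a%:P).
Proof.
have lc : lead_coef (shifted_poly w) = 1.
  rewrite /shifted_poly lead_coefDl ?size_const//.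
  exact/eqP/random_poly_monic.
by rewrite {1}(poly_rootsE (shifted_poly w)) lc scale1r.
Qed.

Lemma size_shifted_roots w : size (poly_roots (shifted_poly w)) = n.
Proof.
have : size (shifted_poly w) = n.+1.
  by rewrite /shifted_poly size_polyDl ?size_const ?size_random_poly.
by rewrite {1}shifted_polyE size_prod_XsubC => -[].
Qed.

Lemma shifted_poly_neq0 w : shifted_poly w != 0.
Proof.
by apply: monic_neq0; rewrite {1}shifted_polyE; exact: monic_prod_XsubC.
Qed.

Lemma prod_shifted_roots w x :
  \prod_(a <- poly_roots (shifted_poly w)) (x - a) =
  \prod_(k < n) (x - to_complex (Z k w)) - \prod_(k < n) (0 - to_complex (Z k w)).
Proof.
transitivity (shifted_poly w).[x].
  rewrite [in RHS]shifted_polyE horner_prod; apply: eq_bigr => a _.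
  by rewrite !hornerE.
by rewrite /shifted_poly hornerD hornerN hornerC !horner_random_poly.
Qed.

Lemma measurable_prod_shifted_roots x : measurable_fun setT
  (fun w => cmod (\prod_(a <- poly_roots (shifted_poly w)) (x - a))).
Proof.
under eq_fun do rewrite prod_shifted_roots.
apply: measurable_cmod; apply: measurable_complexB;
  apply: measurable_complex_prod => k _; apply: measurable_complexB;
  (exact: measurable_complex_cst || exact: measurable_to_complex).
Qed.

Lemma shifted_roots_sample w (Z' : forall n : nat, 'I_n -> {RV P >-> plane R}) :
  Z' n = Z -> shifted_roots (sample Z' n w) (poly_roots (shifted_poly w)).
Proof.
by move=> Z'E x; rewrite prod_shifted_roots !big_sample Z'E.
Qed.

Lemma integral_empirical_inner_free_part (h : plane R -> R) w :
  measurable_fun setT h ->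
  \int[empirical_measure (inner_free_part (shifted_poly w))]_x h x =
  (n%:R - (count_mem (0 : R[i]) (poly_roots (shifted_poly w)))%:R)^-1 *
  \sum_(a <- poly_roots (shifted_poly w)) reflect_fun (h \o @of_complex R) a.
Proof.
move=> mh; rewrite integral_empirical_measure//.
rewrite size_roots_inner_free_part ?shifted_poly_neq0// size_shifted_roots.
rewrite natrB; last by rewrite -[leqRHS](size_shifted_roots w) count_size.
congr (_ * _).
exact: (sum_roots_inner_free_part (h \o @of_complex R) (shifted_poly_neq0 w)).
Qed.

Lemma measurable_integral_inner_free_part (h : plane R -> R) :
  measurable_fun setT h -> nice (h \o @of_complex R) ->
  measurable_fun setT (fun w =>
    \int[empirical_measure (inner_free_part (shifted_poly w))]_x h x).
Proof.
move=> mh nh; pose S w : R := \sum_(a <- poly_roots (shifted_poly w))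
  reflect_fun (h \o @of_complex R) a.
pose c w : R := (count_mem (0 : R[i]) (poly_roots (shifted_poly w)))%:R.
have mS : measurable_fun setT S.
  exact: (measurable_sum_nice size_shifted_roots measurable_prod_shifted_roots
    (nice_reflect_fun nh)).
have mc : measurable_fun setT c.
  exact: (measurable_count_roots size_shifted_roots measurable_prod_shifted_roots).
(* [expR (- ln t)] is [t^-1] for [t > 0], and [S w = 0] when [t = 0]. *)
rewrite (_ : (fun w => _) = (fun w => expR (- ln (n%:R - c w)) * S w)).
  apply: measurable_funM => //; apply: measurableT_comp; first exact: measurable_expR.
  apply: measurableT_comp => //; apply: measurableT_comp; first exact: measurable_ln.
  by apply: measurable_funB => //; exact: measurable_cst.
apply/funext => w; rewrite integral_empirical_inner_free_part// -/(c w) -/(S w).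
have cn : (count_mem (0 : R[i])%R (poly_roots (shifted_poly w)) <= n)%N.
  by rewrite -[leqRHS](size_shifted_roots w) count_size.
move: (cn); rewrite leq_eqVlt => /orP[/eqP E|lt].
  have all0 : all (pred1 (0 : R[i])) (poly_roots (shifted_poly w)).
    by rewrite all_count E size_shifted_roots.
  have -> : S w = 0.
    rewrite /S big_seq big1// => a /(allP all0) /= /eqP ->.
    by rewrite /reflect_fun eqxx.
  by rewrite !mulr0.
by rewrite expRN lnK// posrE subr_gt0 /c ltr_nat.
Qed.

End random_polynomial_roots.

Theorem corollary4 (R : realType) (mu : probability (plane R) R)
    (phi : R -> R)
    (phi_Cc : @Cc_infty R R^o `]1, +oo[ phi)
    (mu_phi : forall A : set (plane R), measurable A ->
       mu A = (\int[lebesgue_measure \x lebesgue_measure]_(w in A)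
                 (phi (Num.sqrt (w.1 ^+ 2 + w.2 ^+ 2)))%:E)%E)
    (d : measure_display) (T : measurableType d) (P : probability T R)
    (Z : forall n : nat, 'I_n -> {RV P >-> plane R})
    (Z_indep : forall n, mutually_independent (Z n))
    (Z_law : forall n (k : 'I_n) (A : set (plane R)), measurable A ->
       distribution P (Z n k) A = mu A) :
  exists G : nat -> T -> {poly R[i]},
    (forall (n : nat) (w : T), (0 < n)%N ->
       let p := random_poly (Z n) w in
       blaschke_factorization (p - p.[0]%:P) (G n w)) /\
    forall h : plane R -> R, @Cc_infty R (R^o * R^o)%type setT h ->
      converges_in_probability P
        (fun n w => \int[empirical_measure (G n w)]_x h x)
        (\int[mu]_x h x).
Proof.
exists (fun n w => inner_free_part (shifted_poly (Z n) w)).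
split=> [n w _ p|h hC]; first exact: inner_free_partP.
have [b b1 mu_supp] := radial_law_bounded phi_Cc mu_phi.
have [C C0 mu_ball] := radial_law_ball phi_Cc mu_phi.
have mu_rotate := radial_law_rotate phi_Cc mu_phi.
have nh := nice_of_Cc hC.
have hE : (fun q => (h \o @of_complex R) (to_complex q)) = h.
  by apply/funext => -[].
have mh : measurable_fun setT h.
  by have := measurable_nice nh; rewrite hE.
have nH := nice_reflect_fun nh.
have IE : \int[mu]_q reflect_fun (h \o @of_complex R) (to_complex q) = \int[mu]_x h x.
  by rewrite (integral_reflect_fun mu_supp nh) hE.
have mX n : measurable_fun setT (fun w =>
    \int[empirical_measure (inner_free_part (shifted_poly (Z n) w))]_x h x).
  (* For [n = 0] the polynomial is 1 and its shift is 0, whatever [w]; the integral is then a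
     constant. *)
  case: n => [|n]; last exact: measurable_integral_inner_free_part.
  rewrite (_ : (fun w => _) = cst (\int[empirical_measure
      (inner_free_part (1 - 1%:P : {poly R[i]}))]_x h x)).
    exact: measurable_cst.
  by apply/funext => w; rewrite /shifted_poly /random_poly big_ord0 hornerC.
split=> // eps eps0; set I := \int[mu]_x h x in IE *.
have I1 : 0 < 1 + `|I| by rewrite ltr_pwDl.
(* The bound [1 / 2] keeps at least [n / 2] roots away from 0, so that the normalisation at most
   doubles the error; the other bound makes the doubled error [2 * (e1 * (1 + |I|))] at most
   [eps]. *)
pose e1 := Num.min (1 / 2) (eps / (2 * (1 + `|I|))).
have e10 : 0 < e1 by rewrite lt_min !divr_gt0// mulr_gt0.
have e1h : e1 <= 1 / 2 by rewrite ge_min lexx.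
have e1e : 2 * (e1 * (1 + `|I|)) <= eps.
  have : e1 <= eps / (2 * (1 + `|I|)) by rewrite ge_min lexx orbT.
  by rewrite ler_pdivlMr ?mulr_gt0// mulrCA.
pose A n := [set w | eps < `|\int[empirical_measure
  (inner_free_part (shifted_poly (Z n) w))]_x h x - I|].
have mA n : measurable (A n).
  apply: measurable_lt; first exact: measurable_cst.
  apply: measurableT_comp; first exact: normr_measurable.
  by apply: measurable_funB => //; exact: measurable_cst.
have main p : 0 < p -> eventually_off P p (fun n w => ~ A n w).
  move=> p0; have p20 : 0 < p / 2 by rewrite divr_gt0.
  have H1 := sample_roots_nice Z_indep Z_law b1 mu_supp C0 mu_ball mu_rotate nH e10 p20.
  have H2 := sample_roots_zero Z_indep Z_law b1 mu_supp C0 mu_ball mu_rotate e10 p20.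
  rewrite (splitr p); apply: (@eventually_off_sub _ _ _ _ _ _ _ 1%N) (eventually_off_and H1 H2).
  move=> n w n0 [h1 h2].
  have zqs := shifted_roots_sample n0 w (erefl (Z n)).
  have sq := size_shifted_roots (Z n) n0 w.
  have {h1 h2} [h1 h2] := (h1 _ zqs sq, h2 _ zqs sq).
  rewrite /A /= integral_empirical_inner_free_part//; apply/negP; rewrite -leNgt.
  move: h1 h2; rewrite IE; set S := \sum_(a <- _) _; set c : R := (count_mem _ _)%:R.
  move=> h1 h2.
  have nR : 0 < (n%:R : R) by rewrite ltr0n.
  have c2 : n%:R / 2 <= n%:R - c.
    by have := ler_wpM2l (ltW nR) e1h; lra.
  have nc0 : 0 < n%:R - c by rewrite (lt_le_trans _ c2)// divr_gt0.
  (* The error splits into the deviation of the sum, at most [n * e1], and the change of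
     normalisation from [n] to [n - c], which contributes [c * I]. *)
  have -> : (n%:R - c)^-1 * S - I = (S - n%:R * I + c * I) / (n%:R - c).
    by field; rewrite gt_eqF.
  rewrite normrM normfV (gtr0_norm nc0) ler_pdivrMr//.
  apply: (le_trans (ler_normD _ _)); rewrite normrM (ger0_norm (ler0n _ _)).
  have h3 : c * `|I| <= n%:R * e1 * `|I| by rewrite ler_wpM2r.
  have h4 : n%:R * (2 * (e1 * (1 + `|I|))) <= n%:R * eps by rewrite ler_wpM2l// ltW.
  have h5 : eps * (n%:R / 2) <= eps * (n%:R - c) by rewrite ler_wpM2l// ltW.
  lra.
apply: cvg_EFin.
  by apply: nearW => n; apply: fin_num_measure; exact: mA.
apply/cvgrPdist_le => p p0; have [n0 Hn0] := main p p0.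
exists n0 => // n /= /Hn0 [B [mB PB HB]].
rewrite sub0r normrN ger0_norm ?fine_ge0//.
rewrite -lee_fin fineK; last by apply: fin_num_measure; exact: mA.
apply: le_trans PB.
apply: le_measure; rewrite ?inE//; first exact: mA.
move=> w Aw; by apply: contrapT => /HB.
Qed.
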